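(* Let $\kappa_0\ge 1$ be a fixed constant and assume $\kappa\le\kappa_0$. Let $c_2,c_3>0$ be arbitrary constants, and let $c_d\ge 2$ and $c_\lambda>0$ be absolute constants. There exist constants $c_0,c_1>0$ (depending only on $\kappa_0,c_2,c_3,c_d,c_\lambda$) such that the following holds. Suppose $p>\frac{c_0\log n}{n}$, $L\le c_2 n^{c_3}$, and $$\frac{n^2pL}{2}\ \ge\ \frac{c_1\, n\log n}{\Delta_K^2}.$$ Then with probability at least $1-O(n^{-5})$, both (i) the spectral method with normalization factor $d=c_d np$ and (ii) the regularized MLE with $\lambda=c_\lambda\sqrt{\frac{np\log n}{L}}$ recover the top-$K$ set exactly, i.e. the $K$ largest entries of the estimate ($\pi$, respectively $\theta$) are strictly larger than all other entries and occur exactly at the indices $\{1,\dots,K\}$.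
   Context: Bradley–Terry–Luce (BTL) setup. There are $n$ items with unknown preference scores $w_1^*\ge w_2^*\ge\cdots\ge w_n^*>0$, all lying in $[w_{\min},w_{\max}]$ with $w_{\min}>0$; set $\theta_i^*=\log w_i^*$ and $\kappa=w_{\max}/w_{\min}$. A comparison graph $\mathcal G=(\{1,\dots,n\},\mathcal E)$ is drawn from the Erdős–Rényi model $\mathcal G_{n,p}$ (each unordered pair is an edge independently with probability $p$). For each edge $(i,j)\in\mathcal E$ one observes $L$ comparisons $y_{i,j}^{(l)}$, $l=1,\dots,L$, where $y_{i,j}^{(l)}=1$ with probability $y^*_{i,j}:=\frac{w_j^*}{w_i^*+w_j^*}$ and $0$ otherwise, with the convention $y_{j,i}^{(l)}=1-y_{i,j}^{(l)}$; all comparisons are mutually independent and independent of $\mathcal G$. Let $y_{i,j}=\frac1L\sum_{l=1}^L y_{i,j}^{(l)}$. Separation: $\Delta_K=\frac{w_K^*-w_{K+1}^*}{w_{\max}}$. Spectral method: for $d>0$ define $P$ by $P_{i,j}=\frac1d y_{i,j}$ if $(i,j)\in\mathcal E$, $P_{i,i}=1-\frac1d\sum_{k:(i,k)\in\mathcal E}y_{i,k}$, and $P_{i,j}=0$ otherwise; $\pi$ is the stationary distribution of $P$ (leading left eigenvector normalized to sum to $1$), and the method outputs the $K$ items with the largest entries of $\pi$. Regularized MLE: with $\mathcal L(\theta;y)=\sum_{(i,j)\in\mathcal E,\,i>j}\{-y_{j,i}(\theta_i-\theta_j)+\log(1+e^{\theta_i-\theta_j})\}$ and $\mathcal L_\lambda(\theta;y)=\mathcal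 L(\theta;y)+\frac\lambda2\|\theta\|_2^2$, the regularized MLE $\theta$ is the minimizer of $\mathcal L_\lambda(\cdot;y)$ over $\mathbb R^n$; the method outputs the $K$ items with the largest entries of $\theta$. *)

(* Defs.v *)
From Stdlib Require Import Reals ClassicalDescription.
From HB Require Import structures.
From mathcomp Require Import all_boot.

Set Implicit Arguments.
Unset Strict Implicit.
Unset Printing Implicit Defensive.

Local Open Scope R_scope.

(* Unordered pairs {i,j}, represented as ordered pairs with i < j. *)
Definition pairT (n : nat) : finType := {x : 'I_n * 'I_n | (x.1 < x.2)%N}.

(* Sample space: an Erdos-Renyi graph (one bit per pair i<j) together with
   L comparison outcomes y_{i,j}^{(l)} for every pair i<j (outcomes on
   non-edges are drawn but never used, which does not change the law of
   the observed data). *)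
Definition Omega (n L : nat) : finType :=
  ({ffun pairT n -> bool} * {ffun (pairT n * 'I_L) -> bool})%type.

Definition Rsum (T : finType) (F : T -> R) : R := \big[Rplus/0]_(x : T) F x.
Definition Rprod (T : finType) (F : T -> R) : R := \big[Rmult/1]_(x : T) F x.

Definition ystar (w : nat -> R) (i j : nat) : R := w j / (w i + w j).

Definition weight (n L : nat) (p : R) (w : nat -> R) (om : Omega n L) : R :=
  Rprod (fun e : pairT n => if om.1 e then p else 1 - p) *
  Rprod (fun el : (pairT n * 'I_L)%type =>
           let i := nat_of_ord (val el.1).1 in
           let j := nat_of_ord (val el.1).2 in
           if om.2 el then ystar w i j else 1 - ystar w i j).

Definition Prob (n L : nat) (p : R) (w : nat -> R) (E : Omega n L -> Prop) : R :=
  Rsum (fun om => if excluded_middle_informative (E om) then weight p w om else 0).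

Definition pedge n L (om : Omega n L) (i j : 'I_n) : bool :=
  match (insub (i, j) : option (pairT n)) with
  | Some e => om.1 e
  | None => false
  end.

Definition adj n L (om : Omega n L) (i j : 'I_n) : bool :=
  pedge om i j || pedge om j i.

Definition yavg n L (om : Omega n L) (e : pairT n) : R :=
  (1 / INR L) * Rsum (fun l : 'I_L => if om.2 (e, l) then 1 else 0).

Definition yhat n L (om : Omega n L) (i j : 'I_n) : R :=
  match (insub (i, j) : option (pairT n)) with
  | Some e => yavg om e
  | None =>
      match (insub (j, i) : option (pairT n)) with
      | Some e => 1 - yavg om e
      | None => 0
      end
  end.

Definition Pmat n L (d : R) (om : Omega n L) (i j : 'I_n) : R :=
  if i == j then
    1 - (1 / d) * Rsum (fun k : 'I_n => if adj om i k then yhat om i k else 0)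
  else if adj om i j then yhat om i j / d else 0.

Definition stationary n L (d : R) (om : Omega n L) (pi : 'I_n -> R) : Prop :=
  Rsum pi = 1 /\
  forall j : 'I_n, Rsum (fun i : 'I_n => pi i * Pmat d om i j) = pi j.

(* The K largest entries of v are strictly larger than all others and
   are at the indices {1..K} (0-based: {0..K-1}). *)
Definition topK n (K : nat) (v : 'I_n -> R) : Prop :=
  forall i j : 'I_n, (i < K)%N -> (K <= j)%N -> v j < v i.

Definition spectral_success n L (K : nat) (d : R) (om : Omega n L) : Prop :=
  (exists pi, stationary d om pi) /\
  (forall pi, stationary d om pi -> topK K pi).

(* Negative log-likelihood:
   sum over edges (i,j) with i > j of -y_{j,i}(th_i - th_j) + log(1+e^{th_i-th_j});
   for a pair e = (a,b) with a < b this is i = b, j = a. *)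
Definition Lfun n L (om : Omega n L) (th : 'I_n -> R) : R :=
  Rsum (fun e : pairT n =>
          let a := (val e).1 in
          let b := (val e).2 in
          if om.1 e
          then - (yavg om e) * (th b - th a) + ln (1 + exp (th b - th a))
          else 0).

Definition Lreg n L (lam : R) (om : Omega n L) (th : 'I_n -> R) : R :=
  Lfun om th + lam / 2 * Rsum (fun i : 'I_n => (th i) ^ 2).

Definition is_rmle n L (lam : R) (om : Omega n L) (th : 'I_n -> R) : Prop :=
  forall th' : 'I_n -> R, Lreg lam om th <= Lreg lam om th'.

Definition mle_success n L (K : nat) (lam : R) (om : Omega n L) : Prop :=
  (exists th, is_rmle lam om th) /\
  (forall th, is_rmle lam om th -> topK K th).

(* Delta_K = (w_K - w_{K+1}) / w_max, 1-based; w here is 0-based. *)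
Definition DeltaK (w : nat -> R) (wmax : R) (K : nat) : R :=
  (w (K - 1)%nat - w K) / wmax.

(* Main.v *)
Require Import Defs.
From mathcomp Require Import Rstruct Rstruct_topology.
From mathcomp Require Import boolp classical_sets reals topology normedtype derive sequences exp.
From Stdlib Require Import Reals.
From HB Require Import structures.
From mathcomp Require Import all_boot.
From mathcomp Require Import all_order all_algebra.
From mathcomp Require Import zify ring lra.
Set Implicit Arguments.
Unset Strict Implicit.
Unset Printing Implicit Defensive.
Import Order.TTheory GRing.Theory Num.Theory.

(* Write q = n p and delta = sqrt (ln n / (q L)).  Both estimators have entrywise relative
   error O(delta), while Delta_K is at least a large multiple of delta.

   Setting pi_i = c w_i (1 + x_i), stationarity of pi becomes a linear system
   sum_i (a_ij x_i - a_ji x_j) = beta_j; linearizing the score equation of the MLE around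
   theta* gives a system of the same form, with the ridge bias lambda theta* added to the
   noise.  Chernoff bounds over all cuts make the comparison graph an expander, so by
   Cheeger's inequality the system is coercive on vectors of sum zero, with constant of
   order q.  The imbalance sum_i (a_ij - a_ji) is small by concentration, so coercivity does
   not require reversibility.

   The entrywise bound is a leave-one-out argument: let x^(m) solve the system in which all
   data on pairs containing m are replaced by their means.  Then x - x^(m) is small in l2
   norm, and since x^(m) is independent of row m, a Bernstein bound controls that row of the
   system applied to x^(m).  Hence |x_m| <= C (delta + eps max |x|), and eps is small.

   For the MLE, if x is the linearized correction, then theta* + x + z and theta* + x - z
   with a constant z of order delta are a super- and a subsolution of the score equation, as
   lambda z dominates the Taylor remainder of order q delta^2; monotonicity of the score
   traps the MLE between them. *)

(** * Flow operators *)

Section FlowOperator.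
Local Open Scope ring_scope.
Variable R : realFieldType.

(** The rates are symmetric in mean: for the spectral chain, u_i times the mean of y_ij is u_i u_j /
    (u_i + u_j); for the MLE the logistic derivative is itself symmetric. Hence each imbalance is a
    difference of two centered sums.

    Since q may be only a constant multiple of ln n, the concentration level eps is a constant
    depending on kappa0, not a vanishing quantity. It only has to be small against the spectral gap,
    so that the terms eps * max |x| can be absorbed on the left.

    The obstacle is that the left-out system may be singular, while restricting to a good event
    before solving it would destroy independence from row m. So a candidate, either a solution or a
    kernel vector, is chosen for every sample from the left-out system alone, and kernel vectors are
    excluded afterwards.

    The calibration q L delta^2 = ln n turns the exponents of the noise bounds into multiples of ln
    n. A failure probability of order n^-8 per event leaves room for a union over the n^2 pairs. *)

Definition sqnorm (T : finType) (x : T -> R) := \sum_i x i ^+ 2.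

Lemma sqnorm_ge0 (T : finType) (x : T -> R) : 0 <= sqnorm x.
Proof. by apply: sumr_ge0 => i _; exact: sqr_ge0. Qed.

Lemma coord_le_sqnorm (T : finType) (x : T -> R) i : x i ^+ 2 <= sqnorm x.
Proof.
rewrite /sqnorm (bigD1 i) //= lerDl.
by apply: sumr_ge0 => j _; exact: sqr_ge0.
Qed.

Lemma sqnorm_eq0 (T : finType) (x : T -> R) : sqnorm x <= 0 -> forall i, x i = 0.
Proof.
move=> x0 i; apply/eqP; rewrite -sqrf_eq0 -(_ : (x i ^+ 2 <= 0) = (x i ^+ 2 == 0)).
  exact: le_trans (coord_le_sqnorm x i) x0.
by rewrite le_eqVlt ltNge sqr_ge0 orbF.
Qed.

Lemma cauchy_schwarz (T : finType) (x y : T -> R) :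
  (\sum_i x i * y i) ^+ 2 <= sqnorm x * sqnorm y.
Proof.
have H : 0 <= \sum_i \sum_j (x i * y j - x j * y i) ^+ 2.
  by apply: sumr_ge0 => i _; apply: sumr_ge0 => j _; exact: sqr_ge0.
have E : \sum_i \sum_j (x i * y j - x j * y i) ^+ 2 =
   (sqnorm x * sqnorm y - (\sum_i x i * y i) ^+ 2) *+ 2.
  rewrite mulr2n {2}/sqnorm [X in _ = _ + (X - _)]mulrC !expr2.
  rewrite /sqnorm !big_distrlr /= -!sumrB -!big_split /=.
  apply: eq_bigr => i _; rewrite -!sumrB -!big_split /=.
  by apply: eq_bigr => j _; ring.
by move: H; rewrite E pmulrn_lge0 // subr_ge0.
Qed.

Lemma dot_le (T : finType) (x y : T -> R) (X Y : R) : 0 <= X -> 0 <= Y ->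
  sqnorm x <= X ^+ 2 -> sqnorm y <= Y ^+ 2 -> `|\sum_i x i * y i| <= X * Y.
Proof.
move=> X0 Y0 hx hy; rewrite -ler_sqr ?nnegrE ?mulr_ge0 //.
rewrite -normrX ger0_norm ?sqr_ge0 // exprMn.
by apply: le_trans (cauchy_schwarz x y) _; apply: ler_pM => //; exact: sqnorm_ge0.
Qed.

Lemma sqnormD_le (T : finType) (x y : T -> R) :
  sqnorm (fun i => x i + y i) <= 2 * sqnorm x + 2 * sqnorm y.
Proof.
rewrite /sqnorm !mulr_sumr -big_split /=; apply: ler_sum => i _.
have := sqr_ge0 (x i - y i); lra.
Qed.

(* The net inflow at j when i sends to j at rate a i j.  Both the stationarity equation of
   the spectral chain and the linearized score equation of the MLE have this form. *)
Definition flow (T : finType) (a : T -> T -> R) (x : T -> R) (j : T) :=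
  \sum_i (a i j * x i - a j i * x j).

Lemma flow_sum0 (T : finType) (a : T -> T -> R) x : \sum_j flow a x j = 0.
Proof.
rewrite /flow; under eq_bigr do rewrite sumrB.
by rewrite sumrB [X in X - _]exchange_big subrr.
Qed.

Lemma flowB (T : finType) (a : T -> T -> R) x y j :
  flow a (fun i => x i - y i) j = flow a x j - flow a y j.
Proof. by rewrite /flow -sumrB; apply: eq_bigr => i _; ring. Qed.

Lemma flowD_cst (T : finType) (a : T -> T -> R) x c j :
  flow a (fun i => c + x i) j = c * \sum_i (a i j - a j i) + flow a x j.
Proof. by rewrite /flow mulr_sumr -big_split; apply: eq_bigr => i _ /=; ring. Qed.

Lemma flowZ (T : finType) (a : T -> T -> R) x c j :
  flow a (fun i => c * x i) j = c * flow a x j.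
Proof. by rewrite /flow mulr_sumr; apply: eq_bigr => i _; ring. Qed.

(** Dirichlet form of the symmetrized rates, corrected by the imbalance: this correction is all that
    non-reversibility costs. *)
Lemma flow_energy (T : finType) (a : T -> T -> R) x :
  - \sum_j x j * flow a x j =
  4^-1 * (\sum_i \sum_j (a i j + a j i) * (x i - x j) ^+ 2)
  - 2^-1 * \sum_j x j ^+ 2 * \sum_i (a i j - a j i).
Proof.
have sw (f : T -> T -> R) : \sum_i \sum_j f i j = \sum_i \sum_j f j i.
  by rewrite exchange_big.
have -> : \sum_i \sum_j (a i j + a j i) * (x i - x j) ^+ 2 =
   2 * \sum_j \sum_i a i j * (x i - x j) ^+ 2.
  have -> : \sum_i \sum_j (a i j + a j i) * (x i - x j) ^+ 2 =
    \sum_i \sum_j a i j * (x i - x j) ^+ 2 + \sum_i \sum_j a j i * (x i - x j) ^+ 2.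
    rewrite -big_split /=; apply: eq_bigr => i _; rewrite -big_split /=.
    by apply: eq_bigr => j _; ring.
  rewrite [X in X + _]sw [X in X + _](_ : _ = \sum_i \sum_j a j i * (x i - x j) ^+ 2).
    by rewrite mulr_natl mulr2n; congr (_ + _); apply: eq_bigr => i _; apply: eq_bigr => j _; ring.
  by apply: eq_bigr => i _; apply: eq_bigr => j _; ring.
(* This sum vanishes by exchanging the indices; adding it makes the two sides agree term by term. *)
have E : \sum_j \sum_i (2^-1 * (a i j * x i ^+ 2) - 2^-1 * (a j i * x j ^+ 2)) = 0.
  under eq_bigr do rewrite sumrB.
  by rewrite sumrB sw subrr.
rewrite -[LHS]addr0 -[X in _ + X = _]E -sumrN !mulr_sumr -sumrB -big_split /=.
apply: eq_bigr => j _; rewrite /flow !mulr_sumr -sumrN -sumrB -big_split /=.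
by apply: eq_bigr => i _; field.
Qed.

Definition coercive (T : finType) (a : T -> T -> R) (g : R) :=
  forall x, \sum_i x i = 0 -> g * sqnorm x <= - \sum_j x j * flow a x j.

(** Cauchy-Schwarz bounds the energy by |x| |flow x|, and one factor |x| cancels. The squared form
    avoids square roots, which a [realFieldType] does not provide. *)
Lemma coercive_bound (T : finType) (a : T -> T -> R) g x :
  0 < g -> coercive a g -> \sum_i x i = 0 ->
  g ^+ 2 * sqnorm x <= sqnorm (flow a x).
Proof.
move=> g0 ca x0; have h1 := ca x x0; have s0 := sqnorm_ge0 x.
have h2 : (g * sqnorm x) ^+ 2 <= sqnorm x * sqnorm (flow a x).
  apply: le_trans (cauchy_schwarz x (flow a x)).
  rewrite -[X in _ <= X ^+ 2]opprK sqrrN; apply: lerXn2r => //.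
    by rewrite nnegrE mulr_ge0 // ltW.
  by rewrite nnegrE; apply: le_trans h1; rewrite mulr_ge0 // ltW.
have [->|sn0] := eqVneq (sqnorm x) 0; first by rewrite mulr0 sqnorm_ge0.
have sp : 0 < sqnorm x by rewrite lt_def s0 andbT.
by rewrite -(ler_pM2l sp); apply: le_trans h2; rewrite exprMn expr2 mulrCA mulrA.
Qed.

(** The 4 compensates the quarter in [flow_energy], and e / 2 pays for the imbalance term. *)
Lemma coercive_of_gap (T : finType) (a : T -> T -> R) (g e : R) :
  (forall x, \sum_i x i = 0 ->
     4 * (g + e / 2) * sqnorm x <= \sum_i \sum_j (a i j + a j i) * (x i - x j) ^+ 2) ->
  (forall j, \sum_i (a i j - a j i) <= e) -> coercive a g.
Proof.
move=> hgap himb x x0; rewrite flow_energy.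
have h1 := hgap x x0.
have h2 : \sum_j x j ^+ 2 * \sum_i (a i j - a j i) <= e * sqnorm x.
  rewrite /sqnorm mulr_sumr; apply: ler_sum => j _.
  by rewrite mulrC; apply: ler_wpM2r; [exact: sqr_ge0 | exact: himb].
lra.
Qed.

(** Fredholm alternative written as a disjunction, so that some x exists for every a before
    invertibility is known. *)
Definition flow_or_kernel n (a : 'I_n -> 'I_n -> R) (r x : 'I_n -> R) :=
  \sum_i x i = 0 /\
  ((forall j, flow a x j = r j) \/ ((exists i, x i != 0) /\ forall j, flow a x j = 0)).

(* Subtracting the all-ones operator makes the flow operator a square system whose
   solutions automatically sum to zero. *)
Lemma flow_solve n (a : 'I_n -> 'I_n -> R) (b : 'I_n -> R) : \sum_j b j = 0 ->
  exists x, flow_or_kernel a b x.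
Proof.
move=> b0.
pose A : 'M[R]_n := \matrix_(i, j) (a i j - (i == j)%:R * (\sum_k a j k) - 1).
have AE (v : 'rV[R]_n) j : (v *m A) 0 j = flow a (v 0) j - \sum_i v 0 i.
  rewrite mxE /flow !sumrB -mulr_suml.
  under eq_bigr do rewrite mxE !mulrBr mulr1.
  rewrite !sumrB; congr (_ - _ - _); first by apply: eq_bigr => i _; rewrite mulrC.
  rewrite (bigD1 j) //= eqxx mul1r [X in _ + X]big1 ?addr0 1?mulrC // => i /negPf ij.
  by rewrite ij mul0r mulr0.
(* The flow part sums to zero, so the coordinates of [v *m A] add up to -n times the sum of v. *)
have sum0 (v : 'rV[R]_n) : \sum_j (v *m A) 0 j = 0 -> \sum_i v 0 i = 0.
  under eq_bigr do rewrite AE.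
  rewrite sumrB flow_sum0 sub0r sumr_const card_ord => /eqP.
  rewrite oppr_eq0 mulrn_eq0 => /orP[/eqP n0|/eqP //].
  by rewrite big1 // => i _; have := ltn_ord i; rewrite [X in (_ < X)%N]n0.
have [uA|nuA] := boolP (A \in unitmx).
  pose v := (\row_j b j) *m invmx A.
  have vA : v *m A = \row_j b j by rewrite mulmxKV.
  have v0 : \sum_i v 0 i = 0.
    by apply: sum0; rewrite vA; under eq_bigr do rewrite mxE.
  exists (v 0); split=> //; left => j.
  by have := AE v j; rewrite vA mxE v0 subr0 => ->.
have : kermx A != 0 by rewrite kermx_eq0 row_free_unit.
case/rowV0Pn => v /sub_kermxP vA vn0.
have v0 : \sum_i v 0 i = 0 by apply: sum0; rewrite vA big1 // => j _; rewrite mxE.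
exists (v 0); split=> //; right; split.
  apply/existsP; apply: contraR vn0 => /existsPn h.
  by apply/eqP/rowP => i; rewrite mxE; apply/eqP; rewrite -[_ == _]negbK h.
by move=> j; have := AE v j; rewrite vA mxE v0 subr0 => <-.
Qed.

End FlowOperator.

(** * Cheeger's inequality *)

Section Cheeger.
Local Open Scope ring_scope.

Lemma pos_neg_parts_le (R : realDomainType) (u v : R) :
  (Num.max u 0 - Num.max v 0) ^+ 2 + (Num.max (- u) 0 - Num.max (- v) 0) ^+ 2
  <= (u - v) ^+ 2.
Proof.
rewrite !maxEle; case: (lerP u 0) => u0; case: (lerP v 0) => v0;
  case: (lerP (- u) 0) => u1; case: (lerP (- v) 0) => v1; nra.
Qed.

Variables (R : realFieldType) (T : finType) (s : T -> T -> R).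
Hypothesis s_ge0 : forall i j, 0 <= s i j.

(* Induction on the support: subtracting the least positive value of phi on its support S
   removes exactly t * cut(S) from the right-hand side. *)
Lemma coarea (h : R) (phi : T -> R) :
  (forall S : {set T}, (2 * #|S| <= #|T|)%N ->
     h * #|S|%:R <= \sum_(i in S) \sum_(j in ~: S) s i j) ->
  (forall i, 0 <= phi i) -> (2 * #|[set i | phi i != 0%R]| <= #|T|)%N ->
  h * \sum_i phi i <= \sum_i \sum_j s i j * Num.max (phi i - phi j) 0.
Proof.
move=> hcut; move En : #|[set i | phi i != 0]| => m.
elim/ltn_ind: m phi En => m IH phi En phi0 hm.
set S := [set i | phi i != 0] in En.
have [S0|[i0 i0S]] := set_0Vmem S.
  rewrite big1 ?mulr0; last first.
    by move=> i _; have /setP/(_ i) := S0; rewrite !inE => /negbT; rewrite negbK => /eqP.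
  apply: sumr_ge0 => i _; apply: sumr_ge0 => j _; apply: mulr_ge0 => //.
  by rewrite le_max lexx orbT.
pose k := [arg min_(i < i0 in S) phi i]%O.
have [kS kmin] : k \in S /\ forall j, j \in S -> phi k <= phi j.
  by rewrite /k; case: arg_minP.
pose t := phi k; pose psi i := phi i - (if i \in S then t else 0).
have outS i : i \notin S -> phi i = 0 by rewrite inE negbK => /eqP.
have t0 : 0 < t by rewrite lt_def phi0 andbT; move: kS; rewrite inE.
have psi0 i : 0 <= psi i.
  by rewrite /psi; case: ifP => iS; rewrite ?subr0 ?phi0 // subr_ge0 kmin.
have psiS i : i \notin S -> psi i = 0.
  by move=> iS; rewrite /psi (negPf iS) outS // subr0.
have hprop : [set i | psi i != 0] \proper S.
  apply/properP; split.
    by apply/subsetP => i; rewrite inE; apply: contraR => /psiS ->.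
  by exists k => //; rewrite inE /psi kS subrr eqxx.
have cpsi := proper_card hprop; rewrite En in cpsi.
have := IH _ cpsi psi erefl psi0.
have -> : (2 * #|[set i | psi i != 0%R]| <= #|T|)%N.
  by apply: leq_trans hm; rewrite leq_mul2l /= ltnW.
move=> /(_ isT) IHpsi.
have -> : \sum_i phi i = \sum_i psi i + t * #|S|%:R.
  rewrite mulr_natr -sumr_const (big_mkcond (fun i => i \in S)) -big_split /=.
  by apply: eq_bigr => i _; rewrite /psi; case: ifP => _; ring.
have -> : \sum_i \sum_j s i j * Num.max (phi i - phi j) 0 =
  \sum_i \sum_j s i j * Num.max (psi i - psi j) 0 +
  t * \sum_(i in S) \sum_(j in ~: S) s i j.
  rewrite mulr_sumr (big_mkcond (fun i => i \in S)) -big_split /=.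
  apply: eq_bigr => i _; case: ifPn => iS; last first.
    rewrite addr0; apply: eq_bigr => j _; congr (_ * _).
    by rewrite (outS i) // (psiS i) // !max_r // sub0r oppr_le0.
  rewrite mulr_sumr (big_mkcond (fun i => i \in ~: S)) -big_split /=.
  apply: eq_bigr => j _; rewrite inE; case: ifPn => jS /=.
    rewrite (outS j) // (psiS j) // !subr0 !max_l // /psi iS; ring.
  by rewrite /psi iS (negPn jS) addr0 opprB addrA subrK.
rewrite mulrDr; apply: lerD => //.
by rewrite mulrCA; apply: ler_wpM2l; [exact: ltW | apply: hcut; rewrite En].
Qed.

Hypothesis s_sym : forall i j, s i j = s j i.

(** [coarea] is applied to y^2; the support condition keeps every level set within the range of the
    cut bound. The differences of squares are then traded for the energy, at the cost of a degree
    term. *)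
Lemma cheeger_half (h D : R) (y : T -> R) : 0 < h -> 0 < D ->
  (forall S : {set T}, (2 * #|S| <= #|T|)%N ->
     h * #|S|%:R <= \sum_(i in S) \sum_(j in ~: S) s i j) ->
  (forall i, \sum_j s i j <= D) ->
  (2 * #|[set i | y i != 0%R]| <= #|T|)%N ->
  h ^+ 2 / D * sqnorm y <= \sum_i \sum_j s i j * (y i - y j) ^+ 2.
Proof.
move=> h0 D0 hcut hD hy; set E := \sum_i _.
have := @coarea h (fun i => y i ^+ 2) hcut (fun i => sqr_ge0 _).
have -> : [set i | y i ^+ 2 != 0] = [set i | y i != 0].
  by apply/setP => i; rewrite !inE sqrf_eq0.
move=> /(_ hy); rewrite -/(sqnorm y) => hco.
have sw (f : T -> T -> R) : \sum_i \sum_j f i j = \sum_i \sum_j f j i.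
  by rewrite exchange_big.
have hmax : \sum_i \sum_j s i j * Num.max (y i ^+ 2 - y j ^+ 2) 0 =
  2^-1 * \sum_i \sum_j s i j * `|y i ^+ 2 - y j ^+ 2|.
  have E0 : \sum_i \sum_j (2^-1 * (s i j * y i ^+ 2) - 2^-1 * (s i j * y j ^+ 2)) = 0.
    under eq_bigr do rewrite sumrB.
    rewrite sumrB [X in _ - X]sw.
    by under [X in _ - X]eq_bigr do under eq_bigr do rewrite s_sym; rewrite subrr.
  rewrite -[RHS]addr0 -[X in _ = _ + X]E0 mulr_sumr -big_split /=.
  apply: eq_bigr => i _; rewrite mulr_sumr -big_split /=.
  apply: eq_bigr => j _; case: (leP 0 (y i ^+ 2 - y j ^+ 2)) => hz.
    by rewrite ger0_norm //; field.
  by rewrite ltr0_norm //; field.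
(* AM-GM with parameter t = D / h: |u^2 - v^2| <= t (u - v)^2 + (u + v)^2 / (4 t). *)
have amgm : \sum_i \sum_j s i j * `|y i ^+ 2 - y j ^+ 2| <=
   D / h * E + h / (4 * D) * \sum_i \sum_j s i j * (2 * y i ^+ 2 + 2 * y j ^+ 2).
  rewrite !mulr_sumr -big_split /=; apply: ler_sum => i _.
  rewrite !mulr_sumr -big_split /=; apply: ler_sum => j _.
  rewrite [D / h * _]mulrCA [h / _ * _]mulrCA -mulrDr; apply: ler_wpM2l => //.
  set u := y i; set v := y j.
  have tp : 0 < D / h by rewrite divr_gt0.
  set tt := D / h in tp *.
  have -> : h / (4 * D) = (4 * tt)^-1 by rewrite /tt; field; rewrite !gt_eqF.
  apply: (@le_trans _ _ (tt * (u - v) ^+ 2 + (4 * tt)^-1 * (u + v) ^+ 2)); last first.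
    rewrite lerD2l; apply: ler_wpM2l; first by rewrite invr_ge0 mulr_ge0 // ltW.
    have := sqr_ge0 (u - v); lra.
  have key e : e ^+ 2 = 1 -> e * (u ^+ 2 - v ^+ 2) <= tt * (u - v) ^+ 2 + (4 * tt)^-1 * (u + v) ^+ 2.
    move=> e1.
    have -> : tt * (u - v) ^+ 2 + (4 * tt)^-1 * (u + v) ^+ 2 =
      e * (u ^+ 2 - v ^+ 2) + (4 * tt)^-1 * (2 * tt * (u - v) - e * (u + v)) ^+ 2
      + (4 * tt)^-1 * (1 - e ^+ 2) * (u + v) ^+ 2.
      by field; rewrite gt_eqF.
    rewrite e1 subrr mulr0 mul0r addr0 lerDl mulr_ge0 ?sqr_ge0 // invr_ge0 mulr_ge0 //.
    exact: ltW.
  have [hz|hz] := leP 0 (u ^+ 2 - v ^+ 2).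
    by rewrite ger0_norm //; have := key 1; rewrite mul1r expr1n; apply.
  by rewrite ltr0_norm //; have := key (-1); rewrite mulN1r sqrrN expr1n; apply.
have hdeg : \sum_i \sum_j s i j * (2 * y i ^+ 2 + 2 * y j ^+ 2) <= 4 * D * sqnorm y.
  have -> : \sum_i \sum_j s i j * (2 * y i ^+ 2 + 2 * y j ^+ 2) =
    4 * \sum_i \sum_j s i j * y i ^+ 2.
    have E1 : \sum_i \sum_j s i j * y j ^+ 2 = \sum_i \sum_j s i j * y i ^+ 2.
      by rewrite sw; apply: eq_bigr => i _; apply: eq_bigr => j _; rewrite s_sym.
    rewrite -[4]/((2 + 2)%:R) natrD mulrDl -{2}E1 !mulr_sumr -big_split /=.
    apply: eq_bigr => i _; rewrite !mulr_sumr -big_split /=.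
    by apply: eq_bigr => j _; ring.
  rewrite -mulrA; apply: ler_wpM2l => //; rewrite /sqnorm mulr_sumr.
  apply: ler_sum => i _; rewrite -mulr_suml; apply: ler_wpM2r => //.
  exact: sqr_ge0.
(* With t = D / h the degree term is exactly [h * sqnorm y], half of the left side, so it can be
   absorbed. *)
have h2 : 2 * h * sqnorm y <= D / h * E + h * sqnorm y.
  have -> : h * sqnorm y = h / (4 * D) * (4 * D * sqnorm y).
    by field; rewrite gt_eqF.
  have : h / (4 * D) * \sum_i \sum_j s i j * (2 * y i ^+ 2 + 2 * y j ^+ 2) <=
         h / (4 * D) * (4 * D * sqnorm y).
    by apply: ler_wpM2l => //; rewrite divr_ge0 ?mulr_ge0 // ltW.
  move: hco; rewrite hmax; move: amgm; lra.
have h3 : h * sqnorm y <= D / h * E by lra.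
have -> : h ^+ 2 / D * sqnorm y = h / D * (h * sqnorm y) by ring.
have -> : E = h / D * (D / h * E) by field; rewrite !gt_eqF.
by apply: ler_wpM2l => //; rewrite divr_ge0 // ltW.
Qed.

(** The median is the least value x k that has at least half of the points at or below it; by
    minimality the next smaller value fails this test, which bounds the set strictly below. *)
Lemma exists_median (x : T -> R) : (0 < #|T|)%N -> exists c,
  (2 * #|[set i | (c < x i)%R]| <= #|T|)%N /\ (2 * #|[set i | (x i < c)%R]| <= #|T|)%N.
Proof.
case/card_gt0P => t0 _.
pose below c := #|[set i | (x i <= c)%R]|.
have [imax _ hmax] := @arg_maxP _ _ _ t0 xpredT x isT.
pose P i := (#|T| <= 2 * below (x i))%N.
have Pmax : P imax.
  rewrite /P /below (_ : [set i | _] = setT) ?cardsT ?leq_pmull //.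
  by apply/setP => i; rewrite !inE; exact: hmax.
have [k Pk hk] := @arg_minP _ _ _ imax P x Pmax.
exists (x k); split.
  have <- : ~: [set i | x i <= x k] = [set i | x k < x i].
    by apply/setP => i; rewrite !inE -ltNge.
  have := cardsC [set i | x i <= x k]; move: Pk; rewrite /P /below; lia.
have [->|[i0 i0S]] := set_0Vmem [set i | x i < x k]; first by rewrite cards0.
have [j jS hj] := @arg_maxP _ _ _ i0 (mem [set i | x i < x k]) x i0S.
have jk : x j < x k by have : j \in [set i | x i < x k] := jS; rewrite inE.
have E : [set i | x i < x k] = [set i | x i <= x j].
  apply/setP => i; rewrite !inE; apply/idP/idP => [h|h].
    have iS : i \in [set i | x i < x k] by rewrite inE.
    exact: hj iS.
  exact: le_lt_trans h jk.
rewrite E ltnW // ltnNge; apply/negP => Pj.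
by have := hk j Pj; rewrite leNgt jk.
Qed.

(** Both parts of x - c around a median c have support at most half, so [cheeger_half] applies to
    each. Splitting does not increase the energy, and since x sums to zero, recentering at c can
    only increase the norm. *)
Lemma cheeger (h D : R) (x : T -> R) : 0 < h -> 0 < D ->
  (forall S : {set T}, (2 * #|S| <= #|T|)%N ->
     h * #|S|%:R <= \sum_(i in S) \sum_(j in ~: S) s i j) ->
  (forall i, \sum_j s i j <= D) -> \sum_i x i = 0 ->
  h ^+ 2 / D * sqnorm x <= \sum_i \sum_j s i j * (x i - x j) ^+ 2.
Proof.
move=> h0 D0 hcut hD x0.
have [T0|Tp] := leqP #|T| 0.
  rewrite /sqnorm !big1 ?mulr0 // => i _; exfalso; move: T0.
    by rewrite leqn0 => /eqP/card0_eq/(_ i); rewrite inE.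
  by rewrite leqn0 => /eqP/card0_eq/(_ i); rewrite inE.
have [c [hc1 hc2]] := exists_median x Tp.
pose y i := Num.max (x i - c) 0; pose z i := Num.max (- (x i - c)) 0.
have supy : [set i | y i != 0] = [set i | c < x i].
  apply/setP => i; rewrite !inE /y; have [xc|xc] := ltrP c (x i).
    by rewrite max_l ?subr_ge0 ?ltW // subr_eq0 gt_eqF.
  by rewrite max_r ?subr_le0 // eqxx.
have supz : [set i | z i != 0] = [set i | x i < c].
  apply/setP => i; rewrite !inE /z; have [xc|xc] := ltrP (x i) c.
    by rewrite max_l ?oppr_ge0 ?subr_le0 ?ltW // oppr_eq0 subr_eq0 lt_eqF.
  by rewrite max_r ?oppr_le0 ?subr_ge0 // eqxx.
have := cheeger_half h0 D0 hcut hD (y := y); rewrite supy => /(_ hc1) Hy.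
have := cheeger_half h0 D0 hcut hD (y := z); rewrite supz => /(_ hc2) Hz.
have Eyz : \sum_i \sum_j s i j * (y i - y j) ^+ 2 + \sum_i \sum_j s i j * (z i - z j) ^+ 2
   <= \sum_i \sum_j s i j * (x i - x j) ^+ 2.
  rewrite -big_split /=; apply: ler_sum => i _; rewrite -big_split /=.
  apply: ler_sum => j _; rewrite -mulrDr; apply: ler_wpM2l => //.
  have -> : x i - x j = (x i - c) - (x j - c) by ring.
  exact: pos_neg_parts_le.
have nyz : sqnorm x <= sqnorm y + sqnorm z.
  have -> : sqnorm y + sqnorm z = \sum_i (x i ^+ 2 + (- (2 * c) * x i + c ^+ 2)).
    rewrite /sqnorm -big_split /=; apply: eq_bigr => i _; rewrite /y /z.
    have [xc|xc] := leP c (x i).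
      by rewrite max_l ?subr_ge0 // max_r ?oppr_le0 ?subr_ge0 //; ring.
    by rewrite max_r ?subr_le0 ?ltW // max_l ?oppr_ge0 ?subr_le0 ?ltW //; ring.
  rewrite 2!big_split /= -mulr_sumr x0 mulr0 add0r lerDl.
  by apply: sumr_ge0 => i _; exact: sqr_ge0.
apply: le_trans Eyz; apply: le_trans (lerD Hy Hz); rewrite -mulrDr.
by apply: ler_wpM2l nyz; rewrite divr_ge0 ?sqr_ge0 // ltW.
Qed.

End Cheeger.

(** * Leave-one-out bound *)

Section LeaveOneOut.
Local Open Scope ring_scope.
Variables (R : realFieldType) (n : nat).

Definition loo (m : 'I_n) (a b : 'I_n -> 'I_n -> R) i j :=
  if (i == m) || (j == m) then b i j else a i j.

Lemma loo_diff_sum m a b (F : 'I_n -> 'I_n -> R -> R) j :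
  (forall i k, F i k 0 = 0) -> j != m ->
  \sum_i F i j (a i j - loo m a b i j) = F m j (a m j - b m j).
Proof.
move=> F0 /negPf jm; rewrite (bigD1 m) //= big1 ?addr0; last first.
  by move=> i /negPf im; rewrite /loo im jm subrr F0.
by rewrite /loo eqxx.
Qed.

Lemma flow_loo_diff m a b (v : 'I_n -> R) j : j != m ->
  flow a v j - flow (loo m a b) v j =
  (a m j - b m j) * v m - (a j m - b j m) * v j.
Proof.
move=> jm; rewrite /flow -sumrB.
rewrite (bigD1 m) //= big1 ?addr0; last first.
  by move=> i im; rewrite /loo !(negPf im) !(negPf jm) subrr.
by rewrite /loo !eqxx !orbT /=; ring.
Qed.

Lemma flow_loo_diff_self m a b (v : 'I_n -> R) :
  flow a v m - flow (loo m a b) v m =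
  \sum_i (a i m - b i m) * v i - (\sum_i (a m i - b m i)) * v m.
Proof.
rewrite /flow mulr_suml -!sumrB; apply: eq_bigr => i _.
by rewrite /loo !eqxx !orbT /=; ring.
Qed.

(** Roles: A is the adjacency matrix, a the random rates, b their means, g the centered noise, f a
    deterministic bias. The target accuracy is delta; Tn and B measure noise and bias in units of q
    * delta, gam is the gap and c1 the row mass in units of q. *)
Variables (A a b g : 'I_n -> 'I_n -> R) (f : 'I_n -> R).
Variables (p q eps gam c1 delta Tn B : R).
Hypotheses (p_gt0 : 0 < p) (p_le1 : p <= 1) (qE : q = n%:R * p) (q_ge1 : 1 <= q).
Hypotheses (eps_gt0 : 0 < eps) (eps_le1 : eps <= 1) (eps_q : 1 <= eps ^+ 2 * q).
Hypotheses (gam_gt0 : 0 < gam) (eps_gam : 16 * eps <= gam).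
Hypotheses (c1_gt0 : 0 < c1) (eps_c1 : eps * (2 + 48 / gam) <= c1 / 2).
Hypotheses (delta_ge0 : 0 <= delta) (Tn_ge0 : 0 <= Tn) (B_ge0 : 0 <= B).
Hypothesis A01 : forall i j, 0 <= A i j <= 1.
Hypothesis A_sym : forall i j, A i j = A j i.
Hypothesis A_deg : forall j, \sum_i A i j <= 2 * q.
Hypothesis a_le : forall i j, 0 <= a i j <= A i j.
Hypothesis b_le : forall i j, 0 <= b i j <= p.
Hypothesis a_coercive : coercive a (gam * q).
Hypothesis a_row : forall m, c1 * q <= \sum_i a m i.
Hypothesis a_conc : forall m, `|\sum_i (a m i - b m i)| <= eps * q.
Hypothesis f_le : forall j, `|f j| <= B * q * delta.
Hypothesis g_le : forall i j, g i j ^+ 2 <= Tn ^+ 2 * q * delta ^+ 2 * A i j.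
Hypothesis g_conc : forall j, `|\sum_i g i j| <= Tn * q * delta.

Let q_gt0 : 0 < q. Proof. exact: lt_le_trans q_ge1. Qed.

(** Coordinate m is a full row and is handled by concentration (the 4). Any other j sees only the
    pair {j, m}; as A and p lie in [0, 1], these squares sum to at most 24 V^2 q, and [eps_q]
    converts this to the same scale (the 24). *)
Lemma loo_residual m (v : 'I_n -> R) (V : R) :
  (forall i, `|v i| <= V) ->
  `|\sum_i (a i m - b i m) * v i| <= eps * q * V ->
  sqnorm (fun j => flow a v j - flow (loo m a b) v j)
    <= 28 * (eps * q * V) ^+ 2.
Proof.
move=> hV hm; have V0 : 0 <= V by apply: le_trans (hV m).
have hself : (flow a v m - flow (loo m a b) v m) ^+ 2 <= 4 * (eps * q * V) ^+ 2.
  rewrite flow_loo_diff_self -(ger0_norm (sqr_ge0 _)) normrX.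
  rewrite (_ : 4 * _ = (2 * (eps * q * V)) ^+ 2); last by ring.
  apply: lerXn2r; rewrite ?nnegrE ?normr_ge0 ?mulr_ge0 ?(ltW eps_gt0) ?(ltW q_gt0) //.
  apply: le_trans (ler_normB _ _) _; rewrite mulr_natl mulr2n; apply: lerD => //.
  by rewrite normrM; apply: ler_pM.
have hother j : j != m -> (flow a v j - flow (loo m a b) v j) ^+ 2
    <= 8 * V ^+ 2 * (A j m + p).
  move=> jm; rewrite flow_loo_diff //.
  have hab i k : `|a i k - b i k| <= A i k + p.
    have /andP[a0 a1] := a_le i k; have /andP[b0 b1] := b_le i k.
    rewrite ler_norml; lra.
  have /andP[A0 A1] := A01 j m.
  apply: (@le_trans _ _ ((2 * ((A j m + p) * V)) ^+ 2)).
    rewrite -(ger0_norm (sqr_ge0 _)) normrX; apply: lerXn2r; rewrite ?nnegrE ?normr_ge0 //.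
      by rewrite !mulr_ge0 // addr_ge0 // ltW.
    apply: le_trans (ler_normB _ _) _; rewrite mulr_natl mulr2n !normrM; apply: lerD.
      by apply: ler_pM => //; rewrite (A_sym j).
    exact: ler_pM.
  rewrite (_ : (2 * _) ^+ 2 = 4 * V ^+ 2 * (A j m + p) ^+ 2); last by ring.
  rewrite (_ : 8 * V ^+ 2 * (A j m + p) = 4 * V ^+ 2 * (2 * (A j m + p))); last by ring.
  apply: ler_wpM2l; first by rewrite mulr_ge0 ?sqr_ge0.
  have := sqr_ge0 (A j m - p); have : A j m ^+ 2 <= A j m by rewrite expr2 ler_piMl.
  have : p ^+ 2 <= p by rewrite expr2 ler_piMl // ltW.
  lra.
rewrite /sqnorm (bigD1 m) //= (_ : 28 * _ = 4 * (eps * q * V) ^+ 2 + 24 * (eps * q * V) ^+ 2); last by ring.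
apply: lerD => //.
apply: (@le_trans _ _ (\sum_j 8 * V ^+ 2 * (A j m + p))).
  rewrite [leRHS](bigID (fun j => j != m)) /= -[leLHS]addr0; apply: lerD.
    exact: ler_sum.
  apply: sumr_ge0 => j _; have /andP[A0 _] := A01 j m.
  by rewrite mulr_ge0 ?addr_ge0 ?(ltW p_gt0) // mulr_ge0 ?sqr_ge0.
have sp : \sum_(j < n) p = q by rewrite sumr_const card_ord -mulr_natl qE.
rewrite -mulr_sumr big_split /= sp.
apply: (@le_trans _ _ (8 * V ^+ 2 * (3 * q))).
  apply: ler_wpM2l; first by rewrite mulr_ge0 ?sqr_ge0.
  have := A_deg m; lra.
rewrite (_ : _ * (3 * q) = 24 * (V ^+ 2 * q * 1)); last by ring.
rewrite (_ : 24 * (eps * q * V) ^+ 2 = 24 * (V ^+ 2 * q * (eps ^+ 2 * q))); last by ring.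
by rewrite ler_pM2l //; apply: ler_wpM2l => //; rewrite mulr_ge0 ?sqr_ge0 // ltW.
Qed.

(** The noise is centered, so its mean value 0 replaces it on the pairs with m; the deterministic f
    stays. *)
Definition loo_rhs m j := f j + \sum_i loo m g (fun _ _ => 0) i j.

(** Coordinate m loses a whole noise sum, controlled by [g_conc]; each other coordinate loses one
    entry, and [g_le] with the degree bound sums these squares. *)
Lemma loo_rhs_diff m : sqnorm (fun j => f j + \sum_i g i j - loo_rhs m j)
  <= 3 * (Tn * q * delta) ^+ 2.
Proof.
have E j : f j + \sum_i g i j - loo_rhs m j =
    \sum_i (g i j - loo m g (fun _ _ => 0) i j).
  by rewrite /loo_rhs sumrB; ring.
rewrite /sqnorm (bigD1 m) //= E.
rewrite (_ : 3 * _ = (Tn * q * delta) ^+ 2 + 2 * (Tn * q * delta) ^+ 2); last by ring.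
apply: lerD.
  under eq_bigr do rewrite /loo eqxx orbT subr0.
  rewrite -(ger0_norm (sqr_ge0 _)) normrX; apply: lerXn2r => //; rewrite nnegrE ?normr_ge0 //.
  by rewrite !mulr_ge0 // ltW.
apply: (@le_trans _ _ (\sum_j Tn ^+ 2 * q * delta ^+ 2 * A j m)).
  rewrite [leRHS](bigID (fun j => j != m)) /= -[leLHS]addr0; apply: lerD.
    apply: ler_sum => j jm; rewrite E (@loo_diff_sum m g _ (fun _ _ x => x)) // subr0.
    by rewrite (A_sym j).
  apply: sumr_ge0 => j _; have /andP[A0 _] := A01 j m.
  by rewrite mulr_ge0 // !mulr_ge0 ?sqr_ge0 // ltW.
rewrite -mulr_sumr.
apply: (@le_trans _ _ (Tn ^+ 2 * q * delta ^+ 2 * (2 * q))).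
  by apply: ler_wpM2l => //; rewrite !mulr_ge0 ?sqr_ge0 // ltW.
by rewrite le_eqVlt; apply/orP; left; apply/eqP; ring.
Qed.

Variables (x : 'I_n -> R) (v : 'I_n -> 'I_n -> R).
Hypothesis x_sum : \sum_i x i = 0.
Hypothesis x_flow : forall j, flow a x j = f j + \sum_i g i j.
Hypothesis v_cand : forall m, flow_or_kernel (loo m a b) (loo_rhs m) (v m).
Hypothesis v_conc : forall m (V : R), (forall i, `|v m i| <= V) ->
  `|\sum_i (a i m - b i m) * v m i| <= eps * q * V.

Lemma sup_norm_attained (y : 'I_n -> R) (m : 'I_n) :
  exists k, forall i, `|y i| <= `|y k|.
Proof.
by have [k _ hk] := @arg_maxP _ _ _ m xpredT (fun i => `|y i|) isT; exists k => i; exact: hk.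
Qed.

(* A kernel vector of the left-out operator would also satisfy v_conc, so it would nearly lie
   in the kernel of flow a, against coercivity. *)
Lemma loo_solution m j : flow (loo m a b) (v m) j = loo_rhs m j.
Proof.
have [v0 [//|[[i vi0] vker]]] := v_cand m; exfalso.
have [k hk] := sup_norm_attained (v m) m.
have := loo_residual hk (v_conc hk).
have -> : sqnorm (fun j => flow a (v m) j - flow (loo m a b) (v m) j) = sqnorm (flow a (v m)).
  by apply: eq_bigr => j' _; rewrite vker subr0.
move=> hres.
have := le_trans (coercive_bound (mulr_gt0 gam_gt0 q_gt0) a_coercive v0) hres.
apply/negP; rewrite -ltNge.
have vk : `|v m k| ^+ 2 <= sqnorm (v m) by rewrite -normrX ger0_norm ?sqr_ge0 ?coord_le_sqnorm.
have vp : 0 < `|v m k| ^+ 2.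
  by rewrite exprn_gt0 // (lt_le_trans _ (hk i)) // normr_gt0.
rewrite (_ : 28 * _ = (28 * eps ^+ 2 * q ^+ 2) * `|v m k| ^+ 2); last by ring.
apply: (@lt_le_trans _ _ ((gam * q) ^+ 2 * `|v m k| ^+ 2)).
  rewrite ltr_pM2r // exprMn ltr_pM2r ?exprn_gt0 //.
  have : (16 * eps) ^+ 2 <= gam ^+ 2 by apply: lerXn2r => //; rewrite nnegrE ?mulr_ge0 ?ltW.
  have : 0 < eps ^+ 2 by rewrite exprn_gt0.
  rewrite exprMn; lra.
by apply: ler_wpM2l => //; rewrite sqr_ge0.
Qed.

(* The equation of row m expresses x m through the sums of (a i m - b i m) * v m i, which are
   small because v m ignores row m, and through x - v m, which is small in l2 norm. *)
Lemma loo_bound m : `|x m| <= 2 / c1 * (24 * Tn / gam + (B + Tn) * (1 + 1 / gam)) * delta.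
Proof.
(* At the largest coordinate, X below is the sup norm of x and errors proportional to it can be
   absorbed. *)
wlog hmax : m / forall i, `|x i| <= `|x m|.
  by move=> hw; have [k hk] := sup_norm_attained x m; apply: le_trans (hk m) (hw k hk).
set X := `|x m|; pose D i := x i - v m i.
have D0 : \sum_i D i = 0 by rewrite sumrB x_sum (v_cand m).1 subrr.
have [k hk] := sup_norm_attained (v m) m; set V := `|v m k| in hk.
have V0 : 0 <= V by rewrite normr_ge0.
have X0 : 0 <= X by rewrite normr_ge0.
have gi : 0 < gam^-1 by rewrite invr_gt0.
(* Coercivity gives |D|^2 with coefficients 2 * 3 = 6 and 2 * 28 = 56; they are rounded up to the
   squares 9 and 64. *)
pose d := (3 * Tn * delta + 8 * eps * V) / gam.
have d0 : 0 <= d by rewrite divr_ge0 ?(ltW gam_gt0) // addr_ge0 // !mulr_ge0 // ltW.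
have hD : sqnorm D <= d ^+ 2.
  have h := coercive_bound (mulr_gt0 gam_gt0 q_gt0) a_coercive D0.
  have E j : flow a D j = (f j + \sum_i g i j - loo_rhs m j)
                + (- (flow a (v m) j - flow (loo m a b) (v m) j)).
    by rewrite flowB x_flow loo_solution; ring.
  have : sqnorm (flow a D) <= 2 * (3 * (Tn * q * delta) ^+ 2) + 2 * (28 * (eps * q * V) ^+ 2).
    rewrite (_ : sqnorm (flow a D) = sqnorm (fun j => (f j + \sum_i g i j - loo_rhs m j)
                + (- (flow a (v m) j - flow (loo m a b) (v m) j)))); last first.
      by apply: eq_bigr => j _; rewrite E.
    apply: le_trans (sqnormD_le _ _) _; apply: lerD; apply: ler_wpM2l => //.
      exact: loo_rhs_diff.
    rewrite [leLHS](_ : _ = sqnorm (fun j => flow a (v m) j - flow (loo m a b) (v m) j)).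
      exact: loo_residual hk (v_conc hk).
    by apply: eq_bigr => j _; rewrite sqrrN.
  move=> /(le_trans h) {}h.
  rewrite -(ler_pM2l (_ : 0 < (gam * q) ^+ 2)) ?exprn_gt0 ?mulr_gt0 //.
  apply: le_trans h _; rewrite /d -exprMn.
  rewrite (_ : _ * (_ / gam) = q * (3 * Tn * delta + 8 * eps * V)); last by field; rewrite gt_eqF.
  have h1 : 0 <= Tn * delta * (eps * V) by rewrite !mulr_ge0 // ltW.
  have h2 := sqr_ge0 (Tn * delta); have h3 := sqr_ge0 (eps * V).
  rewrite (_ : 2 * _ + _ = q ^+ 2 * (6 * (Tn * delta) ^+ 2 + 56 * (eps * V) ^+ 2)); last by ring.
  rewrite [leRHS]exprMn; apply: ler_wpM2l; first exact: sqr_ge0.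
  rewrite (_ : (3 * _ * _ + _) ^+ 2 = 9 * (Tn * delta) ^+ 2 + 64 * (eps * V) ^+ 2 +
     48 * (Tn * delta * (eps * V))); last by ring.
  lra.
have Di i : `|D i| <= d.
  rewrite -ler_sqr ?nnegrE // -normrX ger0_norm ?sqr_ge0 //.
  exact: le_trans (coord_le_sqnorm D i) hD.
have dE : d = 3 * (Tn * delta * gam^-1) + 8 * (eps * V * gam^-1) by rewrite /d; ring.
have epsg : 16 * (eps * gam^-1) <= 1.
  by rewrite mulrA ler_pdivrMr // mul1r.
(* Since 16 eps <= gam, the V-part of d is at most V / 2, so V is bounded by the sup norm of x
   itself. *)
have hVX : V <= 2 * X + 6 * (Tn * delta * gam^-1).
  have : V <= X + d.
    rewrite /V (_ : v m k = x k - D k); last by rewrite /D; ring.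
    by apply: le_trans (ler_normB _ _) _; apply: lerD.
  have : 16 * (eps * gam^-1) * V <= 1 * V by apply: ler_wpM2r.
  rewrite dE; lra.
have hd : d <= 6 * (Tn * delta * gam^-1) + 16 * (eps * gam^-1 * X).
  have : 16 * (eps * gam^-1) * (Tn * delta * gam^-1) <= 1 * (Tn * delta * gam^-1).
    by apply: ler_wpM2r => //; rewrite !mulr_ge0 // ltW.
  have : (eps * gam^-1) * V <= (eps * gam^-1) * (2 * X + 6 * (Tn * delta * gam^-1)).
    by apply: ler_wpM2l => //; rewrite mulr_ge0 // ltW.
  rewrite dE; lra.
have beta_le j : `|f j + \sum_i g i j| <= (B + Tn) * q * delta.
  by apply: le_trans (ler_normD _ _) _; rewrite !mulrDl; apply: lerD.
have n0 : 0 <= n%:R :> R by rewrite ler0n.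
have n1 : 1 <= n%:R :> R by rewrite ler1n; apply: leq_ltn_trans (ltn_ord m).
have BT0 : 0 <= B + Tn by rewrite addr_ge0.
have cst_sum (c : R) : n%:R * c = \sum_(j < n) c.
  by rewrite sumr_const card_ord mulr_natl.
have hx2 : sqnorm x <= n%:R * ((B + Tn) * delta / gam) ^+ 2.
  rewrite -(ler_pM2l (_ : 0 < (gam * q) ^+ 2)) ?exprn_gt0 ?mulr_gt0 //.
  apply: le_trans (coercive_bound (mulr_gt0 gam_gt0 q_gt0) a_coercive x_sum) _.
  rewrite (_ : (gam * q) ^+ 2 * _ = n%:R * ((B + Tn) * q * delta) ^+ 2); last first.
    by field; rewrite gt_eqF.
  rewrite (cst_sum (((B + Tn) * q * delta) ^+ 2)).
  apply: ler_sum => j _.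
  rewrite x_flow -(ger0_norm (sqr_ge0 _)) normrX; apply: lerXn2r (beta_le j); rewrite nnegrE ?normr_ge0 //.
  by rewrite !mulr_ge0 // ltW.
have b2 : sqnorm (fun i => b i m) <= n%:R * p ^+ 2.
  rewrite (cst_sum (p ^+ 2)).
  apply: ler_sum => j _.
  by have /andP[b0 b1] := b_le j m; apply: lerXn2r => //; rewrite nnegrE // ltW.
(* A column of means has norm at most p sqrt n, and x has norm at most sqrt n times order delta: the
   crude l2 bound already gives the right order q * delta. *)
have t1 : `|\sum_i b i m * x i| <= q * ((B + Tn) * delta / gam).
  rewrite -ler_sqr ?nnegrE ?mulr_ge0 ?invr_ge0 ?(ltW q_gt0) ?(ltW gam_gt0) //.
  rewrite -normrX ger0_norm ?sqr_ge0 //; apply: le_trans (cauchy_schwarz _ _) _.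
  apply: le_trans (ler_pM (sqnorm_ge0 _) (sqnorm_ge0 _) b2 hx2) _.
  by rewrite qE le_eqVlt; apply/orP; left; apply/eqP; ring.
have t2 : `|\sum_i b i m * D i| <= q * d.
  apply: dot_le => //; first exact: ltW.
  apply: le_trans b2 _; rewrite qE exprMn; apply: ler_wpM2r; first exact: sqr_ge0.
  by rewrite expr2 ler_peMl.
have t3 : `|\sum_i a i m * D i| <= 2 * q * d.
  apply: dot_le => //; first by rewrite mulr_ge0 // ltW.
  apply: (@le_trans _ _ (2 * q)).
    apply: le_trans (A_deg m); apply: ler_sum => i _.
    have /andP[a0 a1] := a_le i m; have /andP[A0 A1] := A01 i m.
    apply: le_trans (a1); rewrite expr2 ler_piMl //; lra.
  by rewrite expr2 ler_peMl ?mulr_ge0 ?(ltW q_gt0) //; move: q_ge1; lra.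
have t4 := v_conc hk.
have rowE : (\sum_i a m i) * x m = \sum_i (a i m - b i m) * v m i + \sum_i b i m * x i
   - \sum_i b i m * D i + \sum_i a i m * D i - (f m + \sum_i g i m).
  rewrite -x_flow /flow mulr_suml -!sumrN -!big_split /=.
  by apply: eq_bigr => i _; rewrite /D; ring.
have hrow : c1 * q * X <= eps * q * V + q * ((B + Tn) * delta / gam) + q * d + 2 * q * d
   + (B + Tn) * q * delta.
  apply: (@le_trans _ _ (`|(\sum_i a m i) * x m|)).
    rewrite normrM; apply: ler_wpM2r => //; apply: le_trans (a_row m) _; exact: ler_norm.
  rewrite rowE; apply: le_trans (ler_normB _ _) _; apply: lerD => //.
  apply: le_trans (ler_normD _ _) _; apply: lerD => //.
  apply: le_trans (ler_normB _ _) _; apply: lerD => //.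
  by apply: le_trans (ler_normD _ _) _; apply: lerD.
have hrow2 : c1 * X <= eps * V + (B + Tn) * delta / gam + 3 * d + (B + Tn) * delta.
  rewrite -(ler_pM2l q_gt0); move: hrow; lra.
have e1 : eps * V <= eps * (2 * X + 6 * (Tn * delta * gam^-1)).
  by apply: ler_wpM2l => //; exact: ltW.
have e2 : eps * (Tn * delta * gam^-1) <= 1 * (Tn * delta * gam^-1).
  by apply: ler_wpM2r => //; rewrite !mulr_ge0 // ltW.
(* The 2 comes from [eps * V], the 48 from [3 * d]; together they use up at most half of
   [c1 * X]. *)
have e3 : eps * (2 + 48 / gam) * X <= c1 / 2 * X by apply: ler_wpM2r.
rewrite -(ler_pM2l c1_gt0).
rewrite (_ : c1 * (2 / c1 * _ * _) =
   2 * (24 * (Tn * delta * gam^-1) + (B + Tn) * delta + (B + Tn) * delta / gam)); last first.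
  by field; rewrite !gt_eqF.
lra.
Qed.

End LeaveOneOut.

(** * Product measures and exponential moments *)

Section ProductMeasure.
Local Open Scope ring_scope.
Variables (R : realType) (I X : finType) (W : I -> X -> R).
Hypothesis W_ge0 : forall i x, 0 <= W i x.
Hypothesis W_sum : forall i, \sum_x W i x = 1.

Definition prodw (om : {ffun I -> X}) := \prod_i W i (om i).
Definition Ex (F : {ffun I -> X} -> R) := \sum_om prodw om * F om.
Definition Pr (E : {ffun I -> X} -> Prop) := \sum_(om | `[< E om >]) prodw om.

Lemma prodw_ge0 om : 0 <= prodw om.
Proof. exact: prodr_ge0. Qed.

Lemma Ex_prod (h : I -> X -> R) :
  Ex (fun om => \prod_i h i (om i)) = \prod_i \sum_x W i x * h i x.
Proof. by rewrite bigA_distr_bigA; apply: eq_bigr => om _; rewrite -big_split. Qed.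

Lemma prodw_total : \sum_om prodw om = 1.
Proof.
have := Ex_prod (fun _ _ => 1); rewrite [RHS]big1; last first.
  by move=> i _; under eq_bigr do rewrite mulr1.
by move=> <-; apply: eq_bigr => om _; rewrite big1 ?mulr1.
Qed.

(** Injectivity makes the factors read distinct coordinates, hence independent; coordinates outside
    the image integrate to 1. *)
Lemma Ex_prod_inj (T : finType) (Q : {pred T}) (pos : T -> I) (h : T -> X -> R) :
  {in Q &, injective pos} ->
  Ex (fun om => \prod_(t in Q) h t (om (pos t))) =
  \prod_(t in Q) \sum_x W (pos t) x * h t x.
Proof.
move=> inj.
pose k i x := \prod_(t in Q | pos t == i) h t x.
have -> : Ex (fun om => \prod_(t in Q) h t (om (pos t))) =
          Ex (fun om => \prod_i k i (om i)).
  apply: eq_bigr => om _; congr (_ * _).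
  rewrite (partition_big pos predT) //=; apply: eq_bigr => i _.
  by apply: eq_bigr => t /andP[_ /eqP ->].
rewrite Ex_prod (partition_big pos predT) //=; apply: eq_bigr => i _.
case: (pickP [pred t in Q | pos t == i]) => [t /andP[/= tQ /eqP ti]|none]; last first.
  rewrite [RHS]big_pred0 //; under eq_bigr do rewrite /k big_pred0 // mulr1.
  exact: W_sum.
have Eu t' : (t' \in Q) && (pos t' == i) = (t' == t).
  apply/idP/eqP => [/andP[t'Q /eqP t'i]|->]; last by rewrite tQ ti eqxx.
  by apply: inj => //; rewrite ti t'i.
rewrite (eq_bigl (pred1 t)) // big_pred1_eq ti.
by apply: eq_bigr => x _; rewrite /k (eq_bigl (pred1 t)) // big_pred1_eq.
Qed.

Lemma le_Pr (E F : {ffun I -> X} -> Prop) : (forall om, E om -> F om) -> Pr E <= Pr F.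
Proof.
move=> EF; rewrite /Pr [leRHS]big_mkcond [leLHS]big_mkcond /=.
apply: ler_sum => om _; case: asboolP => [/EF|_].
  by case: asboolP.
by case: ifP => _; rewrite ?prodw_ge0.
Qed.

Lemma Pr_union (T : finType) (Q : {pred T}) (E : T -> {ffun I -> X} -> Prop) :
  Pr (fun om => exists2 t, t \in Q & E t om) <= \sum_(t in Q) Pr (E t).
Proof.
rewrite /Pr; under [leRHS]eq_bigr do rewrite big_mkcond.
rewrite exchange_big /= big_mkcond /=; apply: ler_sum => om _.
have nn t : 0 <= (if `[< E t om >] then prodw om else 0) by case: ifP => _; rewrite ?prodw_ge0.
case: asboolP => [[t tQ Et]|_]; last exact: sumr_ge0.
rewrite (bigD1 t) //= (introT (asboolP _) Et) lerDl; exact: sumr_ge0.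
Qed.

Lemma Pr_or (E F : {ffun I -> X} -> Prop) : Pr (fun om => E om \/ F om) <= Pr E + Pr F.
Proof.
have := Pr_union predT (fun b : bool => if b then E else F).
rewrite /= big_bool /=; apply: le_trans; apply: le_Pr => om.
by case=> h; [exists true|exists false].
Qed.

Lemma Pr_compl E : 1 - Pr (fun om => ~ E om) <= Pr E.
Proof.
rewrite lerBlDr -prodw_total /Pr (bigID (fun om => `[< E om >])) /= lerD2l.
rewrite [leLHS]big_mkcond [leRHS]big_mkcond /=.
by apply: ler_sum => om _; case: asboolP => h; case: asboolP => //=; rewrite ?prodw_ge0.
Qed.

Lemma markov_Ex E (F : {ffun I -> X} -> R) : (forall om, 0 <= F om) ->
  (forall om, E om -> 1 <= F om) -> Pr E <= Ex F.
Proof.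
move=> F0 F1; rewrite /Pr big_mkcond /=; apply: ler_sum => om _.
case: asboolP => [/F1 h|_]; first by rewrite ler_peMr ?prodw_ge0.
by rewrite mulr_ge0 ?prodw_ge0.
Qed.

(** Markov's inequality for the exponential of the sum minus r. The tilting parameter is already
    part of h and r. *)
Lemma chernoff (T : finType) (Q : {pred T}) (pos : T -> I) (h : T -> X -> R)
    (u : T -> R) (r : R) :
  {in Q &, injective pos} ->
  (forall t, t \in Q -> \sum_x W (pos t) x * expR (h t x) <= expR (u t)) ->
  Pr (fun om => r <= \sum_(t in Q) h t (om (pos t))) <= expR (\sum_(t in Q) u t - r).
Proof.
move=> inj hu.
apply: le_trans (markov_Ex (F := fun om => expR (- r) * \prod_(t in Q) expR (h t (om (pos t)))) _ _) _.
- by move=> om; rewrite mulr_ge0 ?expR_ge0 //; apply: prodr_ge0 => t _; exact: expR_ge0.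
- by move=> om hr; rewrite -expR_sum -expRD -expR0 ler_expR addrC subr_ge0.
have -> (F : {ffun I -> X} -> R) c : Ex (fun om => c * F om) = c * Ex F.
  by rewrite /Ex mulr_sumr; apply: eq_bigr => om _; rewrite mulrCA.
rewrite (Ex_prod_inj (fun t x => expR (h t x)) inj) addrC expRD expR_sum.
apply: ler_wpM2l; first exact: expR_ge0.
apply: ler_prod => t tQ; rewrite hu // andbT.
by apply: sumr_ge0 => x _; rewrite mulr_ge0 ?expR_ge0.
Qed.

Definition merge (S : {set I}) (om0 om1 : {ffun I -> X}) : {ffun I -> X} :=
  [ffun i => if i \in S then om1 i else om0 i].

(** Resampling the coordinates in S from an independent copy preserves the law. By linearity it
    suffices to test F on point masses, which are products over coordinates. *)
Lemma Ex_merge (S : {set I}) F :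
  \sum_om0 \sum_om1 prodw om0 * prodw om1 * F (merge S om0 om1) = Ex F.
Proof.
have indE (om om' : {ffun I -> X}) : (om == om')%:R = \prod_i (om i == om' i)%:R :> R.
  have [->|/eqP ne] := eqVneq om om'; first by rewrite big1 // => i _; rewrite eqxx.
  have /existsP[i /negPf ni] : [exists i, om i != om' i].
    by apply/existsP; apply: contra_notP ne => /forallNP h; apply/ffunP => i; have /negP := h i; rewrite negbK => /eqP.
  by rewrite (bigD1 i) //= ni mul0r.
have FE om : F om = \sum_om' F om' * (om == om')%:R.
  rewrite (bigD1 om) //= eqxx mulr1 big1 ?addr0 // => om' /negPf ne.
  by rewrite eq_sym ne mulr0.
under eq_bigr do under eq_bigr do rewrite FE mulr_sumr.
under eq_bigr do rewrite exchange_big /=.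
rewrite exchange_big /=; apply: eq_bigr => om _.
rewrite [RHS]mulrC.
have -> : prodw om = (\prod_i \sum_x W i x * (if i \in S then 1 else (x == om i)%:R)) *
                     (\prod_i \sum_x W i x * (if i \in S then (x == om i)%:R else 1)).
  rewrite -big_split /=; apply: eq_bigr => i _.
  have e1 : \sum_x W i x * 1 = 1 by under eq_bigr do rewrite mulr1.
  have e2 : \sum_x W i x * (x == om i)%:R = W i (om i).
    rewrite (bigD1 (om i)) //= eqxx mulr1 big1 ?addr0 // => x /negPf ->.
    by rewrite mulr0.
  by case: (i \in S); rewrite e1 e2 ?mul1r ?mulr1.
rewrite -(Ex_prod (fun i x => if i \in S then 1 else (x == om i)%:R)).
rewrite -(Ex_prod (fun i x => if i \in S then (x == om i)%:R else 1)).
rewrite /Ex big_distrlr /= mulr_sumr; apply: eq_bigr => om0 _.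
rewrite mulr_sumr; apply: eq_bigr => om1 _; rewrite indE.
have -> : \prod_i (merge S om0 om1 i == om i)%:R =
   (\prod_i (if i \in S then 1 else (om0 i == om i)%:R)) *
   (\prod_i (if i \in S then (om1 i == om i)%:R else 1)) :> R.
  rewrite -big_split /=; apply: eq_bigr => i _; rewrite ffunE.
  by case: (i \in S); rewrite ?mul1r ?mulr1.
by ring.
Qed.

(** Conditioning by Fubini: the coordinates outside S are frozen at [om0], and only those in S
    remain random. *)
Lemma Pr_cond (S : {set I}) E B :
  (forall om0, Pr (fun om1 => E (merge S om0 om1)) <= B) -> Pr E <= B.
Proof.
move=> hB.
have PrE E' : Pr E' = Ex (fun om => (`[< E' om >])%:R).
  by rewrite /Pr /Ex big_mkcond; apply: eq_bigr => om _; case: ifP; rewrite ?mulr1 ?mulr0.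
rewrite PrE -(Ex_merge S) -[leRHS]mul1r -[X in _ <= X * _]prodw_total mulr_suml.
apply: ler_sum => om0 _; under eq_bigr do rewrite -mulrA.
by rewrite -mulr_sumr; apply: ler_wpM2l; [exact: prodw_ge0 | have := hB om0; rewrite PrE].
Qed.

End ProductMeasure.

Section ExponentialMoments.
Local Open Scope ring_scope.
Variable R : realType.

(** From 1 - x <= exp (- x) one gets exp x <= 1 / (1 - x), and (1 + x + 2 x^2) (1 - x) = 1 + x^2 (1
    - 2 x). *)
Lemma expR_le_quadratic (x : R) : x <= 2^-1 -> expR x <= 1 + x + 2 * x ^+ 2.
Proof.
move=> hx; have h : 1 - x <= expR (- x) by apply: expR_ge1Dx.
have x1 : 0 < 1 - x by lra.
apply: (@le_trans _ _ (1 - x)^-1).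
  by rewrite -[x in leLHS]opprK expRN lef_pV2 ?posrE ?expR_gt0.
rewrite -div1r ler_pdivrMr //.
rewrite (_ : (1 + x + _) * _ = 1 + x ^+ 2 * (1 - 2 * x)); last by ring.
by rewrite lerDl mulr_ge0 ?sqr_ge0 //; lra.
Qed.

(** Centering removes the linear term. The variance bound v is kept in the exponent because it will
    be of order p, far below the trivial bound 1. *)
Lemma centered_mgf (X : finType) (W h : X -> R) (s v : R) :
  (forall x, 0 <= W x) -> \sum_x W x = 1 ->
  (forall x, `|h x| <= 1) -> \sum_x W x * h x = 0 -> \sum_x W x * h x ^+ 2 <= v ->
  `|s| <= 2^-1 -> \sum_x W x * expR (s * h x) <= expR (2 * s ^+ 2 * v).
Proof.
move=> W0 W1 h1 hE hv hs.
apply: (@le_trans _ _ (\sum_x W x * (1 + s * h x + 2 * (s * h x) ^+ 2))).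
  apply: ler_sum => x _; apply: ler_wpM2l => //; apply: expR_le_quadratic.
  apply: le_trans (ler_norm _) _; rewrite normrM -[leRHS]mulr1.
  exact: ler_pM.
have -> : \sum_x W x * (1 + s * h x + 2 * (s * h x) ^+ 2) =
   \sum_x W x + s * (\sum_x W x * h x) + 2 * s ^+ 2 * (\sum_x W x * h x ^+ 2).
  by rewrite !mulr_sumr -!big_split /=; apply: eq_bigr => x _; ring.
rewrite W1 hE mulr0 addr0.
apply: le_trans (expR_ge1Dx _); rewrite lerD2l; apply: ler_wpM2l => //.
by rewrite mulr_ge0 ?sqr_ge0.
Qed.

End ExponentialMoments.

Section Bernstein.
Local Open Scope ring_scope.
Variables (R : realType) (I X : finType) (W : I -> X -> R).
Hypothesis W_ge0 : forall i x, 0 <= W i x.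
Hypothesis W_sum : forall i, \sum_x W i x = 1.

Lemma bernstein (T : finType) (Q : {pred T}) (pos : T -> I) (h : T -> X -> R) (s v r : R) :
  {in Q &, injective pos} ->
  (forall t x, t \in Q -> `|h t x| <= 1) ->
  (forall t, t \in Q -> \sum_x W (pos t) x * h t x = 0) ->
  (forall t, t \in Q -> \sum_x W (pos t) x * h t x ^+ 2 <= v) ->
  0 < s <= 2^-1 ->
  Pr W (fun om => r <= \sum_(t in Q) h t (om (pos t)))
    <= expR (2 * s ^+ 2 * v * #|Q|%:R - s * r).
Proof.
move=> inj h1 h0 hv /andP[s0 s1].
have -> : 2 * s ^+ 2 * v * #|Q|%:R = \sum_(t in Q) 2 * s ^+ 2 * v.
  by rewrite sumr_const mulr_natr.
apply: le_trans (chernoff W_ge0 W_sum (h := fun t x => s * h t x)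
                   (u := fun=> 2 * s ^+ 2 * v) (s * r) inj _).
  by apply: le_Pr => // om hr; rewrite -mulr_sumr; apply: ler_wpM2l => //; exact: ltW.
move=> t tQ; apply: centered_mgf; rewrite ?h0 ?hv //.
  by move=> x; exact: h1.
by rewrite ger0_norm // ltW.
Qed.

Lemma bernstein_abs (T : finType) (Q : {pred T}) (pos : T -> I) (h : T -> X -> R) (s v r : R) :
  {in Q &, injective pos} ->
  (forall t x, t \in Q -> `|h t x| <= 1) ->
  (forall t, t \in Q -> \sum_x W (pos t) x * h t x = 0) ->
  (forall t, t \in Q -> \sum_x W (pos t) x * h t x ^+ 2 <= v) ->
  0 < s <= 2^-1 ->
  Pr W (fun om => r < `|\sum_(t in Q) h t (om (pos t))|)
    <= 2 * expR (2 * s ^+ 2 * v * #|Q|%:R - s * r).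
Proof.
move=> inj h1 h0 hv hs.
apply: (@le_trans _ _ (Pr W (fun om => r <= \sum_(t in Q) h t (om (pos t)) \/
                          r <= \sum_(t in Q) - h t (om (pos t))))).
  apply: le_Pr => // om; rewrite sumrN; set S := \sum_(t in Q) _.
  case: (leP 0 S) => [S0|S0].
    by rewrite ger0_norm // => /ltW; left.
  by rewrite ltr0_norm // => /ltW; right.
apply: le_trans (Pr_or _ _ _) _ => //; rewrite mulr_natl mulr2n; apply: lerD.
  exact: bernstein.
apply: (bernstein (h := fun t x => - h t x)) => //.
- by move=> t x tQ; rewrite normrN; exact: h1.
- by move=> t tQ; under eq_bigr do rewrite mulrN; rewrite sumrN h0 ?oppr0.
- by move=> t tQ; under eq_bigr do rewrite sqrrN; exact: hv.
Qed.

End Bernstein.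

(** * The comparison model *)

Section Pairs.
Variables (n : nat) (e0 : pairT n).

(* The default e0 is only reached for i = j. *)
Definition pairof (i j : 'I_n) : pairT n :=
  if (insub (i, j) : option (pairT n)) is Some e then e
  else if (insub (j, i) : option (pairT n)) is Some e then e else e0.

Lemma pairof_lt (i j : 'I_n) : (i < j)%N -> val (pairof i j) = (i, j).
Proof. by move=> ij; rewrite /pairof insubT. Qed.

Lemma pairofC (i j : 'I_n) : i != j -> pairof i j = pairof j i.
Proof.
rewrite -(inj_eq val_inj) /= neq_ltn => /orP[] ij.
  by rewrite /pairof insubT /= insubF //= ltnNge ltnW.
by rewrite /pairof insubF ?insubT //= ltnNge ltnW.
Qed.

Lemma val_pairof (i j : 'I_n) : i != j ->
  val (pairof i j) = if (i < j)%N then (i, j) else (j, i).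
Proof.
move=> ij; case: ifPn => lt_ij; first exact: pairof_lt.
rewrite pairofC // pairof_lt //.
by move: ij; rewrite -(inj_eq val_inj) /= neq_ltn (negPf lt_ij).
Qed.

Lemma pairof_inj (i j k l : 'I_n) : i != j -> k != l -> pairof i j = pairof k l ->
  (i = k /\ j = l) \/ (i = l /\ j = k).
Proof.
move=> ij kl /(congr1 val); rewrite !val_pairof //.
by case: ifP => _; case: ifP => _ [-> ->]; auto.
Qed.

End Pairs.

Section Coordinates.
Local Open Scope ring_scope.
Variable R : realType.

Definition bern (t : R) (b : bool) : R := if b then t else 1 - t.

Lemma bern_ge0 t b : 0 <= t <= 1 -> 0 <= bern t b.
Proof. by case/andP=> t0 t1; case: b; rewrite /bern ?subr_ge0. Qed.

Lemma bern_sum t : \sum_b bern t b = 1.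
Proof. by rewrite big_bool /= addrC subrK. Qed.

Variables (L : nat) (L_gt0 : (0 < L)%N).

Definition avg (z : {ffun 'I_L -> bool}) : R := (\sum_l (z l)%:R) / L%:R.

(** One coordinate carries the edge bit and all L outcomes of a pair, so leaving out an item
    resamples whole coordinates. *)
Definition coordw (p t : R) (x : bool * {ffun 'I_L -> bool}) : R :=
  bern p x.1 * prodw (fun=> bern t) x.2.

Lemma L_pos : 0 < L%:R :> R. Proof. by rewrite ltr0n. Qed.

Lemma avg_ge0 z : 0 <= avg z.
Proof. by rewrite divr_ge0 // ?ler0n //; apply: sumr_ge0 => l _; rewrite ler0n. Qed.

Lemma avg_le1 z : avg z <= 1.
Proof.
rewrite ler_pdivrMr ?L_pos // mul1r -[X in _ <= X%:R](card_ord L) -sumr_const.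
by apply: ler_sum => l _; case: (z l).
Qed.

Section Marginals.
Variables (p t : R).
Hypotheses (p01 : 0 <= p <= 1) (t01 : 0 <= t <= 1).

Let bt1 (l : 'I_L) : \sum_b bern t b = 1. Proof. exact: bern_sum. Qed.

Lemma coordw_ge0 x : 0 <= coordw p t x.
Proof. by rewrite mulr_ge0 ?bern_ge0 //; apply: prodw_ge0 => l b; apply: bern_ge0. Qed.

Lemma coordw_split (F : bool -> {ffun 'I_L -> bool} -> R) :
  \sum_x coordw p t x * F x.1 x.2 =
  p * Ex (fun=> bern t) (F true) + (1 - p) * Ex (fun=> bern t) (F false).
Proof.
rewrite -(pair_bigA _ (fun b z => coordw p t (b, z) * F b z)) /= big_bool /=.
by rewrite /Ex !mulr_sumr; congr (_ + _); apply: eq_bigr => z _; rewrite /coordw /= mulrA.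
Qed.

Lemma Ex_cst c : Ex (fun=> bern t) (fun _ : {ffun 'I_L -> bool} => c) = c.
Proof. by rewrite /Ex -mulr_suml prodw_total // mul1r. Qed.

Lemma coordw_sum : \sum_x coordw p t x = 1.
Proof.
have := coordw_split (fun _ _ => 1); rewrite !Ex_cst !mulr1.
by under eq_bigr do rewrite mulr1; move=> ->; rewrite addrC subrK.
Qed.

Lemma Ex_avg : Ex (fun=> bern t) avg = t.
Proof.
have Ez l : Ex (fun=> bern t) (fun z : {ffun 'I_L -> bool} => (z l)%:R) = t.
  have inj : {in predT &, injective (fun _ : unit => l)} by case; case.
  have H := Ex_prod_inj bt1 (fun _ (b : bool) => b%:R : R) inj.
  have -> : Ex (fun=> bern t) (fun z : {ffun 'I_L -> bool} => (z l)%:R) =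
    Ex (fun=> bern t) (fun z : {ffun 'I_L -> bool} => \prod_(u : unit) (z l)%:R).
    by apply: eq_bigr => z _; rewrite big_const card_unit /= mulr1.
  rewrite H.
  by rewrite big_const card_unit /= mulr1 big_bool /= mulr1 mulr0 addr0.
rewrite /Ex /avg; under eq_bigr do rewrite mulr_suml mulr_sumr.
rewrite exchange_big /=; under eq_bigr do under eq_bigr do rewrite mulrA.
under eq_bigr => l _ do rewrite -mulr_suml -/(Ex _ _) Ez.
by rewrite sumr_const card_ord -[LHS]mulr_natr -mulrA mulVf ?mulr1 // gt_eqF ?L_pos.
Qed.

Lemma avg_mgf (s : R) : `|s| <= L%:R / 2 ->
  Ex (fun=> bern t) (fun z => expR (s * (avg z - t))) <= expR (2 * s ^+ 2 / L%:R).
Proof.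
move=> hs; have Lp := L_pos.
have -> : Ex (fun=> bern t) (fun z => expR (s * (avg z - t))) =
  Ex (fun=> bern t) (fun z : {ffun 'I_L -> bool} => \prod_l expR (s / L%:R * ((z l)%:R - t))).
  apply: eq_bigr => z _; rewrite -expR_sum -mulr_sumr sumrB sumr_const card_ord.
  by rewrite -mulr_natl /avg; congr (_ * expR _); field; rewrite gt_eqF.
rewrite (Ex_prod (fun=> bern t) (fun _ b => expR (s / L%:R * (b%:R - t)))).
have -> : expR (2 * s ^+ 2 / L%:R) = \prod_(l < L) expR (2 * (s / L%:R) ^+ 2 * 1).
  rewrite -expR_sum sumr_const card_ord -mulr_natr; congr expR.
  by field; rewrite gt_eqF.
case/andP: t01 => t0 t1.
have bnd (b : bool) : `|b%:R - t| <= 1 by case: b; rewrite ?mulr1n ?mulr0n ler_norml; lra.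
apply: ler_prod => l _; apply/andP; split.
  by apply: sumr_ge0 => b _; rewrite mulr_ge0 ?expR_ge0 ?bern_ge0.
apply: centered_mgf => //.
- by move=> b; exact: bern_ge0.
- exact: bern_sum.
- by rewrite big_bool /=; ring.
- rewrite -[X in _ <= X](bern_sum t); apply: ler_sum => b _; rewrite ler_piMr ?bern_ge0 //.
  by rewrite -(ger0_norm (sqr_ge0 _)) normrX exprn_ile1 ?bnd.
- by rewrite normrM normfV (gtr0_norm Lp) ler_pdivrMr // mulrC.
Qed.

End Marginals.
End Coordinates.

Section Model.
Local Open Scope ring_scope.
Variables (R : realType) (n L : nat) (e0 : pairT n).
Hypothesis L_gt0 : (0 < L)%N.
Variables (ys : 'I_n -> 'I_n -> R) (p : R).
Hypothesis ys_ge0 : forall i j, 0 <= ys i j.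
Hypothesis ysC : forall i j, ys i j + ys j i = 1.
Hypotheses (p_gt0 : 0 < p) (p_le1 : p <= 1).

Notation pr := (pairof e0).
Notation X := (bool * {ffun 'I_L -> bool})%type.
Notation Om := {ffun pairT n -> X}.

Definition pairw (e : pairT n) : X -> R := coordw p (ys (val e).1 (val e).2).
Notation W := pairw.

Lemma ys_itv i j : 0 <= ys i j <= 1.
Proof. by rewrite ys_ge0 -(ysC i j) lerDl ys_ge0. Qed.

Let p_itv : 0 <= p <= 1. Proof. by rewrite p_le1 ltW. Qed.

Lemma pairw_ge0 e x : 0 <= W e x.
Proof. by apply: coordw_ge0; rewrite ?ys_itv. Qed.

Lemma pairw_sum e : \sum_x W e x = 1.
Proof. exact: coordw_sum. Qed.

Definition ycoord (i j : 'I_n) (x : X) : R :=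
  if (i < j)%N then avg R x.2 else 1 - avg R x.2.
Definition eta (i j : 'I_n) (x : X) : R := ycoord i j x - ys i j.
Definition edge (x : X) : R := x.1%:R.

Lemma ycoord_itv i j x : 0 <= ycoord i j x <= 1.
Proof.
have := avg_ge0 R x.2; have := avg_le1 R L_gt0 x.2.
by rewrite /ycoord; case: ifP => _; lra.
Qed.

Lemma ycoordC i j x : i != j -> ycoord i j x + ycoord j i x = 1.
Proof.
rewrite -(inj_eq val_inj) /= neq_ltn /ycoord => /orP[] ij; rewrite ij.
  by rewrite [(j < i)%N]ltnNge ltnW //= addrC subrK.
by rewrite [(i < j)%N]ltnNge ltnW //= subrK.
Qed.

Lemma etaC i j x : i != j -> eta j i x = - eta i j x.
Proof.
move=> ij; have := ycoordC x ij; have := ysC i j; rewrite /eta; lra.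
Qed.

Lemma edge_itv x : 0 <= edge x <= 1.
Proof. by rewrite /edge; case: x.1; rewrite ?mulr1n ?mulr0n ?lexx ?ler01. Qed.

Lemma edge_sqr x : edge x ^+ 2 = edge x.
Proof. by rewrite /edge; case: x.1; rewrite ?mulr1n ?mulr0n ?expr1n ?expr0n. Qed.

Lemma ys_pair i j : i != j ->
  (ys (val (pr i j)).1 (val (pr i j)).2) = if (i < j)%N then ys i j else ys j i.
Proof. by move=> ij; rewrite val_pairof //; case: ifP. Qed.

Lemma E_edge e : \sum_x W e x * edge x = p.
Proof.
have := coordw_split p (ys (val e).1 (val e).2) (fun b (_ : {ffun 'I_L -> bool}) => b%:R).
by rewrite !Ex_cst mulr1 mulr0 addr0; apply.
Qed.

Lemma E_edge_y i j : i != j -> \sum_x W (pr i j) x * (edge x * ycoord i j x) = p * ys i j.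
Proof.
move=> ij; pose y (z : {ffun 'I_L -> bool}) := if (i < j)%N then avg R z else 1 - avg R z.
have := coordw_split p (ys (val (pr i j)).1 (val (pr i j)).2)
   (fun b z => b%:R * y z).
rewrite -/(W _) => ->; rewrite [X in _ + _ * X](_ : _ = 0); last first.
  by rewrite /Ex big1 // => z _; rewrite mul0r mulr0.
rewrite mulr0 addr0; congr (_ * _).
have Ey := Ex_avg L_gt0 (ys (val (pr i j)).1 (val (pr i j)).2).
rewrite /y; move: Ey; rewrite ys_pair //; case: ifP => _ Ey.
  by rewrite -[RHS]Ey; apply: eq_bigr => z _; rewrite mul1r.
have -> : ys i j = 1 - ys j i by rewrite -(ysC j i); ring.
rewrite -[in RHS]Ey -[X in X - _](Ex_cst L (ys j i)) /Ex -sumrB.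
by apply: eq_bigr => z _; rewrite mul1r mulrBr.
Qed.


(** Off the edge the noise vanishes, so the moment is 1 + p (E - 1), which keeps the factor p in the
    exponent. Here E <= exp v with v = 2 (2 s)^2 / L, and exp v <= 1 + 2 v. *)
Lemma noise_mgf i j (kap s : R) : i != j -> `|kap| <= 2 -> `|s| <= L%:R / 4 -> 16 * s ^+ 2 <= L%:R ->
  \sum_x W (pr i j) x * expR (s * (edge x * eta i j x * kap)) <= expR (16 * p * s ^+ 2 / L%:R).
Proof.
move=> ij hk hs hs2; have Lp := L_pos R L_gt0.
set t := ys (val (pr i j)).1 (val (pr i j)).2.
pose et (z : {ffun 'I_L -> bool}) : R := eta i j (true, z).
have -> : \sum_x W (pr i j) x * expR (s * (edge x * eta i j x * kap)) =
    p * Ex (fun=> bern t) (fun z => expR (s * (1 * et z * kap))) +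
    (1 - p) * Ex (fun=> bern t) (fun z => expR (s * (0 * et z * kap))).
  by rewrite -(coordw_split p t (fun b z => expR (s * (b%:R * et z * kap)))).
rewrite [X in _ + _ * X](_ : _ = 1); last first.
  under [LHS]eq_bigr do rewrite !mul0r mulr0 expR0.
  exact: Ex_cst.
rewrite mulr1.
pose v := 8 * s ^+ 2 / L%:R.
have v0 : 0 <= v by apply: divr_ge0; [rewrite mulr_ge0 ?sqr_ge0 | exact: ltW].
have v1 : v <= 2^-1 by rewrite ler_pdivrMr //; lra.
have hmgf : Ex (fun=> bern t) (fun z => expR (s * (1 * et z * kap))) <= expR v.
  (* Outcomes are stored for the increasing orientation of the pair; reading the other one flips the
     sign. *)
  have [sg' hsg'] : exists sg' : R, `|sg'| = 1 /\ forall z : {ffun 'I_L -> bool}, et z = sg' * (avg R z - t).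
    rewrite /et /eta /ycoord /t ys_pair //; have := ysC i j.
    case: ifP => _ h; first by exists 1; split=> [|z]; rewrite ?normr1 ?mul1r.
    by exists (-1); split=> [|z]; rewrite ?normrN1 // mulN1r; lra.
  case: hsg' => sg'1 etE.
  have -> : Ex (fun=> bern t) (fun z => expR (s * (1 * et z * kap))) =
    Ex (fun=> bern t) (fun z : {ffun 'I_L -> bool} => expR ((s * sg' * kap) * (avg R z - t))).
    by apply: eq_bigr => z _; rewrite etE; congr (_ * expR _); ring.
  have hn : `|s * sg' * kap| <= `|s| * 2.
    by rewrite !normrM sg'1 mulr1; apply: ler_wpM2l.
  apply: le_trans (avg_mgf L_gt0 (ys_itv _ _) _) _; first by move: hn hs; lra.
  rewrite ler_expR /v ler_pM2r ?invr_gt0 //.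
  have : (s * sg' * kap) ^+ 2 <= (`|s| * 2) ^+ 2.
    by rewrite -(ger0_norm (sqr_ge0 _)) normrX; apply: lerXn2r; rewrite ?nnegrE ?mulr_ge0.
  have -> : (`|s| * 2) ^+ 2 = 4 * s ^+ 2 by rewrite exprMn -normrX (ger0_norm (sqr_ge0 s)); ring.
  lra.
apply: (@le_trans _ _ (1 + p * (2 * v))).
  have : expR v <= 1 + 2 * v.
    apply: le_trans (expR_le_quadratic _) _; first by [].
    have : v * v <= v * 2^-1 by apply: ler_wpM2l.
    rewrite expr2; lra.
  move=> /(le_trans hmgf) /(ler_wpM2l (ltW p_gt0)); lra.
apply: le_trans (expR_ge1Dx _) _; rewrite ler_expR le_eqVlt; apply/orP; left; apply/eqP.
by rewrite /v; ring.
Qed.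

Lemma eta_mgf i j (s : R) : i != j -> `|s| <= L%:R / 2 ->
  \sum_x W (pr i j) x * expR (s * eta i j x) <= expR (2 * s ^+ 2 / L%:R).
Proof.
move=> ij hs; set t := ys (val (pr i j)).1 (val (pr i j)).2.
have [sg' [sg'1 etE]] : exists sg' : R, `|sg'| = 1 /\ forall x, eta i j x = sg' * (avg R x.2 - t).
  rewrite /eta /ycoord /t ys_pair //; have := ysC i j.
  case: ifP => _ h; first by exists 1; split=> [|z]; rewrite ?normr1 ?mul1r.
  by exists (-1); split=> [|z]; rewrite ?normrN1 // mulN1r; lra.
pose F (z : {ffun 'I_L -> bool}) := expR (s * sg' * (avg R z - t)).
have -> : \sum_x W (pr i j) x * expR (s * eta i j x) = Ex (fun=> bern t) F.
  transitivity (p * Ex (fun=> bern t) F + (1 - p) * Ex (fun=> bern t) F); last by ring.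
  rewrite -(coordw_split p t (fun _ => F)).
  by apply: eq_bigr => x _; rewrite etE mulrA.
apply: le_trans (avg_mgf L_gt0 (ys_itv _ _) _) _; first by rewrite normrM sg'1 mulr1.
by rewrite exprMn -[sg' ^+ 2](ger0_norm (sqr_ge0 _)) normrX sg'1 expr1n mulr1.
Qed.

(** The diagonal is cut off because [pairof] returns an arbitrary default there. *)
Definition cmat (co : 'I_n -> 'I_n -> X -> R) (om : Om) (i j : 'I_n) : R :=
  if i == j then 0 else co i j (om (pr i j)).

Lemma pairof_row_inj m : {in [pred i | i != m] &, injective (fun i => pr i m)}.
Proof.
move=> i k; rewrite !inE => im km /(pairof_inj im km) [[//]|[_ mk]].
by rewrite mk eqxx in km.
Qed.

Lemma cmat_col_sum co om m : \sum_i cmat co om i m = \sum_(i | i != m) co i m (om (pr i m)).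
Proof.
rewrite (bigD1 m) //= /cmat eqxx add0r.
by apply: eq_bigr => i /negPf ->.
Qed.

Lemma card_others (m : 'I_n) : #|[pred i | i != m]|%:R <= n%:R :> R.
Proof. by rewrite ler_nat -[leqRHS](card_ord n) max_card. Qed.

Notation q := (n%:R * p).

(** Bernstein for the weights v / V with s = eps / 4: the exponent is eps^2 q (1 / 8 - 1 / 4). The
    case V = 0 is separate, the strict event being empty there. *)
Lemma row_concentration m (h : 'I_n -> X -> R) (v : 'I_n -> R) (V eps : R) :
  0 < eps <= 1 ->
  (forall i x, i != m -> `|h i x| <= 1) ->
  (forall i, i != m -> \sum_x W (pr i m) x * h i x = 0) ->
  (forall i, i != m -> \sum_x W (pr i m) x * h i x ^+ 2 <= p) ->
  (forall i, `|v i| <= V) ->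
  Pr W (fun om => eps * q * V < `|\sum_(i | i != m) h i (om (pr i m)) * v i|)
    <= 2 * expR (- (eps ^+ 2 * q / 8)).
Proof.
move=> /andP[eps0 eps1] h1 h0 h2 hv.
have V0 : 0 <= V by apply: le_trans (hv m).
have [Vz|Vn0] := eqVneq V 0.
  apply: (@le_trans _ _ 0); last by rewrite mulr_ge0 ?expR_ge0.
  rewrite /Pr big_pred0 // => om; apply/asboolP; rewrite Vz mulr0 big1 ?normr0 ?ltxx //.
  move=> i _; have := hv i; rewrite Vz normr_le0 => /eqP ->; exact: mulr0.
have Vp : 0 < V by rewrite lt_def Vn0.
have vV i : `|v i / V| <= 1 by rewrite normrM normfV (gtr0_norm Vp) ler_pdivrMr // mul1r.
apply: le_trans (le_Pr pairw_ge0 (F := fun om => eps * q <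
    `|\sum_(i in [pred i | i != m]) (fun i x => h i x * (v i / V)) i (om (pr i m))|) _) _.
  move=> om; under [X in _ -> _ < `|X|]eq_bigr do rewrite mulrA.
  by rewrite -mulr_suml normrM normfV (gtr0_norm Vp) ltr_pdivlMr.
apply: le_trans (bernstein_abs pairw_ge0 pairw_sum (h := fun i x => h i x * (v i / V)) (s := eps / 4) (v := p) (eps * q) (pairof_row_inj (m := m)) _ _ _ _) _.
- by move=> i x im; rewrite normrM mulr_ile1 ?h1.
- move=> i im; under eq_bigr do rewrite mulrA.
  by rewrite -mulr_suml h0 ?mul0r.
- move=> i im; apply: le_trans (h2 i im); apply: ler_sum => x _.
  apply: ler_wpM2l; first exact: pairw_ge0.
  rewrite exprMn ler_piMr ?sqr_ge0 //.
  by rewrite -(ger0_norm (sqr_ge0 _)) normrX exprn_ile1.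
- by apply/andP; split; lra.
rewrite ler_pM2l // ler_expR.
have := ler_wpM2l (ltW p_gt0) (card_others m); rewrite [p * n%:R]mulrC.
move=> /(ler_wpM2l (sqr_ge0 eps)).
set c := #|_|%:R; rewrite (_ : 2 * (eps / 4) ^+ 2 * p * c = eps ^+ 2 * (p * c) / 8); last by field.
rewrite (_ : eps / 4 * (eps * q) = eps ^+ 2 * q / 4); last by field.
lra.
Qed.

(** Lower tail by Bernstein for p - edge with s = 1 / 8. A pair across the cut has exactly one
    endpoint in S, so it is counted once and the summands are independent. *)
Lemma cut_concentration (S : {set 'I_n}) :
  Pr W (fun om => \sum_(i in S) \sum_(j in ~: S) edge (om (pr i j)) <=
                  p * (#|S| * #|~: S|)%:R / 2)
    <= expR (- (p * (#|S| * #|~: S|)%:R / 32)).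
Proof.
pose Q := [pred t : 'I_n * 'I_n | (t.1 \in S) && (t.2 \in ~: S)].
have cQ : #|Q| = (#|S| * #|~: S|)%N by rewrite -cardX; apply: eq_card => t.
have QP t : t \in Q -> t.1 != t.2.
  by rewrite inE => /andP[h1]; rewrite inE; apply: contraNneq => <-.
apply: le_trans (le_Pr pairw_ge0 (F := fun om => p * (#|S| * #|~: S|)%:R / 2 <=
    \sum_(t in Q) (fun _ x => p - edge x) t (om (pr t.1 t.2))) _) _.
  move=> om; rewrite sumrB sumr_const cQ -[p *+ _]mulr_natr.
  rewrite (_ : \sum_(t in Q) _ = \sum_(i in S) \sum_(j in ~: S) edge (om (pr i j))).
    lra.
  by rewrite pair_big.
apply: le_trans (bernstein pairw_ge0 pairw_sum (pos := fun t => pr t.1 t.2) (h := fun _ x => p - edge x) (s := 8^-1) (v := p) _ _ _ _ _ _) _.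
- move=> t u tQ uQ /(pairof_inj (QP _ tQ) (QP _ uQ)) [[]|[e1 e2]].
    by case: t {tQ}; case: u {uQ} => /= ? ? ? ? -> ->.
  by move: tQ uQ; rewrite !inE e1 e2 => /andP[-> _]; rewrite andbF.
- move=> t x _; have /andP[x0 x1] := edge_itv x; move: p_gt0 p_le1; rewrite ler_norml; lra.
- move=> t _; under eq_bigr do rewrite mulrBr.
  by rewrite sumrB -mulr_suml pairw_sum E_edge mul1r subrr.
- move=> t _; under eq_bigr do rewrite sqrrB edge_sqr.
  rewrite (_ : \sum_x _ = p ^+ 2 * (\sum_x W (pr t.1 t.2) x) +
      (1 - p *+ 2) * (\sum_x W (pr t.1 t.2) x * edge x)); last first.
    by rewrite !mulr_sumr -big_split /=; apply: eq_bigr => x _; ring.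
  rewrite pairw_sum E_edge; have := sqr_ge0 p; lra.
- by apply/andP; split; lra.
by rewrite cQ ler_expR; lra.
Qed.

End Model.

(** * Good events *)

Section PickCandidate.
Local Open Scope ring_scope.
Variables (R : realType) (n : nat).

(** A choice made from a and r only: equal left-out systems receive equal candidates, on which the
    independence from row m rests. *)
Definition pick_flow (a : 'I_n -> 'I_n -> R) (r : 'I_n -> R) : 'I_n -> R :=
  if pselect (exists x, flow_or_kernel a r x) is left h then projT1 (cid h) else fun=> 0.

Lemma pick_flowP a r : \sum_j r j = 0 -> flow_or_kernel a r (pick_flow a r).
Proof.
move=> r0; rewrite /pick_flow; case: pselect => [h|]; first exact: projT2 (cid h).
by case; have [x hx] := flow_solve a r0; exists x.
Qed.

End PickCandidate.

Section Events.
Local Open Scope ring_scope.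
Variables (R : realType) (n L : nat) (e0 : pairT n).
Hypotheses (n_gt1 : (1 < n)%N) (L_gt0 : (0 < L)%N).
Variables (ys : 'I_n -> 'I_n -> R) (p : R).
Hypothesis ys_ge0 : forall i j, 0 <= ys i j.
Hypothesis ysC : forall i j, ys i j + ys j i = 1.
Hypotheses (p_gt0 : 0 < p) (p_le1 : p <= 1).

Notation pr := (pairof e0).
Notation X := (bool * {ffun 'I_L -> bool})%type.
Notation Om := {ffun pairT n -> X}.
Notation W := (@pairw R n L ys p).
Notation q := (n%:R * p).

Let Wge0 := pairw_ge0 (L := L) ys_ge0 ysC p_gt0 p_le1.
Let Wsum := pairw_sum L ys p.

Definition pmat (c : 'I_n -> 'I_n -> R) i j := if i == j then 0 else p * c i j.

Definition star (m : 'I_n) : {set pairT n} :=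
  [set e | ((val e).1 == m) || ((val e).2 == m)].

Lemma pairof_star (m i : 'I_n) : i != m -> pr i m \in star m.
Proof. by move=> im; rewrite inE val_pairof //; case: ifP => _ /=; rewrite eqxx ?orbT. Qed.

Lemma pairof_notin_star (m i j : 'I_n) : i != j -> i != m -> j != m -> pr i j \notin star m.
Proof.
by move=> ij im jm; rewrite inE val_pairof //; case: ifP => _ /=; rewrite negb_or ?im ?jm.
Qed.

Section LooEvent.
Variables (co : 'I_n -> 'I_n -> X -> R) (c : 'I_n -> 'I_n -> R).
Variables (gco : 'I_n -> 'I_n -> X -> R) (f : 'I_n -> R).
Hypothesis co_itv : forall i j x, i != j -> 0 <= co i j x <= edge R x.
Hypothesis co_mean : forall i j, i != j -> \sum_x W (pr i j) x * co i j x = p * c i j.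
Hypothesis cC : forall i j, c i j = c j i.
Hypothesis c_itv : forall i j, i != j -> 0 <= c i j <= 1.

(* The choice depends on om only through the left-out system, so vloo m is independent of
   every pair meeting m. *)
Definition vloo m (om : Om) :=
  pick_flow (loo m (cmat e0 co om) (pmat c)) (loo_rhs (cmat e0 gco om) f m).

Lemma vloo_merge m om0 om1 : vloo m (merge (star m) om0 om1) = vloo m om0.
Proof.
have E (h : 'I_n -> 'I_n -> X -> R) b :
   loo m (cmat e0 h (merge (star m) om0 om1)) b = loo m (cmat e0 h om0) b.
  apply/funext => i; apply/funext => j; rewrite /loo /cmat.
  have [//|im] := eqVneq i m; have [//|jm] := eqVneq j m.
  have [//|ij] := eqVneq i j.
  by rewrite /= ffunE (negPf (pairof_notin_star ij im jm)).
rewrite /vloo E; congr pick_flow; apply/funext => j.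
by rewrite /loo_rhs E.
Qed.

Let h1 i m x : i != m -> `|co i m x - p * c i m| <= 1.
Proof.
move=> im; have /andP[a0 a1] := co_itv x im; have /andP[b0 b1] := c_itv im.
have /andP[e00 e1] := edge_itv R x.
have t0 : 0 <= p * c i m by rewrite mulr_ge0 // ltW.
have t1 : p * c i m <= 1 by rewrite mulr_ile1 // ltW.
by rewrite ler_norml; lra.
Qed.

Let h0 i m : i != m -> \sum_x W (pr i m) x * (co i m x - p * c i m) = 0.
Proof.
move=> im; under eq_bigr do rewrite mulrBr.
by rewrite sumrB -mulr_suml Wsum mul1r co_mean // subrr.
Qed.

(** The variance is at most the second moment, and 0 <= co <= edge <= 1 bounds that by the edge
    probability. *)
Let h2 i m : i != m -> \sum_x W (pr i m) x * (co i m x - p * c i m) ^+ 2 <= p.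
Proof.
move=> im.
have -> : \sum_x W (pr i m) x * (co i m x - p * c i m) ^+ 2 =
   \sum_x W (pr i m) x * co i m x ^+ 2 - (p * c i m) ^+ 2.
  transitivity (\sum_x W (pr i m) x * co i m x ^+ 2
     - (2 * (p * c i m)) * (\sum_x W (pr i m) x * co i m x)
     + (p * c i m) ^+ 2 * (\sum_x W (pr i m) x)); last by rewrite Wsum co_mean //; ring.
  rewrite !mulr_sumr -sumrB -big_split /=; apply: eq_bigr => x _; ring.
apply: (@le_trans _ _ (\sum_x W (pr i m) x * edge R x)); last by rewrite E_edge.
rewrite lerBlDr -[leLHS]addr0; apply: lerD; last exact: sqr_ge0.
apply: ler_sum => x _; apply: ler_wpM2l; first exact: Wge0.
have /andP[a0 a1] := co_itv x im; have /andP[e00 e1] := edge_itv R x.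
apply: le_trans (a1); rewrite expr2 ler_piMr //; exact: le_trans a1 e1.
Qed.

Variables (eps : R).
Hypothesis eps01 : 0 < eps <= 1.

Lemma centered_col_sum om m (v : 'I_n -> R) :
  \sum_i (cmat e0 co om i m - pmat c i m) * v i =
  \sum_(i | i != m) (co i m (om (pr i m)) - p * c i m) * v i.
Proof.
rewrite (bigD1 m) //= /cmat /pmat eqxx subrr mul0r add0r.
by apply: eq_bigr => i /negPf ->.
Qed.

Lemma centered_row_sum om m :
  \sum_i (cmat e0 co om m i - pmat c m i) =
  \sum_(i | i != m) (co m i (om (pr i m)) - p * c i m).
Proof.
rewrite (bigD1 m) //= /cmat /pmat eqxx subrr add0r.
by apply: eq_bigr => i im; rewrite eq_sym (negPf im) pairofC 1?eq_sym // cC.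
Qed.

Lemma loo_event m : Pr W (fun om => exists2 V : R, (forall i, `|vloo m om i| <= V) &
     eps * q * V < `|\sum_i (cmat e0 co om i m - pmat c i m) * vloo m om i|)
   <= 2 * expR (- (eps ^+ 2 * q / 8)).
Proof.
apply: (Pr_cond Wge0 Wsum (S := star m)) => om0.
(* With the data outside the star frozen, v is deterministic. The event quantifies over V, but it is
   largest for the least admissible V, which is |v k|. *)
set v := vloo m om0; have [k hk] := sup_norm_attained v m.
apply: (le_trans _ (row_concentration (e0 := e0) ys_ge0 ysC p_gt0 p_le1 (m := m)
  (h := fun i x => co i m x - p * c i m) (v := v) (V := `|v k|) eps01 _ _ _ _));
  [|by move=> i x; exact: h1|by move=> i; exact: h0|by move=> i; exact: h2|exact: hk].
apply: (le_Pr Wge0) => om1 [V]; rewrite vloo_merge -/v => hV.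
rewrite centered_col_sum => hlt.
have -> : \sum_(i | i != m) (co i m (om1 (pr i m)) - p * c i m) * v i =
  \sum_(i | i != m) (co i m (merge (star m) om0 om1 (pr i m)) - p * c i m) * v i.
  by apply: eq_bigr => i im; rewrite ffunE pairof_star.
apply: le_lt_trans hlt; apply: ler_wpM2l => //.
by case/andP: eps01 => ? _; rewrite !mulr_ge0 ?ler0n // ltW.
Qed.

Lemma col_event m : Pr W (fun om =>
     eps * q < `|\sum_i (cmat e0 co om i m - pmat c i m)|) <= 2 * expR (- (eps ^+ 2 * q / 8)).
Proof.
apply: (le_trans _ (row_concentration (e0 := e0) ys_ge0 ysC p_gt0 p_le1 (m := m)
  (h := fun i x => co i m x - p * c i m) (v := fun=> 1) (V := 1) eps01 _ _ _ _));
  [|by move=> i x; exact: h1|by move=> i; exact: h0|by move=> i; exact: h2|by rewrite normr1].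
apply: (le_Pr Wge0) => om; rewrite mulr1 -centered_col_sum.
by under [in X in _ -> X]eq_bigr do rewrite mulr1.
Qed.

End LooEvent.

Lemma row_event (co : 'I_n -> 'I_n -> X -> R) (c : 'I_n -> 'I_n -> R) eps m :
  (forall i j x, i != j -> 0 <= co i j x <= edge R x) ->
  (forall i j, i != j -> \sum_x W (pr i j) x * co i j x = p * c i j) ->
  (forall i j, c i j = c j i) -> (forall i j, i != j -> 0 <= c i j <= 1) ->
  0 < eps <= 1 ->
  Pr W (fun om => eps * q < `|\sum_i (cmat e0 co om m i - pmat c m i)|)
    <= 2 * expR (- (eps ^+ 2 * q / 8)).
Proof.
move=> co_itv co_mean cC c_itv eps01.
apply: (le_trans _ (col_event (co := fun i j => co j i) (c := c) _ _ _ eps01 m)).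
- apply: (le_Pr Wge0) => om; rewrite centered_row_sum //.
  have := centered_col_sum (fun i j => co j i) c om m (fun=> 1).
  under eq_bigr do rewrite mulr1; move=> ->.
  by under [X in _ -> _ < `|X|]eq_bigr do rewrite mulr1.
- by move=> i j x ij; apply: co_itv; rewrite eq_sym.
- by move=> i j ij; rewrite pairofC // co_mean 1?eq_sym // cC.
- exact: c_itv.
Qed.

(** The complement has at least n / 2 points, so the cut has at least n |S| / 2 pairs; the bound is
    geometric in |S|, as a union over all sets requires. *)
Lemma cut_event (S : {set 'I_n}) : (2 * #|S| <= n)%N ->
  Pr W (fun om => \sum_(i in S) \sum_(j in ~: S) cmat e0 (fun _ _ => @edge R L) om i j <
                  q / 4 * #|S|%:R)
    <= expR (- (q / 64)) ^+ #|S|.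
Proof.
move=> hS.
have hN : n%:R * #|S|%:R / 2 <= (#|S| * #|~: S|)%:R :> R.
  rewrite ler_pdivrMr // -!natrM ler_nat; have := cardsC S; rewrite card_ord; nia.
have hpN := ler_wpM2l (ltW p_gt0) hN.
apply: (@le_trans _ _ (expR (- (p * (#|S| * #|~: S|)%:R / 32)))).
  apply: (le_trans _ (cut_concentration L e0 ys_ge0 ysC p_gt0 p_le1 S)).
  apply: (le_Pr Wge0) => om; rewrite (_ : \sum_(i in S) _ =
     \sum_(i in S) \sum_(j in ~: S) edge R (om (pr i j))); last first.
    apply: eq_bigr => i iS; apply: eq_bigr => j; rewrite inE /cmat.
    by case: eqVneq => // <-; rewrite iS.
  move=> /ltW; lra.
rewrite -expRM_natl ler_expR; lra.
Qed.

(** The sum of t^|S| over nonempty sets is (1 + t)^n - 1 <= exp (n t) - 1 <= 2 n t. The empty set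
    never violates the strict inequality. *)
Lemma cut_event_all (t : R) : expR (- (q / 64)) <= t -> n%:R * t <= 2^-1 ->
  Pr W (fun om => exists2 S : {set 'I_n}, (2 * #|S| <= n)%N &
      \sum_(i in S) \sum_(j in ~: S) cmat e0 (fun _ _ => @edge R L) om i j <
                  q / 4 * #|S|%:R) <= 2 * (n%:R * t).
Proof.
move=> ht hnt.
have t0 : 0 <= t by apply: le_trans ht; exact: expR_ge0.
pose Q := [pred S : {set 'I_n} | (2 * #|S| <= n)%N && (S != set0)].
apply: (@le_trans _ _ (Pr W (fun om => exists2 S, S \in Q &
  \sum_(i in S) \sum_(j in ~: S) cmat e0 (fun _ _ => @edge R L) om i j < q / 4 * #|S|%:R))).
  apply: (le_Pr Wge0) => om [S hS hlt]; exists S => //; rewrite inE hS /=.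
  by apply: contraTneq hlt => ->; rewrite big_set0 cards0 mulr0 ltxx.
apply: le_trans (Pr_union Wge0 _ _) _.
apply: (@le_trans _ _ (\sum_(S in Q) t ^+ #|S|)).
  apply: ler_sum => S /andP[hS _]; apply: le_trans (cut_event hS) _.
  by apply: lerXn2r; rewrite ?nnegrE ?expR_ge0.
have : \sum_(S : {set 'I_n}) t ^+ #|S| = (1 + t) ^+ n.
  rewrite -[X in _ = _ ^+ X](card_ord n) -prodr_const.
  under [RHS]eq_bigr do rewrite addrC; rewrite bigA_distr.
  apply: eq_big => [S|S _]; first by rewrite inE.
  by rewrite -big_mkcond /= prodr_const.
rewrite (bigD1 set0) //= cards0 expr0 => E.
apply: (@le_trans _ _ (\sum_(S : {set 'I_n} | S != set0) t ^+ #|S|)).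
  rewrite [leLHS]big_mkcond [leRHS]big_mkcond /=; apply: ler_sum => S _.
  by rewrite !inE; case: (S != set0); rewrite ?andbF ?andbT //; case: ifP => _ //; rewrite exprn_ge0.
have nt0 : 0 <= n%:R * t by rewrite mulr_ge0 ?ler0n.
have : (1 + t) ^+ n <= expR (n%:R * t).
  by rewrite expRM_natl; apply: lerXn2r; rewrite ?nnegrE ?expR_ge0 ?addr_ge0 ?expR_ge1Dx.
have := expR_le_quadratic hnt.
have : (n%:R * t) * (n%:R * t) <= (n%:R * t) * 2^-1 by apply: ler_wpM2l.
rewrite -E expr2; move: (\sum_(i | i != set0) _) (expR (n%:R * t)) (n%:R * t) nt0 => a b d.
lra.
Qed.

End Events.

Lemma leq_double_pred n : (1 < n)%N -> (n <= n.-1 * 2)%N.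
Proof. by case: n => [|[|n]] // _; rewrite /= muln2 -addnn addSn ltnS leq_addl. Qed.

(** * Probability that a random flow system is well conditioned *)

Section Instance.
Local Open Scope ring_scope.
Variables (R : realType) (n L : nat) (e0 : pairT n).
Hypotheses (n_gt1 : (1 < n)%N) (L_gt0 : (0 < L)%N).
Variables (ys : 'I_n -> 'I_n -> R) (p : R).
Hypothesis ys_ge0 : forall i j, 0 <= ys i j.
Hypothesis ysC : forall i j, ys i j + ys j i = 1.
Hypotheses (p_gt0 : 0 < p) (p_le1 : p <= 1).

Notation pr := (pairof e0).
Notation X := (bool * {ffun 'I_L -> bool})%type.
Notation Om := {ffun pairT n -> X}.
Notation W := (@pairw R n L ys p).
Notation q := (n%:R * p).

Let Wge0 := pairw_ge0 (L := L) ys_ge0 ysC p_gt0 p_le1.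
Let Wsum := pairw_sum L ys p.

Variables (delta ell : R).
Hypotheses (delta_ge0 : 0 <= delta) (delta_le : delta <= 4^-1).
Hypothesis deltaE : q * L%:R * delta ^+ 2 = ell.
Hypothesis ell_q : 512 * ell <= q.

Definition noise (kap : 'I_n -> 'I_n -> R) i j (x : X) : R :=
  edge R x * eta ys i j x * kap i j.

Let Lp : 0 < L%:R :> R. Proof. by rewrite ltr0n. Qed.
Let np : 0 < n%:R :> R. Proof. by rewrite ltr0n ltnW. Qed.
Let qp : 0 < q. Proof. exact: mulr_gt0. Qed.

(** Tilting by s = L delta makes the log-moment at most 16 ell and the scaled threshold 24 ell; the
    difference is the exponent -8 ell. *)
Lemma noise_tail m kap : (forall i j, `|kap i j| <= 2) ->
  Pr W (fun om => 24 * q * delta <= \sum_(i | i != m) noise kap i m (om (pr i m)))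
   <= expR (- (8 * ell)).
Proof.
move=> hk; pose s := L%:R * delta.
have s0 : 0 <= s by rewrite mulr_ge0 // ltW.
have s2 : s ^+ 2 = L%:R * (L%:R * delta ^+ 2) by rewrite /s; ring.
have hL : 16 * (L%:R * delta ^+ 2) <= 1.
  have : 512 * (L%:R * delta ^+ 2) <= 1.
    by rewrite -(ler_pM2l qp) mulr1 mulrCA [q * (_ * _)]mulrA deltaE.
  have : 0 <= L%:R * delta ^+ 2 by rewrite mulr_ge0 ?sqr_ge0 // ltW.
  lra.
apply: le_trans (le_Pr Wge0 (F := fun om => s * (24 * q * delta) <=
    \sum_(i in [pred i | i != m]) (fun i x => s * noise kap i m x) i (om (pr i m))) _) _.
  by move=> om; rewrite -mulr_sumr; apply: ler_wpM2l.
apply: le_trans (chernoff Wge0 Wsum (h := fun i x => s * noise kap i m x)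
   (u := fun=> 16 * p * s ^+ 2 / L%:R) _ (pairof_row_inj (m := m)) _) _.
  move=> i im; apply: noise_mgf => //.
    by rewrite ger0_norm // /s mulrC [leRHS]mulrC ler_pM2r.
  by rewrite s2 mulrCA ler_piMr // ltW.
rewrite ler_expR sumr_const -[_ *+ _]mulr_natr.
have h1 : 16 * p * s ^+ 2 / L%:R * #|[pred i | i != m]|%:R <= 16 * ell.
  rewrite s2 -deltaE (_ : 16 * p * _ / _ = 16 * p * L%:R * delta ^+ 2); last by field; rewrite gt_eqF.
  rewrite (_ : 16 * (q * _ * _) = (16 * p * L%:R * delta ^+ 2) * n%:R); last by ring.
  apply: ler_wpM2l; last exact: card_others.
  by rewrite !mulr_ge0 ?sqr_ge0 // ltW.
have h2 : s * (24 * q * delta) = 24 * ell by rewrite -deltaE /s; ring.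
rewrite h2; lra.
Qed.

Lemma noise_event m kap : (forall i j, `|kap i j| <= 2) ->
  Pr W (fun om => 24 * q * delta < `|\sum_i cmat e0 (noise kap) om i m|)
   <= 2 * expR (- (8 * ell)).
Proof.
move=> hk; pose kap' i j := - kap i j.
have hk' i j : `|kap' i j| <= 2 by rewrite normrN.
rewrite [leRHS]mulr_natl mulr2n.
apply: (le_trans _ (lerD (noise_tail m hk) (noise_tail m hk'))).
apply: (le_trans _ (Pr_or Wge0 _ _)); apply: (le_Pr Wge0) => om.
rewrite cmat_col_sum.
have -> : \sum_(i | i != m) noise kap' i m (om (pr i m)) =
  - \sum_(i | i != m) noise kap i m (om (pr i m)).
  by rewrite -sumrN; apply: eq_bigr => i _; rewrite /noise mulrN.
set S := \sum_(i | _) _; have [S0|S0] := leP 0 S.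
  by rewrite ger0_norm // => /ltW; left.
by rewrite ltr0_norm // => /ltW; right.
Qed.

(** One averaged outcome deviates by about sqrt (ell / L), that is sqrt q * delta. With s = sqrt
    (ell L) the exponent is 2 ell - 10 ell. *)
Lemma eta_event i j : i != j ->
  Pr W (fun om => 100 * (q * delta ^+ 2) < eta ys i j (om (pr i j)) ^+ 2)
    <= 2 * expR (- (8 * ell)).
Proof.
move=> ij; have ellE : ell = L%:R * (q * delta ^+ 2) by rewrite -deltaE; ring.
have ell0 : 0 <= ell by rewrite ellE !mulr_ge0 ?sqr_ge0 // ltW.
(* For such small L the threshold exceeds 1, the largest possible square, so the event is empty;
   otherwise s <= L / 2 is admissible. *)
have [big|small] := leP (L%:R) (4 * ell).
  apply: (@le_trans _ _ 0); last by rewrite mulr_ge0 ?expR_ge0.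
  rewrite /Pr big_pred0 // => om; apply/asboolP/negP; rewrite -leNgt.
  apply: (@le_trans _ _ 1).
    have /andP[y0 y1] := ycoord_itv R L_gt0 i j (om (pr i j)).
    have /andP[t0 t1] := ys_itv ys_ge0 ysC i j.
    rewrite -(ger0_norm (sqr_ge0 _)) normrX exprn_ile1 // /eta ler_norml; lra.
  have : L%:R * 1 <= L%:R * (4 * (q * delta ^+ 2)) by rewrite mulrCA -ellE mulr1.
  rewrite ler_pM2l //; lra.
pose s := Num.sqrt (ell * L%:R).
have s2 : s ^+ 2 = ell * L%:R by rewrite sqr_sqrtr // mulr_ge0 // ltW.
have s0 : 0 <= s by exact: sqrtr_ge0.
have sL : s <= L%:R / 2.
  rewrite -ler_sqr ?nnegrE ?divr_ge0 ?(ltW Lp) // s2.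
  have := ler_pM2r Lp (4 * ell) L%:R; rewrite (ltW small) => /esym h.
  move: (h); rewrite expr_div_n; lra.
have inj : {in (predT : {pred unit}) &, injective (fun=> pr i j)} by case; case.
have tail sg : `|sg| = 1 -> Pr W (fun om => 10 * ell <= sg * (s * eta ys i j (om (pr i j))))
     <= expR (- (8 * ell)).
  move=> sg1.
  apply: le_trans (le_Pr Wge0 (F := fun om => 10 * ell <=
    \sum_(u in (predT : {pred unit})) (fun _ x => (sg * s) * eta ys i j x) u (om (pr i j))) _) _.
    by move=> om; rewrite big_const card_unit /= addr0 mulrA.
  apply: le_trans (chernoff Wge0 Wsum (h := fun _ x => (sg * s) * eta ys i j x)
     (u := fun=> 2 * (sg * s) ^+ 2 / L%:R) _ inj _) _.
    by move=> u _; apply: eta_mgf => //; rewrite normrM sg1 mul1r ger0_norm.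
  rewrite ler_expR big_const card_unit /= addr0 exprMn s2.
  rewrite -[sg ^+ 2](ger0_norm (sqr_ge0 _)) normrX sg1 expr1n mul1r.
  rewrite (_ : 2 * (ell * L%:R) / L%:R = 2 * ell); last by field; rewrite gt_eqF.
  lra.
rewrite [leRHS]mulr_natl mulr2n.
apply: (le_trans _ (lerD (tail 1 _) (tail (-1) _))); rewrite ?normrN1 ?normr1 //.
apply: (le_trans _ (Pr_or Wge0 _ _)); apply: (le_Pr Wge0) => om.
set t := eta _ _ _ _ => ht.
have : 10 * ell <= `|s * t|.
  rewrite -ler_sqr ?nnegrE ?mulr_ge0 // -normrX ger0_norm ?sqr_ge0 // [leRHS]exprMn s2.
  rewrite (_ : (10 * ell) ^+ 2 = (ell * L%:R) * (100 * (q * delta ^+ 2))); last first.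
    by transitivity (100 * ell * (L%:R * (q * delta ^+ 2))); [rewrite -ellE|]; ring.
  by apply: ler_wpM2l (ltW ht); rewrite mulr_ge0 // ltW.
rewrite mul1r mulN1r; have [h|h] := leP 0 (s * t).
  by rewrite ger0_norm //; left.
by rewrite ltr0_norm //; right.
Qed.

Variables (co : 'I_n -> 'I_n -> X -> R) (c kap : 'I_n -> 'I_n -> R) (f : 'I_n -> R).
Variables (eps ks kc B : R).
Hypothesis co_itv : forall i j x, i != j -> 0 <= co i j x <= edge R x.
Hypothesis co_mean : forall i j, i != j -> \sum_x W (pr i j) x * co i j x = p * c i j.
Hypothesis co_cond : forall i j x, i != j -> ks * edge R x <= co i j x + co j i x.
Hypothesis cC : forall i j, c i j = c j i.
Hypothesis c_itv : forall i j, i != j -> kc <= c i j <= 1.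
Hypothesis kapC : forall i j, kap i j = kap j i.
Hypothesis kap_le : forall i j, `|kap i j| <= 2.
Hypothesis f_sum : \sum_i f i = 0.
Hypothesis f_le : forall i, `|f i| <= B * q * delta.
Hypotheses (B_ge0 : 0 <= B) (ks_gt0 : 0 < ks) (kc_gt0 : 0 < kc).
(** Cheeger with cut constant ks q / 4 and degree bound 4 q gives ks^2 q / 64 = 8 gapc q. A factor 4
    goes to the energy identity, and the rest leaves room for the imbalance. *)
Definition gapc : R := ks ^+ 2 / 512.
Hypotheses (eps01 : 0 < eps <= 1) (eps_gap : 16 * eps <= gapc).
Hypotheses (eps_kc : eps * (2 + 48 / gapc) <= kc / 8).
Hypothesis eps_q : 1 <= eps ^+ 2 * q.
Hypothesis q_conc : 64 * ell <= eps ^+ 2 * q.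
Hypothesis n_ell : n%:R * expR (- (8 * ell)) <= 2^-1.

(** The constant of [loo_bound] for row mass kc / 4, noise constant 24 and gap [gapc]. *)
Definition loo_cst : R := 2 / (kc / 4) * (24 * 24 / gapc + (B + 24) * (1 + 1 / gapc)).

Definition well_conditioned (om : Om) :=
  [/\ coercive (cmat e0 co om) (gapc * q),
      (forall m, \sum_i cmat e0 (fun _ _ => @edge R L) om i m <= 2 * q) &
      forall x, \sum_i x i = 0 ->
        (forall j, flow (cmat e0 co om) x j = f j + \sum_i cmat e0 (noise kap) om i j) ->
        forall m, `|x m| <= loo_cst * delta].

Let gap_gt0 : 0 < gapc. Proof. by rewrite divr_gt0 // exprn_gt0. Qed.
Let eps_gt0 : 0 < eps. Proof. by case/andP: eps01. Qed.
Let eps_le1 : eps <= 1. Proof. by case/andP: eps01. Qed.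

Let A om := cmat e0 (fun _ _ => @edge R L) om.
Let a om := cmat e0 co om.
Let b := pmat p c.
Let g om := cmat e0 (noise kap) om.

Lemma edge_mat_sym om i j : A om i j = A om j i.
Proof. by rewrite /A /cmat eq_sym; case: eqVneq => // ij; rewrite pairofC // eq_sym. Qed.

Lemma pmat_sym i j : b i j = b j i.
Proof. by rewrite /b /pmat eq_sym cC. Qed.

Lemma noise_mat_antisym om i j : g om i j = - g om j i.
Proof.
rewrite /g /cmat eq_sym; case: eqVneq => [_|ij]; first by rewrite oppr0.
by rewrite /noise kapC (pairofC e0) 1?eq_sym // (etaC ysC) //; ring.
Qed.

Lemma antisym_sum0 (h : 'I_n -> 'I_n -> R) : (forall i j, h i j = - h j i) ->
  \sum_j \sum_i h i j = 0.
Proof.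
move=> hh; have E : \sum_j \sum_i h i j = - \sum_j \sum_i h i j.
  rewrite {1}exchange_big -sumrN; apply: eq_bigr => j _.
  by rewrite -sumrN; apply: eq_bigr => i _; exact: hh.
by move: E; lra.
Qed.

Lemma loo_rhs_sum0 om m : \sum_j loo_rhs (g om) f m j = 0.
Proof.
rewrite /loo_rhs big_split /= f_sum add0r; apply: antisym_sum0 => i j.
by rewrite /loo orbC; case: ifP => _; rewrite ?oppr0 // noise_mat_antisym.
Qed.

Definition regular (om : Om) := [/\
  forall S : {set 'I_n}, (2 * #|S| <= n)%N ->
    q / 4 * #|S|%:R <= \sum_(i in S) \sum_(j in ~: S) A om i j,
  forall m, `|\sum_i (A om i m - pmat p (fun _ _ => 1) i m)| <= eps * q,
  forall m, `|\sum_i (a om i m - b i m)| <= eps * q /\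
            `|\sum_i (a om m i - b m i)| <= eps * q,
  forall m (V : R), (forall i, `|vloo e0 p co c (noise kap) f m om i| <= V) ->
     `|\sum_i (a om i m - b i m) * vloo e0 p co c (noise kap) f m om i| <= eps * q * V &
  (forall m, `|\sum_i g om i m| <= 24 * q * delta) /\
  (forall i j, i != j -> eta ys i j (om (pr i j)) ^+ 2 <= 100 * (q * delta ^+ 2))].

Lemma edge_mat_itv om i j : 0 <= A om i j <= 1.
Proof.
by rewrite /A /cmat; case: eqP => _; [rewrite lexx ler01 | exact: edge_itv].
Qed.

Lemma flow_mat_itv om i j : 0 <= a om i j <= A om i j.
Proof.
rewrite /a /A /cmat; case: eqVneq => [_|ij]; first by rewrite lexx.
exact: co_itv.
Qed.

Lemma pmat_itv i j : 0 <= b i j <= p.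
Proof.
rewrite /b /pmat; case: eqVneq => [_|ij]; first by rewrite lexx ltW.
have /andP[h1 h2] := c_itv ij.
rewrite mulr_ge0 ?(ltW p_gt0) //; last by apply: le_trans h1; exact: ltW.
by rewrite ler_piMr // ltW.
Qed.

Lemma regular_degree om : regular om -> forall m, \sum_i A om i m <= 2 * q.
Proof.
case=> _ hdeg _ _ _ m; have := hdeg m; rewrite sumrB => /ler_normlP [_ h].
have : \sum_i pmat p (fun _ _ : 'I_n => 1) i m <= q.
  rewrite mulr_natl -[X in _ *+ X](card_ord n) -sumr_const; apply: ler_sum => i _.
  by rewrite /pmat mulr1; case: ifP => _; rewrite ?lexx ?(ltW p_gt0).
have : eps * q <= 1 * q by rewrite ler_pM2r.
lra.
Qed.

(** The mean matrix b is symmetric, so it cancels from the imbalance, leaving a column deviation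
    minus a row deviation, at most 2 eps q. The cut bound for edges passes to the conductances
    through [co_cond]. *)
Lemma regular_coercive om : regular om -> coercive (a om) (gapc * q).
Proof.
move=> reg; have deg := regular_degree reg; case: (reg) => hcut _ hconc _ _.
apply: (@coercive_of_gap _ _ _ _ (2 * (eps * q))); last first.
  move=> j; rewrite (_ : \sum_i _ = \sum_i (a om i j - b i j) - \sum_i (a om j i - b j i)).
    have [/ler_normlP[_ h1] /ler_normlP[h2 _]] := hconc j; lra.
  by rewrite -sumrB; apply: eq_bigr => i _; rewrite (pmat_sym j i); ring.
move=> x x0.
have s0 i j : 0 <= a om i j + a om j i.
  by have /andP[? _] := flow_mat_itv om i j; have /andP[? _] := flow_mat_itv om j i; rewrite addr_ge0.
have ssym i j : a om i j + a om j i = a om j i + a om i j by rewrite addrC.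
have h0 : 0 < ks * (q / 4) by rewrite mulr_gt0 // divr_gt0.
have D0 : 0 < 4 * q by rewrite mulr_gt0.
have := @cheeger R _ (fun i j => a om i j + a om j i) s0 ssym _ _ x h0 D0 _ _ x0.
rewrite (_ : (ks * (q / 4)) ^+ 2 / (4 * q) = 8 * (gapc * q)); last first.
  by rewrite /gapc; field; rewrite !gt_eqF.
move=> H; apply: le_trans (H _ _).
- apply: ler_wpM2r; first exact: sqnorm_ge0.
  have : 16 * eps * q <= gapc * q by rewrite ler_pM2r.
  have : 0 < eps * q by rewrite mulr_gt0.
  lra.
- move=> S; rewrite card_ord => /hcut h; rewrite -[leLHS]mulrA.
  apply: le_trans (ler_wpM2l (ltW ks_gt0) h) _.
  rewrite mulr_sumr; apply: ler_sum => i _; rewrite mulr_sumr; apply: ler_sum => j _.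
  rewrite /A /a /cmat [j == i]eq_sym; case: eqVneq => [_|ij]; first by rewrite mulr0 addr0.
  by rewrite (pairofC e0 (i := j)) 1?eq_sym //; exact: co_cond.
- move=> i; rewrite big_split /=.
  have h1 : \sum_j a om i j <= 2 * q.
    apply: le_trans (deg i); apply: ler_sum => j _; rewrite edge_mat_sym.
    by have /andP[] := flow_mat_itv om i j.
  have h2 : \sum_j a om j i <= 2 * q.
    apply: le_trans (deg i); apply: ler_sum => j _.
    by have /andP[] := flow_mat_itv om j i.
  lra.
Qed.

Lemma regular_well_conditioned om : regular om -> well_conditioned om.
Proof.
move=> reg; have deg := regular_degree reg; have coe := regular_coercive reg.
split=> // x x0 xflow m.
case: (reg) => hcut hdeg hconc hloo [hnoise heta].
have q1 : 1 <= q.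
  by apply: le_trans eps_q _; rewrite ler_piMl ?(ltW qp) // exprn_ile1 // ltW.
apply: (@loo_bound R n (A om) (a om) b (g om) f p q eps gapc (kc / 4) delta 24 B
  _ _ _ _ _ _ _ _ _ _ _ _ _ _ _ _ _ _ _ _ _ _ _ _ _ 
  x (fun m => vloo e0 p co c (noise kap) f m om) x0 xflow _ _ m) => //.
- by rewrite divr_gt0.
- by apply: le_trans eps_kc _; rewrite le_eqVlt; apply/orP; left; apply/eqP; field.
- exact: edge_mat_itv.
- exact: edge_mat_sym.
- exact: flow_mat_itv.
- exact: pmat_itv.
- move=> i; have [_ /ler_normlP[h _]] := hconc i.
  move: h; rewrite sumrB opprB => h.
  (* The diagonal is empty, so n - 1 >= n / 2 terms remain; the deviation eps q <= kc q / 4 then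
     leaves row mass kc q / 4. *)
  have hb : kc * (p * n%:R / 2) <= \sum_j b i j.
    rewrite (bigD1 i) //= {1}/b /pmat eqxx add0r.
    apply: (@le_trans _ _ (\sum_(j | j != i) kc * p)); last first.
      apply: ler_sum => j ji; rewrite /b /pmat eq_sym (negPf ji) mulrC ler_pM2l //.
      by have /andP[] := c_itv ji; rewrite cC.
    rewrite sumr_const -[kc * p *+ _]mulr_natr -!mulrA ler_pM2l // ler_pM2l //.
    rewrite (_ : #|_| = n.-1); last by rewrite -[in RHS](card_ord n) -(cardC1 i); apply: eq_card.
    by rewrite ler_pdivrMr // -natrM ler_nat leq_double_pred.
  have e1 : eps * q <= kc / 4 * q.
    rewrite ler_pM2r //; apply: (@le_trans _ _ (eps * (2 + 48 / gapc))).
      rewrite ler_peMr ?(ltW eps_gt0) //.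
      have : 0 < 48 / gapc by rewrite divr_gt0.
      lra.
    apply: le_trans eps_kc _; move: kc_gt0; lra.
  have e2 : kc * (p * n%:R / 2) = kc / 2 * q by field.
  move: hb; rewrite e2; lra.
- by move=> i; have [] := hconc i.
- move=> i j; rewrite /g /A /cmat; case: eqVneq => [_|ij]; first by rewrite expr0n /= mulr0.
  rewrite /noise !exprMn edge_sqr.
  have /andP[z0 z1] := edge_itv R (om (pr i j)); set z := edge _ _ in z0 z1 *.
  have k4 : kap i j ^+ 2 <= 2 ^+ 2.
    by rewrite -(ger0_norm (sqr_ge0 _)) normrX; apply: lerXn2r; rewrite ?nnegrE.
  have he := heta i j ij.
  (* The resulting factor 400 fits below 24^2, so the constant 24 serves both for single entries and
     for sums. *)
  have : eta ys i j (om (pr i j)) ^+ 2 * kap i j ^+ 2 <= 100 * (q * delta ^+ 2) * 2 ^+ 2.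
    by apply: ler_pM => //; exact: sqr_ge0.
  move=> /(ler_wpM2l z0) h; rewrite -mulrA; apply: le_trans h _.
  have : 0 <= z * (q * delta ^+ 2) by rewrite !mulr_ge0 ?sqr_ge0 // ltW.
  lra.
- by move=> i; apply: pick_flowP; exact: loo_rhs_sum0.
Qed.

(** The cuts and five families indexed by items cost 2 n each, the pairwise deviations 2 n^2: in
    total at most 14 n^2. *)
Lemma well_conditioned_whp :
  Pr W (fun om => ~ well_conditioned om) <= 14 * n%:R ^+ 2 * expR (- (8 * ell)).
Proof.
set N := expR (- (8 * ell)).
have N0 : 0 <= N by exact: expR_ge0.
have eN : expR (- (eps ^+ 2 * q / 8)) <= N by rewrite ler_expR; move: q_conc; lra.
have eN' : expR (- (q / 64)) <= N.
  rewrite ler_expR; move: ell_q; lra.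
have c0 i j : i != j -> 0 <= c i j <= 1.
  by move=> ij; have /andP[h ->] := c_itv ij; rewrite andbT; apply: le_trans h; exact: ltW.
pose sumB (E : 'I_n -> Om -> Prop) : Om -> Prop := fun om => exists2 m, m \in predT & E m om.
have sumBP (E : 'I_n -> Om -> Prop) : (forall m, Pr W (E m) <= 2 * N) -> Pr W (sumB E) <= n%:R * (2 * N).
  move=> hE; apply: le_trans (Pr_union Wge0 _ _) _.
  rewrite mulr_natl -[X in _ *+ X](card_ord n) -sumr_const.
  by apply: ler_sum => m _; exact: hE.
pose Bcut := fun om : Om => exists2 S : {set 'I_n}, (2 * #|S| <= n)%N &
   \sum_(i in S) \sum_(j in ~: S) A om i j < q / 4 * #|S|%:R.
pose Bdeg := sumB (fun m om => eps * q < `|\sum_i (A om i m - pmat p (fun _ _ => 1) i m)|).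
pose Bcol := sumB (fun m om => eps * q < `|\sum_i (a om i m - b i m)|).
pose Brow := sumB (fun m om => eps * q < `|\sum_i (a om m i - b m i)|).
pose Bloo := sumB (fun m om => exists2 V : R, (forall i, `|vloo e0 p co c (noise kap) f m om i| <= V) &
   eps * q * V < `|\sum_i (a om i m - b i m) * vloo e0 p co c (noise kap) f m om i|).
pose Bnoise := sumB (fun m om => 24 * q * delta < `|\sum_i g om i m|).
pose Beta := fun om : Om => exists2 ij : 'I_n * 'I_n, ij \in [pred ij | ij.1 != ij.2] &
   100 * (q * delta ^+ 2) < eta ys ij.1 ij.2 (om (pr ij.1 ij.2)) ^+ 2.
have incl om : ~ well_conditioned om ->
    Bcut om \/ (Bdeg om \/ (Bcol om \/ (Brow om \/ (Bloo om \/ (Bnoise om \/ Beta om))))).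
  move=> nw; apply: contrapT => h; apply: nw; apply: regular_well_conditioned.
  have [h1 {}h] : ~ Bcut om /\ ~ (Bdeg om \/ (Bcol om \/ (Brow om \/ (Bloo om \/ (Bnoise om \/ Beta om))))) by tauto.
  have [h2 [h3 [h4 [h5 [h6 h7]]]]] : ~ Bdeg om /\ ~ Bcol om /\ ~ Brow om /\ ~ Bloo om /\ ~ Bnoise om /\ ~ Beta om by tauto.
  split.
  - by move=> S hS; rewrite leNgt; apply/negP => hl; apply: h1; exists S.
  - by move=> m; rewrite leNgt; apply/negP => hl; apply: h2; exists m.
  - move=> m; split; rewrite leNgt; apply/negP => hl.
      by apply: h3; exists m.
    by apply: h4; exists m.
  - move=> m V hV; rewrite leNgt; apply/negP => hl.
    by apply: h5; exists m => //; exists V.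
  - split.
      by move=> m; rewrite leNgt; apply/negP => hl; apply: h6; exists m.
    move=> i j ij; rewrite leNgt; apply/negP => hl.
    by apply: h7; exists (i, j).
apply: le_trans (le_Pr Wge0 incl) _.
have one01 : (0 <= 1 :> R) && (1 <= 1 :> R) by rewrite ler01 lexx.
have P1 : Pr W Bcut <= 2 * (n%:R * N).
  exact: (cut_event_all e0 n_gt1 L_gt0 ys_ge0 ysC p_gt0 p_le1 eN' n_ell).
have P2 : Pr W Bdeg <= n%:R * (2 * N).
  apply: sumBP => m; apply: (le_trans _ (ler_wpM2l (ler0n R 2) eN)).
  apply: (col_event ys_ge0 ysC p_gt0 p_le1) => //.
  - by move=> i j x _; have /andP[-> _] := edge_itv R x; rewrite lexx.
  - by move=> i j _; rewrite E_edge mulr1.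
have P3 : Pr W Bcol <= n%:R * (2 * N).
  apply: sumBP => m; apply: (le_trans _ (ler_wpM2l (ler0n R 2) eN)).
  by apply: (col_event ys_ge0 ysC p_gt0 p_le1).
have P4 : Pr W Brow <= n%:R * (2 * N).
  apply: sumBP => m; apply: (le_trans _ (ler_wpM2l (ler0n R 2) eN)).
  by apply: (row_event ys_ge0 ysC p_gt0 p_le1).
have P5 : Pr W Bloo <= n%:R * (2 * N).
  apply: sumBP => m; apply: (le_trans _ (ler_wpM2l (ler0n R 2) eN)).
  by apply: (loo_event ys_ge0 ysC p_gt0 p_le1).
have P6 : Pr W Bnoise <= n%:R * (2 * N).
  by apply: sumBP => m; exact: noise_event.
have P7 : Pr W Beta <= n%:R ^+ 2 * (2 * N).
  apply: le_trans (Pr_union Wge0 _ _) _.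
  apply: (@le_trans _ _ (\sum_(ij : 'I_n * 'I_n) 2 * N)).
    rewrite [leLHS]big_mkcond /=; apply: ler_sum => -[i j] _.
    by case: ifP => [ij|_]; [exact: eta_event | rewrite mulr_ge0].
  by rewrite sumr_const card_prod card_ord -[_ *+ _]mulr_natl natrM expr2.
have H := le_trans (Pr_or Wge0 _ _) (lerD P1 (le_trans (Pr_or Wge0 _ _) (lerD P2
  (le_trans (Pr_or Wge0 _ _) (lerD P3 (le_trans (Pr_or Wge0 _ _) (lerD P4
  (le_trans (Pr_or Wge0 _ _) (lerD P5 (le_trans (Pr_or Wge0 _ _) (lerD P6 P7))))))))))).
apply: le_trans H _.
have n1 : 1 <= n%:R :> R by rewrite ler1n ltnW.
have : n%:R * 1 * N <= n%:R * n%:R * N.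
  by apply: ler_wpM2r => //; apply: ler_wpM2l => //; exact: ltW.
rewrite expr2; lra.
Qed.

End Instance.

(** * Regularized maximum likelihood *)

Section Logistic.
Local Open Scope ring_scope.
Variable R : realType.

Definition sigm (u : R) : R := expR u / (1 + expR u).
Definition softplus (u : R) : R := exp.ln (1 + expR u).

Let e1 (u : R) : 0 < 1 + expR u. Proof. by rewrite ltr_wpDl ?expR_gt0. Qed.

Lemma sigm_ge0 u : 0 <= sigm u.
Proof. by rewrite divr_ge0 ?expR_ge0 // ltW. Qed.

Lemma sigm_le1 u : sigm u <= 1.
Proof. by rewrite ler_pdivrMr // mul1r lerDr. Qed.

Lemma sigmN u : sigm (- u) = 1 - sigm u.
Proof.
have h := expR_gt0 u; rewrite /sigm expRN; field.
by rewrite !gt_eqF // addr_gt0.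
Qed.

Lemma le_sigm u v : u <= v -> sigm u <= sigm v.
Proof.
move=> uv; rewrite ler_pdivrMr // mulrAC ler_pdivlMr //.
by rewrite !mulrDr !mulr1 [expR v * _]mulrC lerD2r ler_expR.
Qed.

Lemma softplus_ge0 u : 0 <= softplus u.
Proof. by rewrite ln_ge0 // lerDl expR_ge0. Qed.

Lemma softplus_ge u : u <= softplus u.
Proof. by rewrite -[leLHS]expRK ler_ln ?posrE ?expR_gt0 // lerDr. Qed.

Lemma softplusN u : softplus (- u) = softplus u - u.
Proof.
rewrite /softplus -[in RHS](expRK u) -ln_div ?posrE ?expR_gt0 // expRK; congr exp.ln.
by rewrite expRN; field; rewrite gt_eqF ?expR_gt0.
Qed.

(** The factorization 1 + exp (u + v) = (1 + exp u) (1 + sigm u (exp v - 1)) reduces the claim to ln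
    (1 + t) <= t. *)
Lemma softplus_le u v : v <= 2^-1 -> softplus (u + v) <= softplus u + sigm u * (v + 2 * v ^+ 2).
Proof.
move=> hv; have s0 := sigm_ge0 u.
have E : 1 + expR (u + v) = (1 + expR u) * (1 + sigm u * (expR v - 1)).
  by rewrite expRD /sigm; field; rewrite gt_eqF.
have p2 : 0 < 1 + sigm u * (expR v - 1).
  by rewrite -(pmulr_rgt0 _ (e1 u)) -E.
rewrite /softplus E lnM ?posrE // lerD2l.
apply: (@le_trans _ _ (sigm u * (expR v - 1))).
  by rewrite -[leRHS]expRK ler_ln ?posrE ?expR_gt0 // expR_ge1Dx.
by apply: ler_wpM2l => //; have := expR_le_quadratic hv; lra.
Qed.

(** With h = exp v - 1, sigm (u + v) is rational in s = sigm u and h, so the remainder is s (1 - s)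
    times an explicit quotient. Its denominator is at least 1 / 2, and s (1 - s) <= 1 / 4. *)
Lemma sigm_taylor u v : `|v| <= 2^-1 ->
  `|sigm (u + v) - sigm u - sigm u * (1 - sigm u) * v| <= 2 * v ^+ 2.
Proof.
move=> hv; have s0 := sigm_ge0 u; have s1 := sigm_le1 u.
have /andP[v0 v1] : - 2^-1 <= v <= 2^-1 by rewrite -ler_norml.
have q := expR_le_quadratic v1; have q' := expR_ge1Dx v.
set s := sigm u in s0 s1 *; pose h := expR v - 1.
have d0 : 2^-1 <= 1 + s * h.
  have : s * (- 2^-1) <= s * h by apply: ler_wpM2l => //; rewrite /h; lra.
  lra.
have dp : 0 < 1 + s * h by lra.
have -> : sigm (u + v) - s - s * (1 - s) * v = s * (1 - s) * ((h - v - s * h * v) / (1 + s * h)).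
  have -> : sigm (u + v) = s * (1 + h) / (1 + s * h).
    have pu := e1 u; have puv : 0 < 1 + expR u * expR v by rewrite -expRD.
    rewrite (_ : 1 + s * h = (1 + expR u * expR v) / (1 + expR u)).
      by rewrite /s /h /sigm expRD; field; rewrite !gt_eqF.
    by rewrite /s /h /sigm; field; rewrite gt_eqF.
  by field; rewrite gt_eqF.
have hh : `|h - v - s * h * v| <= 4 * v ^+ 2.
  have h1 : `|h - v| <= 2 * v ^+ 2 by rewrite /h ler_norml; have := sqr_ge0 v; lra.
  have h2 : `|h| <= 2 * `|v|.
    have -> : h = (h - v) + v by ring.
    apply: le_trans (ler_normD _ _) _.
    have : `|v| * `|v| <= 2^-1 * `|v| by apply: ler_wpM2r.
    rewrite -expr2 -normrX (ger0_norm (sqr_ge0 v)); lra.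
  have h3 : `|s * h * v| <= 2 * v ^+ 2.
    have -> : `|s * h * v| = s * `|h| * `|v| by rewrite 2!normrM [`|s|]ger0_norm.
    have -> : 2 * v ^+ 2 = 2 * `|v| * `|v| by rewrite -mulrA -expr2 -normrX ger0_norm ?sqr_ge0.
    apply: ler_wpM2r => //; apply: le_trans h2.
    by rewrite ler_piMl.
  apply: le_trans (ler_normB _ _) _; lra.
have ss : 0 <= s * (1 - s) <= 4^-1.
  rewrite mulr_ge0 ?subr_ge0 //=.
  have := sqr_ge0 (s - 2^-1); rewrite (_ : (s - 2^-1) ^+ 2 = 4^-1 - s * (1 - s)); last by field.
  by rewrite subr_ge0.
case/andP: ss => ss0 ss1; rewrite normrM (ger0_norm ss0) normrM normfV (gtr0_norm dp).
have : `|h - v - s * h * v| / (1 + s * h) <= 8 * v ^+ 2.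
  rewrite ler_pdivrMr //; apply: le_trans hh _.
  rewrite (_ : 4 * v ^+ 2 = 8 * v ^+ 2 * 2^-1); last by field.
  by apply: ler_wpM2l => //; rewrite mulr_ge0 ?sqr_ge0.
move=> /(ler_wpM2l ss0) /le_trans; apply.
have : 4^-1 * (8 * v ^+ 2) = 2 * v ^+ 2 by field.
by move=> <-; apply: ler_wpM2r => //; rewrite mulr_ge0 ?sqr_ge0.
Qed.

End Logistic.

(** * Existence, score equation and localization of the minimizer *)

Section RegularizedMLE.
Import numFieldNormedType.Exports.
Local Open Scope ring_scope.
Variables (R : realType) (n : nat) (A y : 'I_n -> 'I_n -> R) (lam : R).
Hypothesis A_ge0 : forall i j, 0 <= A i j.
Hypothesis A_sym : forall i j, A i j = A j i.
Hypothesis y_itv : forall i j, 0 <= y i j <= 1.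
Hypothesis Ay : forall i j, A i j * (y i j + y j i) = A i j.
Hypothesis lam_gt0 : 0 < lam.

(* Each edge is counted twice, once per orientation, hence the factor 1/2. *)
Definition objective (th : 'I_n -> R) :=
  2^-1 * (\sum_i \sum_j A i j * (softplus (th j - th i) - y i j * (th j - th i)))
  + lam / 2 * sqnorm th.

Definition score (th : 'I_n -> R) k :=
  \sum_i A i k * (sigm (th k - th i) - y i k) + lam * th k.

Lemma edge_loss_ge0 th i j : 0 <= softplus (th j - th i) - y i j * (th j - th i).
Proof.
set u := th j - th i; have /andP[y0 y1] := y_itv i j.
have s0 := softplus_ge0 u; have s1 := softplus_ge u.
rewrite subr_ge0; have [u0|u0] := leP 0 u.
  by apply: le_trans s1; rewrite ler_piMl.
by apply: le_trans s0; rewrite mulr_ge0_le0 // ltW.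
Qed.

Lemma objective_ge th : lam / 2 * sqnorm th <= objective th.
Proof.
rewrite /objective lerDr mulr_ge0 ?invr_ge0 //.
apply: sumr_ge0 => i _; apply: sumr_ge0 => j _.
by rewrite mulr_ge0 ?edge_loss_ge0.
Qed.

Definition shift_coord k (t : R) (th : 'I_n -> R) i := th i + (if i == k then t else 0).

(** A quadratic upper bound along one coordinate, which makes the score equation provable without
    differentiating the objective. *)
Lemma objective_shift_coord k t th : `|t| <= 2^-1 ->
  objective (shift_coord k t th) <= objective th + t * score th k +
     t ^+ 2 * (\sum_i \sum_j A i j + lam).
Proof.
move=> ht; pose d i : R := if i == k then 1 else 0.
have bE i j : shift_coord k t th j - shift_coord k t th i = (th j - th i) + t * (d j - d i).
  by rewrite /shift_coord /d; case: ifP => _; case: ifP => _; ring.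
have d1 i j : `|d j - d i| <= 1.
  by rewrite /d; case: ifP => _; case: ifP => _; rewrite ?subrr ?subr0 ?sub0r ?normrN ?normr0 ?normr1.
have edge i j : A i j * (softplus (shift_coord k t th j - shift_coord k t th i) - y i j * (shift_coord k t th j - shift_coord k t th i))
   <= A i j * (softplus (th j - th i) - y i j * (th j - th i))
     + t * (A i j * (sigm (th j - th i) - y i j) * (d j - d i)) + 2 * t ^+ 2 * A i j.
  have htd : `|t * (d j - d i)| <= 2^-1.
    by rewrite normrM; apply: le_trans ht; rewrite ler_piMr.
  rewrite bE; set u := th j - th i; set D := d j - d i in htd *.
  have := softplus_le u (le_trans (ler_norm _) htd).
  have D2 : D ^+ 2 <= 1 by rewrite -(ger0_norm (sqr_ge0 _)) normrX exprn_ile1 ?d1.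
  have : sigm u * (2 * (t * D) ^+ 2) <= 1 * (2 * t ^+ 2).
    apply: ler_pM; [exact: sigm_ge0 | by apply: mulr_ge0 => //; exact: sqr_ge0 | exact: sigm_le1 |].
    by apply: ler_wpM2l => //; rewrite exprMn ler_piMr ?sqr_ge0.
  move=> h1 h2.
  have : softplus (u + t * D) - y i j * (u + t * D) <=
     softplus u - y i j * u + t * ((sigm u - y i j) * D) + 2 * t ^+ 2 by lra.
  move=> /(ler_wpM2l (A_ge0 i j)); lra.
have sumE : \sum_i \sum_j A i j * (sigm (th j - th i) - y i j) * (d j - d i) =
    2 * \sum_i A i k * (sigm (th k - th i) - y i k).
  transitivity (\sum_i \sum_j A i j * (sigm (th j - th i) - y i j) * d j
    - \sum_i \sum_j A i j * (sigm (th j - th i) - y i j) * d i).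
    rewrite -sumrB; apply: eq_bigr => i _; rewrite -sumrB; apply: eq_bigr => j _; ring.
  have pick (F : 'I_n -> R) : \sum_j F j * d j = F k.
    rewrite (bigD1 k) //= /d eqxx mulr1 big1 ?addr0 // => j /negPf ->.
    exact: mulr0.
  under eq_bigr do rewrite pick.
  rewrite [X in _ - X]exchange_big /=.
  under [X in _ - X]eq_bigr do rewrite pick.
  rewrite -sumrB mulr_sumr; apply: eq_bigr => i _.
  rewrite (A_sym k i) -(opprB (th k) (th i)) sigmN.
  have := Ay i k; rewrite mulrDr.
  lra.
have sqE : sqnorm (shift_coord k t th) = sqnorm th + 2 * t * th k + t ^+ 2.
  rewrite /sqnorm (bigD1 k) //= [in RHS](bigD1 k) //= {1}/shift_coord eqxx.
  rewrite (_ : \sum_(i < n | i != k) shift_coord k t th i ^+ 2 = \sum_(i < n | i != k) th i ^+ 2).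
    ring.
  by apply: eq_bigr => i /negPf ik; rewrite /shift_coord ik addr0.
have big : \sum_i \sum_j A i j * (softplus (shift_coord k t th j - shift_coord k t th i) - y i j * (shift_coord k t th j - shift_coord k t th i))
  <= \sum_i \sum_j A i j * (softplus (th j - th i) - y i j * (th j - th i))
    + t * (2 * \sum_i A i k * (sigm (th k - th i) - y i k)) + 2 * t ^+ 2 * \sum_i \sum_j A i j.
  rewrite -sumE !mulr_sumr -!big_split /=; apply: ler_sum => i _.
  by rewrite !mulr_sumr -!big_split /=; apply: ler_sum => j _; exact: edge.
rewrite /objective /score sqE.
have : 0 <= lam * t ^+ 2 by rewrite mulr_ge0 ?sqr_ge0 // ltW.
lra.
Qed.

Lemma score_min th : (forall th', objective th <= objective th') -> forall k, score th k = 0.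
Proof.
move=> hmin k; apply: contrapT => /eqP D0; set D := score th k in D0.
pose C := \sum_i \sum_j A i j + lam.
have C0 : 0 <= C.
  by rewrite addr_ge0 ?(ltW lam_gt0) //; apply: sumr_ge0 => i _; apply: sumr_ge0.
have Dp : 0 < `|D| by rewrite normr_gt0.
(* A descent step - D tau, short enough to be admissible (tau |D| <= 1 / 2) and to beat the
   quadratic term (tau C < 1). *)
pose tau := (1 + C + 2 * `|D|)^-1.
have dp : 0 < 1 + C + 2 * `|D| by lra.
have tp : 0 < tau by rewrite invr_gt0.
have tE : tau * (1 + C + 2 * `|D|) = 1 by rewrite mulVf // gt_eqF.
have tC : 0 <= tau * C by rewrite mulr_ge0 // ltW.
have tD : 0 <= tau * `|D| by rewrite mulr_ge0 // ltW.
have ht : `|- (D * tau)| <= 2^-1.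
  rewrite normrN normrM (gtr0_norm tp) mulrC; lra.
have := le_trans (hmin _) (objective_shift_coord k th ht); rewrite -/D -/C.
have D2 : 0 < D ^+ 2 by rewrite lt_def sqr_ge0 sqrf_eq0 D0.
have tC1 : 0 < 1 - tau * C by move: tE; rewrite !mulrDr; lra.
have := mulr_gt0 (mulr_gt0 D2 tp) tC1.
have -> : (- (D * tau)) ^+ 2 * C = D ^+ 2 * tau * (tau * C) by ring.
have -> : - (D * tau) * D = - (D ^+ 2 * tau) by ring.
lra.
Qed.

(* At a maximizer of th - th', every edge term of the score of
   th dominates that of th', and the ridge term makes the domination strict. *)
Lemma score_comparison th th' :
  (forall k, score th k <= 0) -> (forall k, 0 <= score th' k) -> forall k, th k <= th' k.
Proof.
move=> hth hth' k.
have [i _ hi] := @arg_maxP _ _ _ k xpredT (fun i => th i - th' i) isT.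
apply: contrapT => /negP; rewrite -ltNge => hk.
have pos : 0 < th i - th' i by apply: lt_le_trans (hi k isT); rewrite subr_gt0.
have := le_trans (hth i) (hth' i); apply/negP; rewrite -ltNge.
rewrite /score; apply: ler_ltD; last by rewrite ltr_pM2l // -subr_gt0.
apply: ler_sum => j _; apply: ler_wpM2l => //; rewrite lerD2r; apply: le_sigm.
have : th j - th' j <= th i - th' i := hi j isT.
lra.
Qed.

Lemma objective_continuous : continuous (fun v : 'rV[R]_n => objective (v ord0)).
Proof.
have sum_cont (T : topologicalType) (I : finType) (F : I -> T -> R) :
    (forall i, continuous (F i)) -> continuous (fun x => \sum_i F i x).
  by move=> hF; apply: continuous_big => //; exact: add_continuous.
have diff_cont i j : continuous (fun v : 'rV[R]_n => v ord0 j - v ord0 i).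
  move=> v; apply: continuousB; exact: coord_continuous.
have sp_cont : continuous (@softplus R).
  move=> u; apply: (@continuous_comp _ _ _ (fun u => 1 + expR u) (@exp.ln R)).
    by apply: continuousD; [exact: cst_continuous | exact: continuous_expR].
  by apply: continuous_ln; rewrite ltr_wpDl ?expR_gt0.
have mul_cont (T : topologicalType) (F G : T -> R) :
    continuous F -> continuous G -> continuous (fun x => F x * G x).
  by move=> hF hG x; apply: continuousM; [exact: hF | exact: hG].
have add_cont (T : topologicalType) (F G : T -> R) :
    continuous F -> continuous G -> continuous (fun x => F x + G x).
  by move=> hF hG x; apply: cvgD; [exact: hF | exact: hG].
have sub_cont (T : topologicalType) (F G : T -> R) :
    continuous F -> continuous G -> continuous (fun x => F x - G x).
  by move=> hF hG x; apply: cvgB; [exact: hF | exact: hG].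
have cst_cont (T : topologicalType) (c : R) : continuous (fun _ : T => c).
  exact: cst_continuous.
apply: (add_cont _ _ _).
  apply: (mul_cont _ (fun=> 2^-1)) => //.
  apply: (sum_cont _ _ _) => i; apply: (sum_cont _ _ _) => j.
  apply: (mul_cont _ (fun=> A i j)) => //.
  apply: sub_cont.
    move=> v; apply: (@continuous_comp _ _ _ (fun v : 'rV[R]_n => v ord0 j - v ord0 i) (@softplus R)).
      exact: diff_cont.
    exact: sp_cont.
  by apply: (mul_cont _ (fun=> y i j)).
apply: (mul_cont _ (fun=> lam / 2)) => //.
apply: (sum_cont _ _ _) => i; rewrite /GRing.exp /=.
by apply: mul_cont; exact: coord_continuous.
Qed.

Lemma objective_minimizer : exists th, forall th', objective th <= objective th'.
Proof.
(* Outside the box of radius B >= 1 the ridge term alone is at least lam / 2 * B = lam / 2 + m0, so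
   the minimum over the compact box is global. *)
pose m0 := objective (fun=> 0); pose B := 1 + 2 * m0 / lam.
have m0_ge0 : 0 <= m0.
  apply: le_trans (objective_ge _); rewrite mulr_ge0 ?sqnorm_ge0 // divr_ge0 //.
  exact: ltW.
have B1 : 1 <= B by rewrite lerDl divr_ge0 ?mulr_ge0 // ltW.
pose box := [set v : 'rV[R]_n | forall i, `[- B, B]%classic (v ord0 i)]%classic.
have box_compact := @rV_compact R n (fun=> `[- B, B]%classic) (fun=> @segment_compact R (- B) B).
have inbox (th : 'I_n -> R) : (forall i, `|th i| <= B) -> box (\row_i th i).
  by move=> h i; rewrite mxE /= in_itv /= -ler_norml.
have rowE (th : 'I_n -> R) : (\row_i th i) ord0 = th by apply/funext => i; rewrite mxE.
have [|v _ hv] := @EVT_min_rV R n _ box _ box_compact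
    (continuous_subspaceT objective_continuous).
  by exists (\row_i 0); apply: inbox => i; rewrite normr0 (le_trans ler01).
exists (v ord0) => th.
have [inB|] := pselect (forall i, `|th i| <= B).
  by have := hv (\row_i th i); rewrite rowE; apply; rewrite in_setE; exact: inbox.
move=> /existsNP[i /negP]; rewrite -ltNge => hi.
apply: (@le_trans _ _ m0).
  have := hv (\row_i 0); rewrite rowE; apply; rewrite in_setE; apply: inbox => j.
  by rewrite normr0 (le_trans ler01).
apply: le_trans (objective_ge th).
have h1 : B <= sqnorm th.
  apply: le_trans (coord_le_sqnorm th i); rewrite -(ger0_norm (sqr_ge0 _)) normrX.
  apply: (@le_trans _ _ (`|th i| * 1)); first by rewrite mulr1 ltW.
  by rewrite expr2; apply: ler_wpM2l => //; exact: le_trans B1 (ltW hi).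
have : lam / 2 * B <= lam / 2 * sqnorm th by apply: ler_wpM2l => //; rewrite divr_ge0 // ltW.
apply: le_trans; rewrite /B (_ : _ * _ = lam / 2 + m0); last by field; rewrite gt_eqF.
by rewrite lerDr divr_ge0 // ltW.
Qed.

(* th0 + x +- z are super- and subsolutions of the score equation: a constant shift z leaves
   all differences unchanged, and its ridge contribution lam * z absorbs the quadratic Taylor
   remainder of the logistic function. *)
Lemma rmle_close (th0 x : 'I_n -> R) (q xi : R) (th : 'I_n -> R) :
  (forall j, \sum_i A i j <= 2 * q) -> 0 <= q ->
  (forall j, flow (fun i k => A i k * (sigm (th0 i - th0 k) * (1 - sigm (th0 i - th0 k)))) x j =
     lam * th0 j - \sum_i A i j * (y i j - sigm (th0 j - th0 i))) ->
  (forall j, `|x j| <= xi) -> xi <= 4^-1 ->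
  (forall th', objective th <= objective th') ->
  forall j, `|th j - th0 j| <= 2 * xi + 16 * q * xi ^+ 2 / lam.
Proof.
move=> deg q0 hflow hx hxi hmin k.
have xi0 : 0 <= xi by apply: le_trans (hx k).
pose z := xi + 16 * q * xi ^+ 2 / lam.
(* By the choice of x the linear terms cancel, leaving Taylor remainders: each is at most 2 (2
   xi)^2, over a degree of at most 2 q. *)
have shifted (s : R) j : `|score (fun i => th0 i + x i + s) j - lam * (x j + s)| <= 16 * q * xi ^+ 2.
  have -> : score (fun i => th0 i + x i + s) j - lam * (x j + s) =
     \sum_i A i j * (sigm ((th0 j - th0 i) + (x j - x i)) - sigm (th0 j - th0 i)
        - sigm (th0 j - th0 i) * (1 - sigm (th0 j - th0 i)) * (x j - x i)).
    have := hflow j; rewrite /flow /score => E.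
    transitivity (\sum_i A i j * (sigm (th0 j + x j + s - (th0 i + x i + s)) - y i j)
      + \sum_i A i j * (y i j - sigm (th0 j - th0 i))
      + (lam * th0 j - \sum_i A i j * (y i j - sigm (th0 j - th0 i)))); first by ring.
    rewrite -E -!big_split /=; apply: eq_bigr => i _.
    rewrite (A_sym j i) -(opprB (th0 j) (th0 i)) sigmN.
    rewrite (_ : th0 j + x j + s - (th0 i + x i + s) = (th0 j - th0 i) + (x j - x i)); last by ring.
    by ring.
  apply: le_trans (ler_norm_sum _ _ _) _.
  apply: (@le_trans _ _ (\sum_i A i j * (8 * xi ^+ 2))).
    apply: ler_sum => i _; rewrite normrM ger0_norm //; apply: ler_wpM2l => //.
    have hd : `|x j - x i| <= 2 * xi.
      by apply: le_trans (ler_normB _ _) _; rewrite mulr_natl mulr2n; apply: lerD.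
    have hd2 : `|x j - x i| <= 2^-1 by apply: le_trans hd _; lra.
    apply: le_trans (sigm_taylor _ hd2) _.
    have : (x j - x i) ^+ 2 <= (2 * xi) ^+ 2.
      rewrite -(ger0_norm (sqr_ge0 (x j - x i))) normrX; apply: lerXn2r => //.
      by rewrite nnegrE mulr_ge0.
    rewrite exprMn; lra.
  rewrite -mulr_suml; have := ler_wpM2r (_ : 0 <= 8 * xi ^+ 2) (deg j).
  move=> /(_ (mulr_ge0 (ler0n R 8) (sqr_ge0 xi))) h; apply: le_trans h _.
  by rewrite le_eqVlt; apply/orP; left; apply/eqP; ring.
have zE : lam * (z - xi) = 16 * q * xi ^+ 2 by rewrite /z; field; rewrite gt_eqF.
have sc0 := score_min hmin.
have up : th k <= th0 k + x k + z.
  apply: (score_comparison (th := th) (th' := fun i => th0 i + x i + z)) => [j|j].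
    by rewrite sc0.
  have /ler_normlP[h1 h2] := shifted z j; have /ler_normlP[h3 h4] := hx j.
  have : lam * (z - xi) <= lam * (x j + z) by rewrite ler_pM2l //; lra.
  by rewrite zE; lra.
have lo : th0 k + x k + (- z) <= th k.
  apply: (score_comparison (th := fun i => th0 i + x i + (- z)) (th' := th)) => [j|j]; last first.
    by rewrite sc0.
  have /ler_normlP[h1 h2] := shifted (- z) j; have /ler_normlP[h3 h4] := hx j.
  have : lam * (z - xi) <= lam * - (x j + (- z)) by rewrite ler_pM2l //; lra.
  by rewrite zE; lra.
have /ler_normlP[h3 h4] := hx k.
rewrite (_ : 2 * xi + _ = xi + z); last by rewrite /z; ring.
by rewrite ler_norml; apply/andP; split; lra.
Qed.

End RegularizedMLE.

(** * Recovery of the ranking *)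

Section SpectralRecovery.
Local Open Scope ring_scope.
Variables (R : realFieldType) (n : nat) (a0 : 'I_n -> 'I_n -> R) (u : 'I_n -> R).
Variables (g xi : R).
Let a i j := a0 i j * u i.
Hypotheses (n_gt0 : (0 < n)%N) (g_gt0 : 0 < g) (a_coercive : coercive a g).
Hypotheses (u_gt0 : forall i, 0 < u i) (u_le1 : forall i, u i <= 1).
Hypothesis xi_lt1 : xi < 1.
Hypothesis flow_bound : forall x, \sum_i x i = 0 ->
  (forall j, flow a x j = - \sum_i (a i j - a j i)) -> forall m, `|x m| <= xi.

Lemma flow_weighted v j : flow a0 (fun i => u i * v i) j = flow a v j.
Proof. by apply: eq_bigr => i _; rewrite /a !mulrA. Qed.

Lemma flow_inj x : \sum_i x i = 0 -> (forall j, flow a x j = 0) -> forall i, x i = 0.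
Proof.
move=> x0 fx; apply: sqnorm_eq0.
have := coercive_bound g_gt0 a_coercive x0.
rewrite (_ : sqnorm (flow a x) = 0); last first.
  by rewrite /sqnorm big1 // => j _; rewrite fx expr0n.
by rewrite pmulr_rle0 ?exprn_gt0.
Qed.

(** The right-hand side is minus the flow of the constant 1, so 1 + x is annihilated by the weighted
    flow. *)
Lemma exists_correction : exists x, [/\ \sum_i x i = 0,
  forall j, flow a x j = - \sum_i (a i j - a j i) & forall m, `|x m| <= xi].
Proof.
have b0 : \sum_j - \sum_i (a i j - a j i) = 0.
  rewrite sumrN; apply/eqP; rewrite oppr_eq0; apply/eqP; under eq_bigr do rewrite sumrB.
  by rewrite sumrB [X in X - _]exchange_big subrr.
have [x [x0 [fx|[[i xi0] fx]]]] := flow_solve a b0.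
  by exists x; split=> //; exact: flow_bound.
by have := flow_inj x0 fx i; move/eqP: xi0.
Qed.

(* The stationary vectors are the multiples of u i * (1 + x i). *)
Lemma spectral_recovery :
  (exists pi, \sum_i pi i = 1 /\ forall j, flow a0 pi j = 0) /\
  (forall pi, \sum_i pi i = 1 -> (forall j, flow a0 pi j = 0) ->
   forall i j, 2 * xi < u i - u j -> pi j < pi i).
Proof.
have [x [x0 fx xb]] := exists_correction.
have x1 i : 0 < 1 + x i by have /ler_normlP[] := xb i; move: xi_lt1; lra.
have flow1 j : flow a (fun i => 1 + x i) j = 0 by rewrite flowD_cst fx mul1r subrr.
pose S := \sum_i u i * (1 + x i).
have Sp : 0 < S.
  rewrite /S (bigD1 (Ordinal n_gt0)) //= ltr_pwDl ?mulr_gt0 //.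
  by apply: sumr_ge0 => i _; rewrite ltW // mulr_gt0.
split.
  exists (fun i => u i * (S^-1 * (1 + x i))); split.
    under eq_bigr do rewrite mulrCA.
    by rewrite -mulr_sumr -/S mulVf // gt_eqF.
  by move=> j; rewrite flow_weighted flowZ flow1 mulr0.
move=> pi pi1 fpi i j hij.
pose v k := pi k / u k.
have piE k : pi k = u k * v k by rewrite /v mulrC divfK // gt_eqF.
have fv k : flow a v k = 0.
  by rewrite -flow_weighted -(fpi k); apply: eq_bigr => l _; rewrite -!piE.
pose m := (\sum_k v k) / n%:R.
have n0 : n%:R != 0 :> R by rewrite pnatr_eq0 -lt0n.
(* Subtracting the multiple of 1 + x with the same mean leaves a sum-zero kernel vector, which
   coercivity forces to vanish. *)
have y0 : \sum_k (v k - m * (1 + x k)) = 0.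
  rewrite sumrB -mulr_sumr big_split /= x0 addr0 sumr_const card_ord.
  by rewrite -mulr_natr mul1r /m divfK // subrr.
have fy k : flow a (fun k => v k - m * (1 + x k)) k = 0.
  by rewrite flowB fv flowZ flow1 mulr0 subrr.
have vE k : v k = m * (1 + x k) by apply/eqP; rewrite -subr_eq0 (flow_inj y0 fy).
have mS : m * S = 1.
  by rewrite -pi1 /S mulr_sumr; apply: eq_bigr => k _; rewrite piE vE mulrCA.
have mp : 0 < m by rewrite -(pmulr_lgt0 _ Sp) mS.
rewrite !piE !vE !(mulrCA (u _)) ltr_pM2l //.
have xi0 : 0 <= xi by apply: le_trans (xb i).
have hi : - xi <= u i * x i.
  have /ler_normlP[h1 h2] : `|u i * x i| <= xi.
    rewrite normrM (gtr0_norm (u_gt0 i)); apply: le_trans (xb i); exact: ler_piMl.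
  lra.
have hj : u j * x j <= xi.
  have /ler_normlP[h1 h2] : `|u j * x j| <= xi.
    rewrite normrM (gtr0_norm (u_gt0 j)); apply: le_trans (xb j); exact: ler_piMl.
  lra.
lra.
Qed.

End SpectralRecovery.

(** * The spectral method and the MLE as flow systems *)

Section Recovery.
Local Open Scope ring_scope.
Variables (R : realType) (n L : nat) (e0 : pairT n).
Hypotheses (n_gt1 : (1 < n)%N) (L_gt0 : (0 < L)%N).
Variables (u : 'I_n -> R) (p k clam : R).
Hypotheses (k_gt0 : 0 < k) (k_le1 : k <= 1).
Hypothesis u_itv : forall i, k <= u i <= 1.
Hypotheses (p_gt0 : 0 < p) (p_le1 : p <= 1) (clam_gt0 : 0 < clam).

Notation pr := (pairof e0).
Notation X := (bool * {ffun 'I_L -> bool})%type.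
Notation Om := {ffun pairT n -> X}.
Definition btl i j : R := u j / (u i + u j).
Notation W := (@pairw R n L btl p).
Notation q := (n%:R * p).

Lemma u_gt0 i : 0 < u i.
Proof. by have /andP[h _] := u_itv i; exact: lt_le_trans h. Qed.

Lemma u_le1 i : u i <= 1.
Proof. by have /andP[_ h] := u_itv i. Qed.

Lemma btl_ge0 i j : 0 <= btl i j.
Proof. by rewrite divr_ge0 ?addr_ge0 // ltW // u_gt0. Qed.

Let uu i j : u i + u j != 0.
Proof. by rewrite gt_eqF // addr_gt0 // u_gt0. Qed.

Lemma btlC i j : btl i j + btl j i = 1.
Proof. by rewrite /btl [u j + u i]addrC -mulrDl [u j + u i]addrC divff. Qed.

Definition logscore i := exp.ln (u i).
(** Centered, so that the ridge bias sums to zero as solvability of the flow system requires;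
    differences of scores are unchanged. *)
Definition theta0 i := logscore i - (\sum_j logscore j) / n%:R.

Lemma sigm_theta0 i j : sigm (theta0 j - theta0 i) = btl i j.
Proof.
rewrite /theta0 opprB addrA subrK /logscore /sigm expRB !lnK ?posrE ?u_gt0 //.
by rewrite /btl; field; rewrite uu gt_eqF ?u_gt0.
Qed.

Let n0 : n%:R != 0 :> R.
Proof. by rewrite pnatr_eq0 -lt0n ltnW. Qed.

Lemma theta0_sum0 : \sum_i theta0 i = 0.
Proof. by rewrite sumrB sumr_const card_ord -[X in _ - X]mulr_natr divfK // subrr. Qed.

Lemma theta0_le i : `|theta0 i| <= - exp.ln k.
Proof.
have lk j : exp.ln k <= logscore j <= 0.
  rewrite ler_ln ?posrE ?u_gt0 //; have /andP[-> _] /= := u_itv j.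
  by rewrite ln_le0 // u_le1.
have : n%:R * exp.ln k <= \sum_j logscore j <= 0.
  rewrite mulr_natl -{1}(card_ord n) -sumr_const; apply/andP; split.
    by apply: ler_sum => j _; have /andP[] := lk j.
  by apply: sumr_le0 => j _; have /andP[] := lk j.
case/andP=> h1 h2; have np : 0 < n%:R :> R by rewrite ltr0n ltnW.
have h3 : exp.ln k <= (\sum_j logscore j) / n%:R by rewrite ler_pdivlMr // mulrC.
have h4 : (\sum_j logscore j) / n%:R <= 0 by rewrite ler_pdivrMr // mul0r.
have /andP[h5 h6] := lk i.
by rewrite /theta0 ler_norml; apply/andP; split; lra.
Qed.

(** With t = u_j / u_i, - ln t >= 1 - t = (u_i - u_j) / u_i, and u_i <= 1. *)
Lemma theta0_gap i j : u j <= u i -> u i - u j <= theta0 i - theta0 j.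
Proof.
move=> h.
have -> : theta0 i - theta0 j = - exp.ln (u j / u i).
  by rewrite ln_div ?posrE ?u_gt0 // /theta0 /logscore; ring.
have h1 : exp.ln (u j / u i) <= u j / u i - 1.
  rewrite -[leRHS]expRK ler_ln ?posrE ?divr_gt0 ?u_gt0 ?expR_gt0 //.
  by apply: le_trans (expR_ge1Dx _); rewrite addrC subrK.
have h2 : u i - u j <= 1 - u j / u i.
  have ui := u_gt0 i.
  rewrite -(ler_pM2l ui) [leRHS]mulrBr mulr1 [u i * (_ / _)]mulrC divfK ?gt_eqF //.
  by rewrite ler_piMl ?u_le1 // subr_ge0.
lra.
Qed.

Variables (ell delta : R).
Hypotheses (delta_gt0 : 0 < delta) (delta_le : delta <= 4^-1).
Hypothesis deltaE : q * L%:R * delta ^+ 2 = ell.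
Hypothesis ell_q : 512 * ell <= q.

(* Lower bounds for the conductances co i j + co j i and for the mean rates, valid for both
   the spectral and the MLE instance, followed by the size of the ridge bias lam * theta0
   relative to q * delta. *)
Definition ks := k / 2.
Definition kc := k / 4.
Definition biasc := clam * - exp.ln k.
(* Small enough for the hypotheses eps_gap and eps_kc of the leave-one-out bound. *)
Definition epsc := gapc ks * kc / 400.
Definition errc := loo_cst ks kc biasc.

Hypothesis eps_q : 1 <= epsc ^+ 2 * q.
Hypothesis q_conc : 64 * ell <= epsc ^+ 2 * q.
Hypothesis n_ell : n%:R * expR (- (8 * ell)) <= 2^-1.
Hypothesis err_small : errc * delta <= 4^-1.

Let lam := clam * q * delta.
Let np : 0 < n%:R :> R. Proof. by rewrite ltr0n ltnW. Qed.
Let qp : 0 < q. Proof. exact: mulr_gt0. Qed.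
Let lam_gt0 : 0 < lam. Proof. by rewrite !mulr_gt0. Qed.
Let ks_gt0 : 0 < ks. Proof. by rewrite divr_gt0. Qed.
Let kc_gt0 : 0 < kc. Proof. by rewrite divr_gt0. Qed.

Let biasc_ge0 : 0 <= biasc.
Proof. by rewrite mulr_ge0 ?oppr_ge0 ?ln_le0 // ltW. Qed.

Let gap_gt0 : 0 < gapc ks. Proof. by rewrite divr_gt0 // exprn_gt0. Qed.

Let gap_le1 : gapc ks <= 1.
Proof.
rewrite /gapc /ks; have : k ^+ 2 <= 1 by rewrite exprn_ile1 // ltW.
have := sqr_ge0 k; rewrite expr_div_n; lra.
Qed.

Let kc_le1 : kc <= 1. Proof. by rewrite /kc; move: k_le1; lra. Qed.

Let gk_gt0 : 0 < gapc ks * kc. Proof. exact: mulr_gt0. Qed.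
Let gk_le_gap : gapc ks * kc <= gapc ks. Proof. by rewrite ler_piMr // ltW. Qed.

Let eps01 : 0 < epsc <= 1.
Proof.
rewrite /epsc; move: gk_gt0 gk_le_gap gap_le1 => h1 h2 h3.
by apply/andP; split; lra.
Qed.

Let eps_gap : 16 * epsc <= gapc ks.
Proof. rewrite /epsc; move: gk_gt0 gk_le_gap gap_le1 => h1 h2 h3; lra. Qed.

Let eps_kc : epsc * (2 + 48 / gapc ks) <= kc / 8.
Proof.
have -> : epsc * (2 + 48 / gapc ks) = (2 * (gapc ks * kc) + 48 * kc) / 400.
  by rewrite /epsc; field; rewrite gt_eqF.
have : gapc ks * kc <= 1 * kc by rewrite ler_pM2r.
have := kc_gt0; lra.
Qed.

Definition spectral_flow (om : Om) :=
  cmat e0 (fun i j x => edge R x * ycoord R i j x) om.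
Definition edge_mat (om : Om) := cmat e0 (fun _ _ => @edge R L) om.
Definition outcome (om : Om) i j := ycoord R i j (om (pr i j)).

Definition spectral_ok (om : Om) :=
  (exists pi, \sum_i pi i = 1 /\ forall j, flow (spectral_flow om) pi j = 0) /\
  (forall pi, \sum_i pi i = 1 -> (forall j, flow (spectral_flow om) pi j = 0) ->
   forall i j, 2 * (errc * delta) < u i - u j -> pi j < pi i).

Definition mle_ok (om : Om) :=
  (exists th, forall th', objective (edge_mat om) (outcome om) lam th <=
                          objective (edge_mat om) (outcome om) lam th') /\
  (forall th, (forall th', objective (edge_mat om) (outcome om) lam th <=
                           objective (edge_mat om) (outcome om) lam th') ->
   forall i j, (4 * errc + 32 * errc ^+ 2 / clam) * delta < u i - u j -> th j < th i).

(** The weight u_i is the substitution pi = u v. The imbalance of a pair is edge * (y_ij (u_i + u_j)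
    - u_j), which is the noise eta times u_i + u_j: hence [spectral_noise]. *)
Definition spectral_coef i j (x : X) := edge R x * ycoord R i j x * u i.
Definition spectral_noise i j := - (u i + u j).
(** The derivative of the logistic function at the true score difference; its only randomness is the
    edge. *)
Definition mle_coef i j (x : X) := edge R x * (btl i j * btl j i).

Let spectral_wc := well_conditioned e0 btl p delta spectral_coef spectral_noise (fun=> 0) ks kc biasc.
Let mle_wc := well_conditioned e0 btl p delta mle_coef (fun _ _ => -1) (fun i => lam * theta0 i) ks kc biasc.

Lemma spectral_wc_ok om : spectral_wc om -> spectral_ok om.
Proof.
case=> coe _ bnd.
have aE : (fun i j => spectral_flow om i j * u i) = cmat e0 spectral_coef om.
  apply/funext => i; apply/funext => j; rewrite /spectral_flow /cmat.
  by case: ifP => _; rewrite ?mul0r.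
apply: (spectral_recovery (ltnW n_gt1) (g := gapc ks * q)); rewrite ?aE //.
- exact: mulr_gt0.
- exact: u_gt0.
- exact: u_le1.
- apply: le_lt_trans err_small _; lra.
move=> x x0 fx; apply: bnd => // j; rewrite fx add0r -sumrN; apply: eq_bigr => i _.
rewrite /spectral_flow /cmat eq_sym; case: eqVneq => [_|ij]; first by rewrite !mul0r subrr oppr0.
have ji : i != j by rewrite eq_sym.
rewrite (pairofC e0 ij) /spectral_coef /noise /spectral_noise /eta.
set x1 := om _; have yC := ycoordC R x1 ji.
have bE : btl i j * (u i + u j) = u j by rewrite /btl divfK.
have -> : ycoord R j i x1 = 1 - ycoord R i j x1 by rewrite -yC; ring.
set t := btl i j in bE *; set y := ycoord _ _ _ _; set z := edge _ _.
by transitivity (- (z * (y * (u i + u j) - t * (u i + u j)))); [rewrite bE|]; ring.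
Qed.

Lemma mle_wc_ok om : mle_wc om -> mle_ok om.
Proof.
case=> coe deg bnd.
have A0 i j : 0 <= edge_mat om i j.
  by rewrite /edge_mat /cmat; case: ifP => // _; have /andP[] := edge_itv R (om (pr i j)).
have Asym i j : edge_mat om i j = edge_mat om j i.
  by rewrite /edge_mat /cmat eq_sym; case: eqVneq => // ij; rewrite pairofC // eq_sym.
have y01 i j : 0 <= outcome om i j <= 1 by exact: ycoord_itv.
have Ay i j : edge_mat om i j * (outcome om i j + outcome om j i) = edge_mat om i j.
  rewrite /edge_mat /cmat; case: eqVneq => [_|ij]; first by rewrite mul0r.
  by rewrite /outcome (pairofC e0 (i := j)) 1?eq_sym // ycoordC // mulr1.
have [x [x0 fx]] : exists x, \sum_i x i = 0 /\ forall j, flow (cmat e0 mle_coef om) x j =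
    lam * theta0 j + \sum_i cmat e0 (noise btl (fun _ _ => -1)) om i j.
  have antisym i j : cmat e0 (noise btl (fun _ _ => -1)) om i j =
      - cmat e0 (noise btl (fun _ _ => -1)) om j i.
    rewrite /cmat eq_sym; case: eqVneq => [_|ij]; first by rewrite oppr0.
    by rewrite /noise (pairofC e0) 1?eq_sym // (etaC btlC) //; ring.
  have b0 : \sum_j (lam * theta0 j + \sum_i cmat e0 (noise btl (fun _ _ => -1)) om i j) = 0.
    by rewrite big_split /= -mulr_sumr theta0_sum0 mulr0 add0r; exact: antisym_sum0.
  have [x [x0 [fx|[[i xi0] fx]]]] := flow_solve (cmat e0 mle_coef om) b0.
    by exists x.
  exfalso; move/eqP: xi0; apply; apply: sqnorm_eq0.
  have gq : 0 < gapc ks * q by exact: mulr_gt0.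
  have := coercive_bound gq coe x0.
  rewrite (_ : sqnorm (flow _ x) = 0); last first.
    by rewrite /sqnorm big1 // => j _; rewrite fx expr0n.
  by rewrite pmulr_rle0 ?exprn_gt0.
have xb := bnd x x0 fx.
split; first exact: objective_minimizer.
move=> th hmin i j hij.
have close := @rmle_close R n (edge_mat om) (outcome om) lam A0 Asym Ay lam_gt0
  theta0 x q (errc * delta) th deg (ltW qp) _ xb err_small hmin.
(* Both xi = errc * delta and lam = clam * q * delta carry a factor delta, so the remainder q xi^2 /
   lam is again of order delta. *)
have {close} close m : `|th m - theta0 m| <= (2 * errc + 16 * errc ^+ 2 / clam) * delta.
  rewrite [leRHS](_ : _ = 2 * (errc * delta) + 16 * q * (errc * delta) ^+ 2 / lam); last first.
    by rewrite /lam; field; rewrite !gt_eqF.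
  apply: close => l; rewrite -[RHS]/(_ - _).
  transitivity (flow (cmat e0 mle_coef om) x l).
    apply: eq_bigr => m' _; rewrite !sigm_theta0 /edge_mat /mle_coef /cmat [l == m']eq_sym.
    case: eqVneq => [_|ml]; first by rewrite !mul0r.
    have b1 r t : 1 - btl r t = btl t r by rewrite -(btlC r t); ring.
    by rewrite !b1; ring.
  rewrite fx -sumrN; congr (_ + _); apply: eq_bigr => m' _.
  rewrite /edge_mat /cmat sigm_theta0; case: eqVneq => [_|ml]; first by rewrite mul0r oppr0.
  by rewrite /noise /outcome /eta; ring.
have h0 : 0 <= (4 * errc + 32 * errc ^+ 2 / clam) * delta.
  have := le_trans (normr_ge0 _) (close i); lra.
have := @theta0_gap i j; rewrite -subr_ge0 => /(_ (ltW (le_lt_trans h0 hij))).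
have /ler_normlP[a1 a2] := close i; have /ler_normlP[a3 a4] := close j.
move: hij; lra.
Qed.

Lemma spectral_wc_whp :
  Pr W (fun om => ~ spectral_wc om) <= 14 * n%:R ^+ 2 * expR (- (8 * ell)).
Proof.
have uu0 i j : 0 < u i + u j by rewrite addr_gt0 ?u_gt0.
apply: (well_conditioned_whp (e0 := e0) n_gt1 L_gt0 btl_ge0 btlC p_gt0 p_le1 (ltW delta_gt0)
  delta_le deltaE ell_q (c := fun i j => btl i j * u i) (eps := epsc)) => //.
- move=> i j x ij; have /andP[z0 z1] := edge_itv R x.
  have /andP[y0 y1] := ycoord_itv R L_gt0 i j x.
  rewrite /spectral_coef -mulrA mulr_ge0 ?mulr_ge0 // ?(ltW (u_gt0 i)) //=.
  by rewrite ler_piMr // mulr_ile1 ?u_le1 // ltW // u_gt0.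
- move=> i j ij; under eq_bigr do rewrite mulrA.
  by rewrite -mulr_suml (E_edge_y e0 L_gt0 p btlC ij) mulrA.
- move=> i j x ij; have /andP[z0 z1] := edge_itv R x.
  rewrite /spectral_coef -[leRHS](_ : edge R x * (ycoord R i j x * u i + ycoord R j i x * u j) = _); last by ring.
  rewrite [leLHS]mulrC; apply: ler_wpM2l => //.
  have := ycoordC R x ij; have /andP[y0 y1] := ycoord_itv R L_gt0 i j x.
  set y := ycoord _ _ _ _ in y0 y1 *; set y' := ycoord _ _ _ _ => yy.
  have -> : y' = 1 - y by rewrite -yy; ring.
  have /andP[ui _] := u_itv i; have /andP[uj _] := u_itv j.
  (* The conductance is a convex combination of u_i and u_j whatever the outcome, hence at least
     k. *)
  have : y * k <= y * u i by apply: ler_wpM2l.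
  have : (1 - y) * k <= (1 - y) * u j by apply: ler_wpM2l => //; rewrite subr_ge0.
  rewrite /ks; have := k_gt0; lra.
- by move=> i j; rewrite /btl [u j + u i]addrC; ring.
- move=> i j ij; have ui := u_gt0 i; have uj := u_gt0 j.
  have /andP[ki u1] := u_itv i; have /andP[kj uj1] := u_itv j.
  rewrite /btl mulrAC ler_pdivlMr // ler_pdivrMr // mul1r /kc.
  apply/andP; split; last first.
    apply: (@le_trans _ _ (u j)); last by rewrite lerDr ltW.
    by rewrite ler_piMr // ltW.
  have : k * u i <= u j * u i by rewrite ler_pM2r.
  have : k * u j <= u i * u j by rewrite ler_pM2r.
  have : 0 < u j * u i by exact: mulr_gt0.
  rewrite [u i * u j]mulrC; lra.
- by move=> i j; rewrite /spectral_noise addrC.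
- move=> i j; rewrite /spectral_noise normrN gtr0_norm //.
  have := u_le1 i; have := u_le1 j; lra.
- by rewrite big1.
- move=> i /=; rewrite normr0; apply: mulr_ge0; last exact: ltW.
  by apply: mulr_ge0; [exact: biasc_ge0 | exact: ltW].
Qed.

Lemma mle_wc_whp :
  Pr W (fun om => ~ mle_wc om) <= 14 * n%:R ^+ 2 * expR (- (8 * ell)).
Proof.
have uu0 i j : 0 < u i + u j by rewrite addr_gt0 ?u_gt0.
have b1 i j : btl i j <= 1 by rewrite -(btlC i j) lerDl btl_ge0.
have bk i j : k / 2 <= btl i j.
  have /andP[ki u1] := u_itv i; have /andP[kj uj1] := u_itv j.
  rewrite ler_pdivlMr //.
  have : k * (u i + u j) <= k * 2 by rewrite ler_pM2l //; lra.
  lra.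
have ck i j : kc <= btl i j * btl j i <= 1.
  apply/andP; split; last by rewrite mulr_ile1 ?btl_ge0.
  have h := bk i j; have h' := bk j i; have := btlC i j => E.
  have -> : btl j i = 1 - btl i j by rewrite -E; ring.
  have h2 : btl i j <= 1 - k / 2 by move: h'; lra.
  (* For b in [k/2, 1 - k/2] the product b (1 - b) is at least k/2 - k^2/4, which is at least k/4 as
     k <= 1. *)
  have : 0 <= (btl i j - k / 2) * (1 - k / 2 - btl i j) by rewrite mulr_ge0 ?subr_ge0.
  have : k * k <= 1 * k by rewrite ler_pM2r.
  rewrite /kc; lra.
apply: (well_conditioned_whp (e0 := e0) n_gt1 L_gt0 btl_ge0 btlC p_gt0 p_le1 (ltW delta_gt0)
  delta_le deltaE ell_q (c := fun i j => btl i j * btl j i) (eps := epsc)) => //.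
- move=> i j x ij; have /andP[z0 z1] := edge_itv R x; have /andP[c0 c1] := ck i j.
  rewrite /mle_coef; apply/andP; split; last by rewrite ler_piMr.
  by apply: mulr_ge0 => //; apply: mulr_ge0; exact: btl_ge0.
- move=> i j ij; under eq_bigr do rewrite mulrA.
  by rewrite -mulr_suml E_edge.
- move=> i j x ij; have /andP[z0 z1] := edge_itv R x; have /andP[c0 c1] := ck i j.
  rewrite /mle_coef -mulrDr [leLHS]mulrC; apply: ler_wpM2l => //.
  by rewrite [btl j i * _]mulrC; move: c0; rewrite /ks /kc; lra.
- by move=> i j; rewrite mulrC.
- by move=> i j; rewrite normrN normr1 ler1n.
- by rewrite -mulr_sumr theta0_sum0 mulr0.
- move=> i; rewrite normrM (gtr0_norm lam_gt0) /lam /biasc.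
  rewrite (_ : clam * _ * q * delta = clam * q * delta * - exp.ln k); last by ring.
  by apply: ler_wpM2l; [exact: ltW | exact: theta0_le].
Qed.

Lemma recovery_whp :
  Pr W (fun om => ~ (spectral_ok om /\ mle_ok om)) <= 28 * n%:R ^+ 2 * expR (- (8 * ell)).
Proof.
have Wge0 := pairw_ge0 (L := L) btl_ge0 btlC p_gt0 p_le1.
apply: (@le_trans _ _ (Pr W (fun om => ~ spectral_wc om \/ ~ mle_wc om))).
  apply: (le_Pr Wge0) => om h; apply: contrapT => h'; apply: h.
  have [h1 h2] : spectral_wc om /\ mle_wc om by split; apply: contrapT => h; apply: h'; [left|right].
  by split; [exact: spectral_wc_ok | exact: mle_wc_ok].
apply: le_trans (Pr_or Wge0 _ _) _.
have := lerD spectral_wc_whp mle_wc_whp; lra.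
Qed.

End Recovery.

(** * Transfer to the sample space *)

Section Bridge.
Local Open Scope ring_scope.
Notation R := Rdefinitions.R.

Lemma RsumE (T : finType) (F : T -> R) : Rsum F = \sum_x F x.
Proof. by []. Qed.

Lemma RprodE (T : finType) (F : T -> R) : Rprod F = \prod_x F x.
Proof. by []. Qed.

Variables (n L : nat) (e0 : pairT n).
Hypothesis L_gt0 : (0 < L)%N.
Notation pr := (pairof e0).
Notation X := (bool * {ffun 'I_L -> bool})%type.

(** The sample space separates the graph from the outcomes; the leave-one-out argument needs the
    data grouped by pair. *)
Definition regroup (om : Omega n L) : {ffun pairT n -> X} :=
  [ffun e => (om.1 e, [ffun l => om.2 (e, l)])].

Lemma regroup_bij : bijective regroup.
Proof.
exists (fun om : {ffun pairT n -> X} => ([ffun e => (om e).1], [ffun el => (om el.1).2 el.2]) : Omega n L).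
  by case=> g z; congr (_, _); [apply/ffunP => e|apply/ffunP => -[e l]]; rewrite !ffunE /= ?ffunE.
move=> om; apply/ffunP => e; rewrite !ffunE /=; case E : (om e) => [b z] /=.
by congr (_, _); apply/ffunP => l; rewrite !ffunE /= E.
Qed.

Lemma weight_regroup p (w : nat -> R) (om : Omega n L) :
  weight p w om = prodw (pairw (fun i j => ystar w i j) p) (regroup om).
Proof.
rewrite /weight RmultE !RprodE /prodw /pairw /coordw big_split /=; congr (_ * _).
  by apply: eq_bigr => e _; rewrite ffunE.
rewrite pair_bigA /=; apply: eq_bigr => -[e l] _ /=.
by rewrite !ffunE.
Qed.

Lemma Prob_regroup p (w : nat -> R) (E : Omega n L -> Prop) (E' : {ffun pairT n -> X} -> Prop) b :
  (forall e x, 0 <= @pairw R n L (fun i j => ystar w i j) p e x) ->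
  (forall e, \sum_x @pairw R n L (fun i j => ystar w i j) p e x = 1) ->
  (forall om, E' (regroup om) -> E om) ->
  Pr (@pairw R n L (fun i j => ystar w i j) p) (fun om => ~ E' om) <= b ->
  1 - b <= Prob p w E.
Proof.
move=> W0 W1 EE hb.
apply: (@le_trans _ _ (Pr (@pairw R n L (fun i j => ystar w i j) p) E')).
  by apply: (le_trans _ (Pr_compl W1 E')); rewrite lerB.
rewrite /Pr (reindex regroup) /=; last exact: onW_bij regroup_bij.
rewrite /Prob RsumE [leLHS]big_mkcond /=; apply: ler_sum => om _.
rewrite weight_regroup; case: ClassicalDescription.excluded_middle_informative => h.
  by case: ifP => // _; exact: prodw_ge0.
by case: asboolP => // /EE.
Qed.

Lemma adj_regroup (om : Omega n L) i j : i != j -> adj om i j = (regroup om (pr i j)).1.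
Proof.
rewrite /adj /pedge /regroup ffunE /pairof -(inj_eq val_inj) /= neq_ltn => /orP[] ij.
  by rewrite insubT /= insubF ?orbF //= ltnNge ltnW.
by rewrite insubF ?insubT //= ltnNge ltnW.
Qed.

Lemma adj_irrefl (om : Omega n L) i : adj om i i = false.
Proof. by rewrite /adj /pedge insubF //= ltnn. Qed.

Lemma yavg_regroup (om : Omega n L) e : yavg om e = avg R (regroup om e).2.
Proof.
rewrite /yavg RsumE /avg !RealsE div1r mulrC; congr (_ * _).
by apply: eq_bigr => l _; rewrite !ffunE; case: (om.2 _).
Qed.

Lemma yhat_regroup (om : Omega n L) i j : i != j ->
  yhat om i j = ycoord R i j (regroup om (pr i j)).
Proof.
rewrite /yhat /ycoord /pairof -(inj_eq val_inj) /= neq_ltn => /orP[] ij.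
  by rewrite ij insubT yavg_regroup.
by rewrite [(i < j)%N]ltnNge ltnW //= insubF ?insubT ?yavg_regroup //= ltnNge ltnW.
Qed.

(* The normalization d cancels from the stationarity equation. *)
Lemma stationary_flow d (om : Omega n L) (pi : 'I_n -> R) : d != 0 ->
  stationary d om pi <->
  \sum_i pi i = 1 /\ forall j, flow (spectral_flow R e0 (regroup om)) pi j = 0.
Proof.
move=> d0; rewrite /stationary RsumE.
have rate i j : spectral_flow R e0 (regroup om) i j = if adj om i j then yhat om i j else 0.
  rewrite /spectral_flow /cmat; case: eqVneq => [->|ij]; first by rewrite adj_irrefl.
  by rewrite adj_regroup // yhat_regroup // /edge; case: (_).1; rewrite ?mul1r ?mul0r.
set r := spectral_flow _ _ _ in rate *.
have PE i j : Pmat d om i j = (i == j)%:R * (1 - (\sum_k r i k) / d) + r i j / d.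
  rewrite /Pmat !RealsE RsumE; case: eqVneq => [<-|ij].
    rewrite rate adj_irrefl mul0r addr0 !mul1r mulrC; congr (1 - _ * _).
    by apply: eq_bigr => k _; rewrite rate.
  by rewrite mul0r add0r rate; case: ifP => _; rewrite ?mul0r.
have E j : \sum_i pi i * Pmat d om i j = pi j + flow r pi j / d.
  under eq_bigr do rewrite PE mulrDr.
  rewrite big_split /= (bigD1 j) //= eqxx mul1r [X in _ + X + _]big1 ?addr0; last first.
    by move=> i /negPf ->; rewrite mul0r mulr0.
  rewrite /flow sumrB mulrBl -mulr_suml mulrBr mulr1 mulrA [pi j * _]mulrC -addrA; congr (_ + _).
  rewrite addrC; congr (_ - _); rewrite mulr_suml; apply: eq_bigr => i _.
  by rewrite mulrA [pi i * _]mulrC.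
have RE j : Rsum (fun i => Rmult (pi i) (Pmat d om i j)) = \sum_i pi i * Pmat d om i j.
  by rewrite RsumE.
split=> -[h1 h2]; split=> // j.
  have := h2 j; rewrite RE E => /eqP; rewrite -subr_eq0 addrC addKr mulf_eq0 invr_eq0 (negPf d0) orbF.
  by move/eqP.
by rewrite RE E h2 mul0r addr0.
Qed.

Lemma sum_pairs (F : 'I_n -> 'I_n -> R) : (forall i j, F i j = F j i) ->
  (forall i, F i i = 0) ->
  \sum_(e : pairT n) F (val e).1 (val e).2 = 2^-1 * \sum_i \sum_j F i j.
Proof.
move=> Fs F0.
have -> : \sum_(e : pairT n) F (val e).1 (val e).2 = \sum_(x : 'I_n * 'I_n | (x.1 < x.2)%N) F x.1 x.2.
  rewrite [RHS](reindex_omap (val : pairT n -> 'I_n * 'I_n) insub) /=; last first.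
    by move=> x x12; rewrite insubT.
  by apply: eq_bigl => -[x x12] /=; rewrite insubT /= eqxx andbT x12.
have -> : \sum_i \sum_j F i j = \sum_(x : 'I_n * 'I_n) F x.1 x.2 by rewrite pair_bigA.
rewrite [X in _ = _ * X](bigID (fun x : 'I_n * 'I_n => (x.1 < x.2)%N)) /=.
rewrite [X in _ = _ * (_ + X)](bigID (fun x : 'I_n * 'I_n => (x.2 < x.1)%N)) /=.
rewrite [X in _ = _ * (_ + (_ + X))]big1; last first.
  by move=> [i j] /=; rewrite -!leqNgt -eqn_leq => /eqP/val_inj ->.
rewrite addr0 [X in _ = _ * (_ + X)](reindex_inj (h := fun x : 'I_n * 'I_n => (x.2, x.1))) /=; last first.
  by move=> [i j] [i' j'] [-> ->].
set S := \sum_(x : 'I_n * 'I_n | (x.1 < x.2)%N) _.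
have -> : \sum_(j : 'I_n * 'I_n | ~~ (j.2 < j.1)%N && (j.1 < j.2)%N) F j.2 j.1 = S.
  apply: eq_big => [[i j]|[i j] _] /=; last exact: Fs.
  by case: (ltnP j i) => //= ij; rewrite ltnNge ltnW.
by field.
Qed.

(** [softplusN] and the complementarity of outcomes make the loss of an edge independent of its
    orientation, so [sum_pairs] applies. *)
Lemma Lreg_objective lam (om : Omega n L) th :
  Lreg lam om th = objective (edge_mat R e0 (regroup om)) (outcome R e0 (regroup om)) lam th.
Proof.
rewrite /Lreg /objective !RealsE; congr (_ + _); last first.
  by rewrite RsumE; congr (_ * _); apply: eq_bigr => i _; rewrite RealsE.
rewrite -sum_pairs; last first.
- by move=> i; rewrite /edge_mat /cmat eqxx mul0r.
- move=> i j; rewrite /edge_mat /cmat eq_sym; case: eqVneq => [_|ij]; first by rewrite !mul0r.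
  rewrite /outcome (pairofC e0 ij) -(opprB (th j)) softplusN; congr (_ * _).
  have := ycoordC R (regroup om (pr i j)) ij; set y := ycoord _ _ _ _; set y' := ycoord _ _ _ _.
  move=> yy; have -> : y' = 1 - y by rewrite -yy; ring.
  by ring.
rewrite /Lfun RsumE; apply: eq_bigr => e _; have e12 := valP e.
set i := (val e).1 in e12 *; set j := (val e).2 in e12 *.
have ij : i != j by rewrite -(inj_eq val_inj) /= neq_ltn e12.
have eE : pr i j = e by apply: val_inj; rewrite pairof_lt // /i /j; case: (val e).
rewrite /edge_mat /cmat (negPf ij) /outcome eE /edge /ycoord e12 yavg_regroup.
rewrite {1 2}/regroup ffunE /=; case: (om.1 e); last by rewrite mul0r.
by rewrite !RealsE mul1r /softplus mulNr addrC.
Qed.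
End Bridge.

(** * Choice of constants and exact recovery *)

Section TopK.
Local Open Scope ring_scope.
Notation R := Rdefinitions.R.

Lemma ln_ge_half n : (1 < n)%N -> 2^-1 <= exp.ln n%:R :> R.
Proof.
move=> n1; have n0 : 0 < n%:R :> R by rewrite ltr0n ltnW.
rewrite -ler_expR lnK ?posrE //; apply: le_trans (expR_le_quadratic (lexx _)) _.
apply: (@le_trans _ _ 2); last by rewrite ler_nat.
by rewrite le_eqVlt; apply/orP; left; apply/eqP; field.
Qed.

Lemma expR_ln_pow n (m : nat) : (0 < n)%N -> expR (- (m%:R * exp.ln n%:R)) = n%:R ^- m :> R.
Proof. by move=> n0; rewrite expRN expRM_natl lnK // posrE ltr0n. Qed.

Lemma le_of_sqr_le (x y : R) : 0 <= y -> x ^+ 2 <= y ^+ 2 -> x <= y.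
Proof.
move=> y0; rewrite -(ger0_norm (sqr_ge0 x)) normrX => h.
apply: le_trans (ler_norm x) _.
by rewrite -ler_sqr ?nnegrE.
Qed.

Lemma topk_recovery (kappa0 cd clam : R) : 1 <= kappa0 -> 0 < cd -> 0 < clam ->
  exists c0 c1 : R, [/\ 0 < c0, 0 < c1 &
  forall (n K L : nat) (p wmin wmax : R) (w : nat -> R),
    0 < wmin -> (forall i, (i < n)%N -> wmin <= w i <= wmax) ->
    (forall i j, (i <= j)%N -> (j < n)%N -> w j <= w i) ->
    wmax / wmin <= kappa0 -> (1 <= K)%N -> (K < n)%N -> (0 < L)%N -> p <= 1 ->
    c0 * exp.ln n%:R / n%:R < p ->
    c1 * n%:R * exp.ln n%:R <=
      ((w (K - 1)%N - w K) / wmax) ^+ 2 * (n%:R ^+ 2 * p * L%:R / 2) ->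
    1 - 28 / n%:R ^+ 5 <= Prob p w (fun om : Omega n L =>
      spectral_success K (cd * n%:R * p) om /\
      mle_success K (clam * Num.sqrt (n%:R * p * exp.ln n%:R / L%:R)) om)].
Proof.
move=> kappa1 cd0 clam0; pose k := kappa0^-1.
have kp : 0 < kappa0 by exact: lt_le_trans kappa1.
have k0 : 0 < k by rewrite invr_gt0.
have k1 : k <= 1 by rewrite invf_le1.
pose eps := epsc k; pose err := errc k clam; pose gapm := 4 * err + 32 * err ^+ 2 / clam.
have eps0 : 0 < eps.
  apply: divr_gt0 => //; apply: mulr_gt0; last exact: divr_gt0.
  by apply: divr_gt0 => //; apply: exprn_gt0; exact: divr_gt0.
(* The summands yield, in order, [ell_q] together with [d_le], then [q_conc], then [err_le]. *)
pose c0 := 512 + 64 / eps ^+ 2 + 16 * err ^+ 2.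
(* The squares are the score gaps, in units of delta, that the MLE and the spectral method require;
   the 1 makes the comparison strict. *)
pose c1 := gapm ^+ 2 + (2 * err) ^+ 2 + 1.
have e2 : 0 < 64 / eps ^+ 2 by rewrite divr_gt0 // exprn_gt0.
have err2 := sqr_ge0 err.
have c0p : 0 < c0 by rewrite /c0; lra.
have c1p : 0 < c1 by rewrite /c1; have := sqr_ge0 gapm; have := sqr_ge0 (2 * err); lra.
exists c0, c1; split=> // n K L p wmin wmax w wmin0 wb wmon kap K1 Kn L0 p1 hp hsep.
have n1 : (1 < n)%N by exact: leq_ltn_trans Kn.
have n0 : (0 < n)%N by exact: ltnW.
have np : 0 < n%:R :> R by rewrite ltr0n.
have Lp : 0 < L%:R :> R by rewrite ltr0n.
have wmax0 : 0 < wmax.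
  by have /andP[h1 h2] := wb 0 n0; apply: lt_le_trans wmin0 (le_trans h1 h2).
set l := exp.ln n%:R in hp hsep *.
have l2 : 2^-1 <= l by exact: ln_ge_half.
have l0 : 0 < l by lra.
have p0 : 0 < p by apply: lt_trans hp; rewrite divr_gt0 // mulr_gt0.
pose q := n%:R * p; have q0 : 0 < q by exact: mulr_gt0.
have hq : c0 * l < q by rewrite /q [n%:R * p]mulrC -ltr_pdivrMr.
have qL0 : 0 < q * L%:R by exact: mulr_gt0.
pose delta := Num.sqrt (l / (q * L%:R)).
have dpos : 0 < delta by rewrite sqrtr_gt0 divr_gt0.
have d2 : delta ^+ 2 = l / (q * L%:R) by rewrite sqr_sqrtr // ltW // divr_gt0.
have deltaE : q * L%:R * delta ^+ 2 = l by rewrite d2 mulrC divfK // gt_eqF.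
have d2c : c0 * delta ^+ 2 <= 1.
  rewrite d2 mulrA ler_pdivrMr // mul1r; apply: le_trans (ltW hq) _.
  by rewrite ler_peMr ?ler1n // ltW.
have d20 : 0 < delta ^+ 2 by rewrite exprn_gt0.
have t1 : 0 <= 64 / eps ^+ 2 * delta ^+ 2 by rewrite mulr_ge0 // ltW.
have t2 : 0 <= err ^+ 2 * delta ^+ 2 by rewrite mulr_ge0 // ltW.
have d_le : delta <= 4^-1.
  apply: le_of_sqr_le; first by rewrite invr_ge0.
  by move: d2c; rewrite /c0 expr2; lra.
have err_le : err * delta <= 4^-1.
  apply: le_of_sqr_le; first by rewrite invr_ge0.
  by rewrite [(err * delta) ^+ 2]exprMn; move: d2c; rewrite /c0; lra.
have t3 : 0 < 64 / eps ^+ 2 * l by rewrite mulr_gt0.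
have t4 : 0 <= err ^+ 2 * l by rewrite mulr_ge0 // ltW.
have ell_q : 512 * l <= q by move: hq; rewrite /c0; lra.
have q_conc : 64 * l <= eps ^+ 2 * q.
  have : 64 / eps ^+ 2 * l <= q by move: hq; rewrite /c0; lra.
  rewrite -(ler_pM2l (exprn_gt0 2 eps0)); apply: le_trans.
  by rewrite le_eqVlt; apply/orP; left; apply/eqP; field; rewrite gt_eqF.
have eps_q : 1 <= eps ^+ 2 * q by lra.
have nexp m : expR (- (m%:R * l)) = n%:R ^- m by rewrite expR_ln_pow.
have n2 : 2 <= n%:R :> R by rewrite ler_nat.
have n_ell : n%:R * expR (- (8 * l)) <= 2^-1.
  rewrite (nexp 8) exprS invfM mulrA divff ?gt_eqF // mul1r lef_pV2 ?posrE ?exprn_gt0 //.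
  by rewrite exprS -[leLHS]mulr1; apply: ler_pM => //; rewrite exprn_ege1 // ler1n.
pose u (i : 'I_n) := w i / wmax.
have u_itv i : k <= u i <= 1.
  have /andP[h1 h2] := wb i (ltn_ord i).
  rewrite ler_pdivlMr // ler_pdivrMr // mul1r h2 andbT; apply: le_trans h1.
  by rewrite /k mulrC ler_pdivrMr // mulrC -ler_pdivrMr.
have wpos (i : 'I_n) : 0 < w i.
  by have /andP[h1 _] := wb i (ltn_ord i); exact: lt_le_trans h1.
have ysE : (fun i j : 'I_n => ystar w i j) = btl u.
  apply/funext => i; apply/funext => j; rewrite /ystar /btl /u !RealsE.
  by field; rewrite !gt_eqF // addr_gt0.
pose e0 : pairT n := exist _ (Ordinal n0, Ordinal n1) isT.
have ys_ge0 := btl_ge0 k0 u_itv; have ysC := btlC k0 u_itv.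
(* The prescribed ridge parameter is exactly of the order q * delta assumed in the analysis. *)
have lamE : clam * Num.sqrt (q * l / L%:R) = clam * q * delta.
  rewrite -[RHS]mulrA; congr (_ * _).
  have qd : 0 <= q * delta by apply: mulr_ge0; exact: ltW.
  rewrite -[RHS](ger0_norm qd).
  rewrite -sqrtr_sqr [(q * delta) ^+ 2]exprMn d2; congr Num.sqrt; field.
  by rewrite !gt_eqF.
have gap (i j : 'I_n) c : (i < K)%N -> (K <= j)%N -> c ^+ 2 < c1 -> c * delta < u i - u j.
  move=> iK Kj hc.
  have K1n : (K - 1 < n)%N by apply: leq_ltn_trans Kn; exact: leq_subr.
  set D := (w (K - 1)%N - w K) / wmax in hsep.
  have D0 : 0 <= D.
    by rewrite divr_ge0 ?subr_ge0 ?(ltW wmax0) //; apply: wmon => //; exact: leq_subr.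
  have Dle : D <= u i - u j.
    rewrite /D /u -mulrBl ler_pM2r ?invr_gt0 //=; apply: lerB; apply: wmon => //.
    by rewrite -ltnS subn1 prednK.
  apply: lt_le_trans Dle.
  (* The sample-size condition divided by n q L / 2; the 2 comes from the expected number n^2 p / 2
     of edges. *)
  have hD : 2 * c1 * delta ^+ 2 <= D ^+ 2.
    rewrite d2 mulrA ler_pdivrMr //.
    have -> : 2 * c1 * l = 2 / n%:R * (c1 * n%:R * l) by field; rewrite gt_eqF.
    apply: le_trans (ler_wpM2l _ hsep) _; first by rewrite divr_ge0.
    by rewrite le_eqVlt; apply/orP; left; apply/eqP; rewrite /q; field; rewrite gt_eqF.
  rewrite ltNge; apply/negP => hcd.
  have : D ^+ 2 <= (c * delta) ^+ 2.
    by apply: lerXn2r => //; rewrite nnegrE //; exact: le_trans hcd.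
  apply/negP; rewrite -ltNge; apply: lt_le_trans hD.
  rewrite exprMn ltr_pM2r //; apply: lt_trans hc _; lra.
have -> : (fun om : Omega n L => spectral_success K (cd * n%:R * p) om /\
      mle_success K (clam * Num.sqrt (n%:R * p * l / L%:R)) om) =
    (fun om => spectral_success K (cd * n%:R * p) om /\ mle_success K (clam * q * delta) om).
  exact: (congr1 (fun z : R => fun om : Omega n L =>
    spectral_success K (cd * n%:R * p) om /\ mle_success K z om) lamE).
apply: (@Prob_regroup n L p w _
   (fun om => spectral_ok e0 u k clam delta om /\ mle_ok e0 u p k clam delta om)).
- by rewrite ysE => e x; apply: pairw_ge0.
- by rewrite ysE => e; exact: pairw_sum.
- move=> om [[sp1 sp2] [ml1 ml2]].
  have d_neq0 : cd * n%:R * p != 0 by rewrite gt_eqF // !mulr_gt0.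
  split; split.
  + by case: sp1 => pi hpi; exists pi; apply/(stationary_flow e0 om pi d_neq0).
  + move=> pi /(stationary_flow e0 om pi d_neq0) [pi1 fpi] i j iK Kj; apply/RltP.
    apply: sp2 => //; rewrite mulrA; apply: gap => //.
    by rewrite -/err /c1; have := sqr_ge0 gapm; lra.
  + case: ml1 => th hth; exists th => th'; apply/RleP.
    by rewrite !(Lreg_objective e0); exact: hth.
  + move=> th hth i j iK Kj; apply/RltP; apply: (ml2 th) => [th'|].
      by rewrite -!(Lreg_objective e0); apply/RleP; exact: hth.
    by apply: gap => //; rewrite -/err -/gapm /c1; have := sqr_ge0 (2 * err); lra.
rewrite ysE.
apply: le_trans (recovery_whp e0 (k := k) (clam := clam) n1 L0 k0 k1 u_itv p0 p1 clam0
  dpos d_le deltaE ell_q eps_q q_conc n_ell err_le) _.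
(* With ell = ln n the failure bound is 28 n^2 n^-8, and n^2 <= n^3 brings it to 28 n^-5. *)
rewrite (nexp 8) -mulrA; apply: ler_wpM2l => //.
rewrite (_ : n%:R ^- 5 = n%:R ^+ 3 / n%:R ^+ 8); last by field; rewrite gt_eqF.
apply: ler_wpM2r; first by rewrite invr_ge0 exprn_ge0 // ltW.
by apply: ler_weXn2l => //; rewrite ler1n.
Qed.

End TopK.

Local Open Scope R_scope.

Theorem theorem1 :
  forall (kappa0 c2 c3 cd clam : R),
    1 <= kappa0 -> 0 < c2 -> 0 < c3 -> 2 <= cd -> 0 < clam ->
  exists c0 c1 C : R, 0 < c0 /\ 0 < c1 /\ 0 < C /\
  forall (n K L : nat) (p wmin wmax : R) (w : nat -> R),
    0 < wmin ->
    (forall i : nat, (i < n)%nat -> wmin <= w i <= wmax) ->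
    (forall i j : nat, (i <= j)%nat -> (j < n)%nat -> w j <= w i) ->
    wmax / wmin <= kappa0 ->
    (1 <= K)%nat -> (K < n)%nat ->
    (0 < L)%nat ->
    p <= 1 ->
    c0 * ln (INR n) / INR n < p ->
    INR L <= c2 * Rpower (INR n) c3 ->
    c1 * INR n * ln (INR n) <=
      (DeltaK w wmax K) ^ 2 * (INR n ^ 2 * p * INR L / 2) ->
    Prob (L := L) p w
      (fun om : Omega n L =>
         spectral_success K (cd * INR n * p) om /\
         mle_success K (clam * sqrt (INR n * p * ln (INR n) / INR L)) om)
    >= 1 - C / INR n ^ 5.
Proof.
move=> kappa0 c2 c3 cd clam /RleP kappa1 _ _ cd2 /RltP clam0.
have /RltP cd0 := Rlt_le_trans _ _ _ Rlt_0_2 cd2.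
have [c0 [c1 [c0p c1p H]]] := topk_recovery kappa1 cd0 clam0.
exists c0, c1, (INR 28); split; first exact/RltP.
split; first exact/RltP.
split; first by apply/RltP; rewrite INRE.
move=> n K L p wmin wmax w /RltP wmin0 wb wmon /RleP kap K1 Kn L0 /RleP p1 /RltP hp _ /RleP hsep.
apply/Rle_ge/RleP; move: hp hsep; rewrite /DeltaK !RealsE => hp hsep.
apply: (H n K L p wmin wmax w) => //.
- by move=> i /wb [h1 h2]; apply/andP; split; exact/RleP.
- by move=> i j ij jn; apply/RleP; exact: wmon.
Qed.
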